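(* Let $E$ be a normed space of finite dimension. Then the isolated types in $K_C(E)$ are dense (in the topology of point-wise convergence) if either of the following holds: (1) Every face of $B(E^* )$ of dimension at most $\dim E - 2$ is a simplex. This holds in particular whenever $\dim E \leq 3$. Special cases of this include: (1a) Every proper face of $B(E^* )$ is a simplex. This holds in particular whenever $\dim E \leq 2$. In this case the separable Gurarij space $\mathbf{G}$ is atomic over $E \subseteq \mathbf{G}$ (for an isometric inclusion) if and only if every $\lambda \in E^*$ admits a unique extension of the same norm to $\mathbf{G}$. (1b) The space $E$ is smooth, i.e., every nonzero $v \in E$ is smooth in $E$. In this case $\mathbf{G}$ is atomic over $E \subseteq \mathbf{G}$ if and only if every nonzero $v \in E$ is smooth in $\mathbf{G}$. (2) The space $E$ is polyhedral.
   Context: All spaces are real; embeddings of normed spaces are linear and isometric. $B(E^* )$ is the closed unit ball of the dual $E^*$. For a convex set $X$, a convex subset $F \subseteq X$ is a face of $X$ if no member of $F$ can be expressed as a proper convex combination of two points of $X$ that are not both in $F$; it is a proper face if $F \neq X$. The dimension of a face is that of its affine span. A simplex is the convex hull of a finite affinely independent set. $E$ is polyhedral if its unit ball is a polytope. A norming linear functional for $v \in E \setminus \{0\}$ is $\lambda \in E^*$ with $\|\lambda\|=1$ and $\lambda v = \|v\|$; $v$ is smooth in $E$ if its norming linear functional is unique. Types. For a Banach space $E$ and $n \in \mathbb{N}$, let $E(n) = E \oplus \bigoplus_{i<n} \mathbb{R} x_i$, with formal variables $x_i$. The space of $n$-types $S_n(E)$ is the set of all semi-norms on $E(n)$ extending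 the norm of $E$; the semi-norm corresponding to $\xi \in S_n(E)$ is written $\|\cdot\|^\xi$. If $E \subseteq F$ are Banach spaces and $\bar a \in F^n$, then $\mathrm{tp}(\bar a/E) \in S_n(E)$ is the semi-norm $b + \sum \lambda_i x_i \mapsto \| b + \sum \lambda_i a_i \|$; $\bar a$ realises $\xi$ if $\xi = \mathrm{tp}(\bar a/E)$. The topology on $S_n(E)$ is the least one making $\xi \mapsto \|x\|^\xi$ continuous for every $x \in E(n)$. The distance $d(\xi,\zeta)$ is the infimum, over all Banach spaces $F \supseteq E$ and all realisations $\bar a,\bar b \in F^n$ of $\xi,\zeta$ respectively, of $\sup_i \|a_i - b_i\|$. A type $\xi$ is isolated if every metric neighbourhood of $\xi$ is also a neighbourhood of $\xi$ in the topology. For $E \subseteq F$, $F$ is atomic over $E$ if the type over $E$ of every finite tuple in $F$ is isolated. $K_C(E)$ is the set of convex functions $f \colon E \to \mathbb{R}$ with $f(x) \leq f(y) + \|x-y\|$ and $\|x-y\| \leq f(x)+f(y)$ for all $x,y \in E$, with the topology of point-wise convergence and the supremum distance. It is identified with $S_1(E)$ via $\xi \mapsto (a \mapsto \|x-a\|^\xi)$, a homeomorphism and an isometry; thus $f\in K_C(E)$ is isolated if every neighbourhood of $f$ for the supremum distance is a neighbourhood for point-wise convergence. A Gurarij space is a Banach space $G$ such that for any $\varepsilon > 0$, finite-dimensional Banach spaces $E \subseteq F$ and isometric embedding $\varphi \colon E \to G$, there is a linear map $\psi \colon F \to G$ extending $\varphi$ with $(1-\varepsilon)\|x\| \leq \|\psi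 x\| \leq (1+\varepsilon)\|x\|$ for all $x \in F$. The separable Gurarij space exists and is unique up to isometric isomorphism; it is denoted $\mathbf{G}$. *)

(* Defs.v *)
From HB Require Import structures.
From mathcomp Require Import all_boot all_order all_algebra.
From mathcomp Require Import all_classical all_reals all_analysis.

Set Implicit Arguments.
Unset Strict Implicit.
Unset Printing Implicit Defensive.

Import Order.TTheory GRing.Theory Num.Theory.
Import numFieldNormedType.Exports.

Local Open Scope classical_set_scope.
Local Open Scope ring_scope.

Section LinearAlgebra.
Context {R : realType}.
Implicit Type V : lmodType R.

Definition has_dim V (n : nat) : Prop :=
  exists b : 'I_n -> V, forall x : V,
    exists! c : 'rV[R]_n, x = \sum_(i < n) c 0 i *: b i.

Definition finite_dim V : Prop := exists n, has_dim V n.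

Definition affinely_independent V (n : nat) (v : 'I_n -> V) : Prop :=
  forall c : 'I_n -> R, \sum_(i < n) c i = 0 ->
    \sum_(i < n) c i *: v i = 0 -> forall i, c i = 0.

Definition affine_span V (A : set V) : set V :=
  [set x | exists (n : nat) (v : 'I_n -> V) (c : 'I_n -> R),
    [/\ forall i, A (v i), \sum_(i < n) c i = 1
      & x = \sum_(i < n) c i *: v i]].

(* The affine span of [A] has dimension [m], i.e. is spanned by [m.+1]
   affinely independent points; [set0] has no dimension in this sense. *)
Definition affine_dim V (A : set V) (m : nat) : Prop :=
  exists v : 'I_m.+1 -> V,
    affinely_independent v /\ affine_span (range v) = affine_span A.

Definition convex_hull V (A : set V) : set V := smallest (@convex_set R V) A.

Definition polytope V (A : set V) : Prop :=
  exists2 B : set V, finite_set B & A = convex_hull B.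

(* [set0] is a simplex, with [n = 0]. *)
Definition simplex V (A : set V) : Prop :=
  exists (n : nat) (v : 'I_n -> V),
    affinely_independent v /\ A = convex_hull (range v).

Definition face V (X F : set V) : Prop :=
  [/\ @convex_set R V F, F `<=` X &
    forall (x y : V) (t : R), X x -> X y -> 0 < t -> t < 1 ->
      F (t *: x + (1 - t) *: y) -> F x /\ F y].

Definition proper_face V (X F : set V) : Prop := face X F /\ F <> X.

End LinearAlgebra.

Section Duality.
Context {R : realType}.
Implicit Type E : normedModType R.

Definition unit_ball E : set E := [set x | `|x| <= 1].
Arguments unit_ball : clear implicits.

Definition dual_space E : set (E -> R^o) := [set l | linear l /\ continuous l].
Arguments dual_space : clear implicits.

Definition dual_norm E (l : E -> R^o) : R :=
  sup [set `|l x| | x in unit_ball E].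

Definition dual_ball E : set (E -> R^o) :=
  [set l | dual_space E l /\ dual_norm l <= 1].
Arguments dual_ball : clear implicits.

Definition norming E (v : E) (l : E -> R^o) : Prop :=
  [/\ dual_space E l, dual_norm l = 1 & l v = `|v|].

Definition smooth_at E (v : E) : Prop := exists! l : E -> R^o, norming v l.

Definition smooth_space E : Prop := forall v : E, v != 0 -> smooth_at v.

Definition polyhedral E : Prop := polytope (unit_ball E).

End Duality.
Arguments unit_ball {R} E _.
Arguments dual_space {R} E _.
Arguments dual_ball {R} E _.

(* An inclusion [E `<=` F] of normed spaces is rendered as a linear map
   [E -> F] which is isometric. *)
Definition isometric (R : realType) (E F : normedModType R)
  (f : {linear E -> F}) : Prop := forall x, `|f x| = `|x|.

Definition isolated_wrt (R : realType) (T : topologicalType)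
    (d : T -> T -> R) (x : T) : Prop :=
  forall e : R, 0 < e -> nbhs x [set y | d x y < e].

Section Types.
Context {R : realType}.

Definition seminorm (V : lmodType R) (p : V -> R) : Prop :=
  (forall x y, p (x + y) <= p x + p y) /\
  (forall (c : R) x, p (c *: x) = `|c| * p x).

(* [(b, c) : E * 'rV_n] stands for the element b + \sum_i c_i x_i of E(n). *)
Definition ntypes (E : normedModType R) (n : nat) :
    set {ptws (E * 'rV[R]_n)%type -> R} :=
  [set p | seminorm (p : E * 'rV[R]_n -> R) /\ forall b : E, p (b, 0) = `|b|].
Arguments ntypes : clear implicits.

Definition tp_fun (E F : normedModType R) (f : {linear E -> F}) (n : nat)
    (a : 'I_n -> F) : {ptws (E * 'rV[R]_n)%type -> R} :=
  fun x => `|f x.1 + \sum_(i < n) x.2 0 i *: a i|.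

Lemma tp_subproof (E F : normedModType R) (f : {linear E -> F})
    (hf : isometric f) (n : nat) (a : 'I_n -> F) :
  tp_fun f a \in ntypes E n.
Proof.
rewrite inE; split; last first.
  move=> b; rewrite /tp_fun /= big1 ?addr0 ?hf// => i _.
  by rewrite mxE scale0r.
split=> [x y|c x]; rewrite /tp_fun /=.
  apply: le_trans (ler_normD _ _); rewrite raddfD addrACA -big_split/=.
  rewrite (eq_bigr (fun i => x.2 0 i *: a i + y.2 0 i *: a i))// => i _.
  by rewrite mxE scalerDl.
rewrite -normrZ scalerDr linearZ scaler_sumr.
rewrite (eq_bigr (fun i => c *: (x.2 0 i *: a i)))// => i _.
by rewrite mxE scalerA.
Qed.

Definition tp (E F : normedModType R) (f : {linear E -> F}) (hf : isometric f)
    (n : nat) (a : 'I_n -> F) : ntypes E n :=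
  exist _ (tp_fun f a) (tp_subproof hf a).

Definition type_dist (E : normedModType R) (n : nat) (xi zeta : ntypes E n) :
    R :=
  inf [set r | exists (F : completeNormedModType R) (f : {linear E -> F})
      (hf : isometric f) (a b : 'I_n -> F),
    [/\ tp hf a = xi, tp hf b = zeta
      & r = \big[Num.max/0]_(i < n) `|a i - b i|]].

Definition isolated_type (E : normedModType R) (n : nat) (xi : ntypes E n) :
  Prop := isolated_wrt (@type_dist E n) xi.

Definition atomic (E F : normedModType R) (f : {linear E -> F})
    (hf : isometric f) : Prop :=
  forall (n : nat) (a : 'I_n -> F), isolated_type (tp hf a).

Definition KC (E : normedModType R) : set {ptws E -> R} :=
  [set f | [/\ @convex_function R E setT f,
    forall x y : E, f x <= f y + `|x - y|
    & forall x y : E, `|x - y| <= f x + f y]].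
Arguments KC : clear implicits.

Definition KC_dist (E : normedModType R) (f g : KC E) : R :=
  sup (range (fun x : E => `|\val f x - \val g x|)).

Definition isolated_KC (E : normedModType R) : set (KC E) :=
  [set f | isolated_wrt (@KC_dist E) f].

End Types.
Arguments ntypes {R} E n _.
Arguments KC {R} E _.
Arguments isolated_KC {R} E _.

Section Gurarij.
Context {R : realType}.

Definition separable_space (T : topologicalType) : Prop :=
  exists2 A : set T, countable A & dense A.

Definition gurarij (G : completeNormedModType R) : Prop :=
  forall (e : R), 0 < e ->
  forall (E F : completeNormedModType R), finite_dim E -> finite_dim F ->
  forall (j : {linear E -> F}) (phi : {linear E -> G}),
    isometric j -> isometric phi ->
  exists psi : {linear F -> G},
    (forall x, psi (j x) = phi x) /\
    (forall x, (1 - e) * `|x| <= `|psi x| /\ `|psi x| <= (1 + e) * `|x|).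

Definition unique_extensions (E G : normedModType R) (i : {linear E -> G}) :
    Prop :=
  forall l : E -> R^o, dual_space E l ->
    exists! L : G -> R^o,
      [/\ dual_space G L, forall x, L (i x) = l x & dual_norm L = dual_norm l].

(* With [d = \dim E]: the faces of dimension at most [d - 2], a possibly
   negative bound, are simplices. *)
Definition small_faces_simplices (E : normedModType R) (d : nat) : Prop :=
  forall (F : set (E -> R^o)) (m : nat),
    face (dual_ball E) F -> affine_dim F m -> (m + 2 <= d)%N -> simplex F.

Definition proper_faces_simplices (E : normedModType R) : Prop :=
  forall F : set (E -> R^o), proper_face (dual_ball E) F -> simplex F.

End Gurarij.

(* Main.v *)
Require Import Defs.
From HB Require Import structures.
From mathcomp Require Import all_boot all_order all_algebra.
From mathcomp Require Import all_classical all_reals all_analysis.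
From mathcomp Require Import ring lra.

Import Order.TTheory GRing.Theory Num.Theory.
Import numFieldNormedType.Exports.
Local Open Scope classical_set_scope.
Local Open Scope ring_scope.

Set Implicit Arguments.
Unset Strict Implicit.
Unset Printing Implicit Defensive.

(** Write [B] for the unit ball of the dual of [E]. A Katetov function [f] (convex,
    1-Lipschitz, [`|x - y| <= f x + f y]) is a supremum of affine functions with
    slopes in [B], and its conjugate [l => sup_x (l x - f x)] is a convex function
    [h] on [B] with [h l + h (- l) <= 0]. A finite set of constraints
    [f x_j <= r_j] with [`|x_i - x_j| <= r_i + r_j] has a largest Katetov solution,
    its [envelope]. Thus finitely many values of [f] bound it from above by an
    envelope, and from below through the inequality [`|x - y| <= f x + f y]; if the two
    bounds are close to each other everywhere, [f] is nearly isolated.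

    Density. Fix a Katetov function and finitely many of its values; they give a
    maximum [g] of affine functions on [B] with [g l + g (- l) <= 0]. If the gap in
    this inequality were closed, the resulting constraints would determine their
    solution, since [f' x + f' y >= `|x - y|] is then as strong as the upper bounds.
    It is enough to close the gap on a set [S] of functionals which norms every
    vector. A set for which this can be done is a [gauge_boundary]: near a point
    of [S] there is an affine function between [g] and [l => - g (- l)]
    ([sandwiched]), and around the other points of [B] everything is controlled by
    convexity ([good]). Halving the gap repeatedly, in the manner of Edwards'
    separation theorem, gives [edwards]; compactness of [B] then leaves finitely
    many constraints, whose envelope is determined up to [e] by finitely many values
    ([approx_isolated]). A Baire category argument with [e] tending to [0] ends the
    proof ([dense_isolated]).

    For (1), [S] consists of the functionals which are normed by some [u] without
    lying inside a facet [{m in B | m u = 1}]. Such a point lies in a face of dimension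
    at most [d - 2], and on a simplex a convex function is dominated by the affine function
    with the same values at the vertices, which is the affine function required.
    For (2), [S] is the set of vertices of the polytope [B]; they are isolated
    points of [S], and a constant is the affine function required.

    Atomicity. Let proper faces be simplices, [a] a point of [G], [u] a unit vector
    and [F = {m in B | m u = 1}]. Extending the vertices of [F] to [G] and interpolating gives [x] in [E] such that
    the values at [a] of those extensions are the values at [x] of the vertices.
    Then [f y = `|a - y|] can be changed, by an arbitrarily small amount on any given
    finite set, into a Katetov function which is at most [k] at [x + k u] and [x - k u]
    ([pinched_kc]). If the type of [a] is isolated, [f] itself is almost as small
    there, so that [L a = L x] for every [L] of norm one with [L u = 1]: norm
    preserving extensions are unique ([atomic_unique]). Conversely, unique extension
    of [l] means that [`|a - x1| + `|a - x2|] comes arbitrarily close to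
    [l (x2 - x1)]; by compactness finitely many points serve all [l] of norm one,
    and they control [f] far away from the origin, a finite net controlling it
    elsewhere ([kc_rigid]). Types in several variables reduce to their
    one-variable slices along the combinations [\sum_i w_i a_i], and the distance
    between types is computed by amalgamating semi-norms ([seminorm_amalgam]).

    When [E] is smooth, a proper face of [B] has at most one point: the midpoint of
    two of its elements is normed by some vector, which then norms both. And unique
    extension of the functional which norms [v] is smoothness of [G] at the image of
    [v]. *)

(** * Hahn-Banach and the realisation of semi-norms *)

Section HahnBanach.
Context {R : realType} {V : lmodType R}.
Implicit Types (p q : V -> R).

(** Linearity with values in [R] itself rather than in the module [R^o], so that the
    values of a functional are plain reals. *)
Definition functional (l : V -> R) : Prop :=
  forall a x y, l (a *: x + y) = a * l x + l y.

Definition sublinear p : Prop :=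
  (forall x y, p (x + y) <= p x + p y) /\
  (forall t x, 0 <= t -> p (t *: x) = t * p x).

Lemma functional0 l : functional l -> l 0 = 0.
Proof. by move=> /(_ 1 0 0); rewrite scale1r addr0 mul1r => /eqP; rewrite -subr_eq subrr eq_sym => /eqP. Qed.

Lemma functionalD l x y : functional l -> l (x + y) = l x + l y.
Proof. by move=> /(_ 1 x y); rewrite scale1r mul1r. Qed.

Lemma functionalZ l a x : functional l -> l (a *: x) = a * l x.
Proof. by move=> fl; have := fl a x 0; rewrite addr0 functional0// addr0. Qed.

Lemma functionalN l x : functional l -> l (- x) = - l x.
Proof. by move=> fl; rewrite -scaleN1r functionalZ// mulN1r. Qed.

Lemma functionalB l x y : functional l -> l (x - y) = l x - l y.
Proof. by move=> fl; rewrite functionalD// functionalN. Qed.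

Lemma functional_sum l n (c : 'I_n -> R) (x : 'I_n -> V) : functional l ->
  l (\sum_i c i *: x i) = \sum_i c i * l (x i).
Proof.
move=> fl; elim/big_rec2 : _ => [|i y z _ <-]; first exact: functional0.
exact: fl.
Qed.

Lemma sublinear0 p : sublinear p -> p 0 = 0.
Proof. by move=> [_ /(_ 0 0 (lexx _))]; rewrite scale0r mul0r. Qed.

Lemma sublinear_ge p x : sublinear p -> - p (- x) <= p x.
Proof.
move=> sp; have := sp.1 x (- x).
by rewrite subrr sublinear0// => ?; lra.
Qed.

(** The indices need not be comparable: subadditivity of the infimum only asks that
    the value of some index at a sum lies below a given sum of values. The bound [c]
    makes the infima finite. *)
Lemma inf_sublinear (I : Type) (S : set I) (phi : I -> V -> R) (c : V -> R) :
  S !=set0 ->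
  (forall i x, S i -> c x <= phi i x) ->
  (forall i, S i -> 0 <= phi i 0) -> (exists2 i, S i & phi i 0 <= 0) ->
  (forall i j x y, S i -> S j ->
    exists2 k, S k & phi k (x + y) <= phi i x + phi j y) ->
  (forall i (t : R) x, S i -> 0 < t ->
    exists2 k, S k & phi k (t *: x) <= t * phi i x) ->
  let r x := inf [set phi i x | i in S] in
  sublinear r /\ (forall i x, S i -> r x <= phi i x).
Proof.
move=> [i0 Si0] lb z0 [i1 Si1 z1] sub hom r.
have rle i x : S i -> r x <= phi i x.
  by move=> Si; apply: ge_inf; [exists (c x) => _ [j Sj <-]; exact: lb|exists i].
have ler x a : (forall i, S i -> a <= phi i x) -> a <= r x.
  move=> h; apply: lb_le_inf; first by exists (phi i0 x), i0.
  by move=> _ [i Si <-]; exact: h.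
have hom1 t x : 0 < t -> r (t *: x) <= t * r x.
  move=> t0; rewrite -ler_pdivrMl//; apply: ler => i Si.
  have [k Sk hk] := hom i t x Si t0.
  by rewrite ler_pdivrMl//; exact: le_trans (rle k _ Sk) hk.
split=> //; split=> [x y|t x].
  rewrite -lerBlDr; apply: (ler x) => i Si; rewrite lerBlDl -lerBlDr.
  apply: (ler y) => j Sj; rewrite lerBlDr addrC.
  have [k Sk hk] := sub i j x y Si Sj.
  by rewrite addrC [leRHS]addrC; exact: le_trans (rle k _ Sk) hk.
rewrite le_eqVlt => /predU1P[<-|t0].
  rewrite scale0r mul0r; apply/eqP; rewrite eq_le.
  by rewrite (le_trans (rle i1 _ Si1) z1) ler.
apply/eqP; rewrite eq_le hom1//=.
have := hom1 t^-1 (t *: x); rewrite invr_gt0 scalerA mulVf ?gt_eqF// scale1r.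
by move=> /(_ t0); rewrite ler_pdivlMl.
Qed.

Let shift p a (t : R) x := p (x + t *: a) - t * p a.

(** The function [x => inf_(t >= 0) (p (x + t a) - t p a)] lies below [p] and is
    sublinear; it takes a value at most [- p a] at [- a], so that a [p] which
    cannot be decreased is odd at [a]. *)
Lemma shrink_sublinear p a : sublinear p ->
  exists q, [/\ sublinear q, forall x, q x <= p x & forall t x, 0 <= t ->
    q x <= p (x + t *: a) - t * p a].
Proof.
move=> sp.
have [||||||sq le] := @inf_sublinear _ [set t : R | 0 <= t] (shift p a) (fun x => - p (- x)).
- by exists 0 => /=.
- move=> t x /= t0; rewrite /shift.
  have := sp.1 (x + t *: a) (- x); rewrite addrAC subrr add0r sp.2// => ?.
  lra.
- by move=> t /= t0; rewrite /shift add0r sp.2// subrr.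
- by exists 0 => //=; rewrite /shift scale0r addr0 mul0r subr0 sublinear0.
- move=> s t x y /= s0 t0; exists (s + t); rewrite /= ?addr_ge0// /shift.
  have := sp.1 (x + s *: a) (y + t *: a).
  by rewrite scalerDl addrACA => ?; lra.
- move=> s t x /= s0 t0; exists (t * s); first by rewrite /= mulr_ge0// ltW.
  by rewrite /shift -scalerA -scalerDr sp.2 ?mulrBr ?mulrA//; exact: ltW.
exists (fun x => inf [set shift p a t x | t in [set t | 0 <= t]]); split => //.
  by move=> x; have := le 0 x (lexx _); rewrite /shift scale0r addr0 mul0r subr0.
Qed.

(** Zorn's lemma applies because the infimum of a chain of sublinear functions is
    sublinear. *)
Lemma sublinear_minimal p : sublinear p ->
  exists q, [/\ sublinear q, forall x, q x <= p x &
    forall q', sublinear q' -> (forall x, q' x <= q x) -> q' = q].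
Proof.
move=> sp.
pose D := {q | sublinear q /\ forall x, q x <= p x}.
pose le (q1 q2 : D) := `[< forall x, sval q2 x <= sval q1 x >].
have [||||[q [sq qp]] qmin] := @Zorn D le.
- by move=> t; apply/asboolP.
- move=> r s t /asboolP rs /asboolP st; apply/asboolP => x.
  exact: le_trans (st x) (rs x).
- move=> [s ?] [t ?] /asboolP /= st /asboolP /= ts; apply: eq_exist.
  by apply/funext => x; apply/eqP; rewrite eq_le st ts.
- move=> A totA; have [[q0 Aq0]|A0] := pselect (A !=set0); last first.
    exists (exist _ p (conj sp (fun=> lexx _))) => s As.
    by exfalso; apply: A0; exists s.
  have [||||||sr rle] := @inf_sublinear D A (fun (q : D) x => sval q x) (fun x => - p (- x)).
  + by exists q0.
  + move=> q x _; apply: le_trans (sublinear_ge _ (svalP q).1).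
    by rewrite lerN2; exact: (svalP q).2.
  + by move=> q _; rewrite sublinear0//; exact: (svalP q).1.
  + by exists q0 => //; rewrite sublinear0//; exact: (svalP q0).1.
  + move=> i j x y Ai Aj; have [/asboolP ij|/asboolP ji] := totA i j Ai Aj.
      exists j => //; apply: le_trans ((svalP j).1.1 _ _) _.
      by rewrite lerD2r ij.
    exists i => //; apply: le_trans ((svalP i).1.1 _ _) _.
    by rewrite lerD2l ji.
  + move=> i t x Ai t0; exists i => //.
    by rewrite (svalP i).1.2//; exact: ltW.
  have rp : forall x, inf [set sval i x | i in A] <= p x.
    by move=> x; exact: le_trans (rle q0 x Aq0) ((svalP q0).2 x).
  exists (exist (fun q => sublinear q /\ forall x, q x <= p x) _ (conj sr rp)) => s As; apply/asboolP => x /=.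
  exact: rle.
exists q; split=> // q' sq' q'q.
have q'p x : q' x <= p x by exact: le_trans (q'q x) (qp x).
have := qmin (exist _ q' (conj sq' q'p)).
by rewrite /le asboolT// => /(_ isT) /(congr1 sval).
Qed.

(** A minimal sublinear function is linear, as [shrink_sublinear] cannot decrease it.
    Decreasing [p] at [v] beforehand forces the value [p v]. *)
Theorem hahn_banach p v : sublinear p ->
  exists l, [/\ functional l, forall x, l x <= p x & l v = p v].
Proof.
move=> sp; have [p' [sp' p'p p'v]] := shrink_sublinear v sp.
have [q [sq qp' qmin]] := sublinear_minimal sp'.
have qD x a : q (x + a) = q x + q a.
  apply/eqP; rewrite eq_le sq.1/=.
  have [r [sr rq ra]] := shrink_sublinear a sq.
  have rE := qmin _ sr rq.
  by have := ra 1 x ler01; rewrite scale1r mul1r rE lerBrDr.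
have q0 : q 0 = 0 by exact: sublinear0.
have qN x : q (- x) = - q x.
  by apply/eqP; rewrite -subr_eq0 opprK addrC -qD subrr q0.
have qZ t x : q (t *: x) = t * q x.
  have [t0|t0] := leP 0 t; first exact: sq.2.
  rewrite -[t]opprK scaleNr qN sq.2 ?oppr_ge0 ?ltW//.
  by rewrite !mulNr.
have qp x : q x <= p x by exact: le_trans (qp' x) (p'p x).
exists q; split=> //; first by move=> a x y; rewrite qD qZ.
apply/eqP; rewrite eq_le qp /=.
have := le_trans (qp' (- v)) (p'v 1 (- v) ler01).
by rewrite scale1r addNr (sublinear0 sp) mul1r sub0r qN lerN2.
Qed.

End HahnBanach.

Section Subgradient.
Context {R : realType} {E : normedModType R}.

(** Convexity makes the difference quotients of [f] at [y] a sublinear family, and any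
    linear function below their infimum supports [f] at [y]. *)
Lemma subgradient (f : E -> R) (y : E) :
  (forall x z t, 0 <= t -> t <= 1 ->
     f (t *: x + (1 - t) *: z) <= t * f x + (1 - t) * f z) ->
  (forall x z, f x <= f z + `|x - z|) ->
  exists l, [/\ functional l, forall x, l x <= `|x| &
    forall z, f y + l (z - y) <= f z].
Proof.
move=> cvx lip.
pose phi (t : R) h := (f (y + t *: h) - f y) / t.
have [||||||sp le] := @inf_sublinear R E _ [set t : R | 0 < t] phi (fun h => - `|h|).
- by exists 1 => /=.
- move=> t x /= t0; rewrite /phi ler_pdivlMr//.
  have := lip y (y + t *: x).
  by rewrite opprD addNKr normrN normrZ gtr0_norm// => ?; lra.
- by move=> t /= t0; rewrite /phi scaler0 addr0 subrr mul0r.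
- by exists 1 => //=; rewrite /phi scaler0 addr0 subrr mul0r.
- move=> s t x z /= s0 t0; have st0 : 0 < s + t by rewrite addr_gt0.
  exists (s * t / (s + t)); first by rewrite /= divr_gt0// mulr_gt0.
  have := cvx (y + s *: x) (y + t *: z) (t / (s + t)).
  have -> : 1 - t / (s + t) = s / (s + t) by field; rewrite gt_eqF.
  have -> : (t / (s + t)) *: (y + s *: x) + (s / (s + t)) *: (y + t *: z) =
     y + (s * t / (s + t)) *: (x + z).
    rewrite !scalerDr !scalerA addrACA -scalerDl -mulrDl addrC [t + s]addrC.
    rewrite divff ?gt_eqF// scale1r addrC; congr (_ + (_ *: _ + _ *: _)); by field; rewrite gt_eqF.
  have c0 : 0 <= t / (s + t) by rewrite divr_ge0 ?ltW.
  have c1 : t / (s + t) <= 1 by rewrite ler_pdivrMr// mul1r lerDr ltW.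
  move=> /(_ c0 c1) h.
  rewrite /phi invf_div mulrA ler_pdivrMr ?mulr_gt0//.
  have -> : ((f (y + s *: x) - f y) / s + (f (y + t *: z) - f y) / t) * (s * t) =
    (f (y + s *: x) - f y) * t + (f (y + t *: z) - f y) * s.
    by field; rewrite !gt_eqF.
  rewrite -ler_pdivlMr//; apply: le_trans (_ : t / (s + t) * f (y + s *: x) + s / (s + t) * f (y + t *: z) - f y <= _).
    by rewrite lerD2r.
  rewrite le_eqVlt; apply/orP; left; apply/eqP; field; by rewrite gt_eqF.
- move=> s t x /= s0 t0; exists (s / t); first by rewrite /= divr_gt0.
  rewrite /phi scalerA divfK ?gt_eqF// invf_div.
  by rewrite le_eqVlt; apply/orP; left; apply/eqP; field; rewrite gt_eqF.
have [l [fl lp _]] := hahn_banach 0 sp.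
have lphi t x : 0 < t -> l x <= phi t x.
  by move=> t0; apply: le_trans (lp x) _; exact: le.
exists l; split=> // [x|z].
  apply: le_trans (lphi 1 x ltr01) _; rewrite /phi divr1 scale1r.
  by have := lip (y + x) y; rewrite addrAC subrr add0r => ?; lra.
have := lphi 1 (z - y) ltr01; rewrite /phi divr1 scale1r [y + _]addrC subrK => ?.
lra.
Qed.

End Subgradient.

Section BoundedFunctions.
Context {R : realType} {X : Type}.

(** The bounded functions on [X], with the supremum norm, form a Banach space into
    which any semi-normed space maps isometrically: they provide the ambient
    spaces in which types are realised. *)
Definition bounded_pred : {pred X -> R^o} :=
  fun f => `[< exists M : R, forall x, `|f x| <= M >].

Lemma bounded_submod : submod_closed bounded_pred.
Proof.
split; first by apply/asboolP; exists 0 => x; rewrite normr0.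
move=> a f g /asboolP[M hM] /asboolP[N hN]; apply/asboolP.
exists (`|a| * M + N) => x; apply: le_trans (ler_normD _ _) _.
by rewrite normrM lerD// ler_wpM2l.
Qed.

HB.instance Definition _ := GRing.isSubmodClosed.Build R (X -> R^o) bounded_pred bounded_submod.

Record bfun := Bfun { bfun_val :> X -> R^o; _ : bfun_val \in bounded_pred }.
HB.instance Definition _ := [isSub for bfun_val].
HB.instance Definition _ := [Choice of bfun by <:].
HB.instance Definition _ := [SubChoice_isSubLmodule of bfun by <:].

Definition bfun_norm (f : bfun) : R := sup [set `|f x| | x in setT].

Lemma bfun_norm_ub (f : bfun) x : `|f x| <= bfun_norm f.
Proof.
apply: ub_le_sup; last by exists x.
have /asboolP[M hM] := valP f.
by exists M => _ [y _ <-]; exact: hM.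
Qed.

Lemma bfun_norm_le (f : bfun) M : 0 <= M -> (forall x, `|f x| <= M) ->
  bfun_norm f <= M.
Proof.
move=> M0 hM; have [[x _]|nX] := pselect ([set: X] !=set0).
  by apply: ge_sup; [exists `|f x|, x|move=> _ [y _ <-]].
rewrite /bfun_norm (_ : [set _ | _ in _] = set0) ?sup0//.
by apply/seteqP; split=> // r [x _ _]; exfalso; apply: nX; exists x.
Qed.

Lemma bfun_norm_ge0 f : 0 <= bfun_norm f.
Proof.
have [[x _]|nX] := pselect ([set: X] !=set0).
  by apply: le_trans (bfun_norm_ub f x).
rewrite /bfun_norm (_ : [set _ | _ in _] = set0) ?sup0//.
by apply/seteqP; split=> // r [x _ _]; exfalso; apply: nX; exists x.
Qed.

Lemma bfun_normD f g : bfun_norm (f + g) <= bfun_norm f + bfun_norm g.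
Proof.
apply: bfun_norm_le => [|x]; first by rewrite addr_ge0// bfun_norm_ge0.
by apply: le_trans (ler_normD _ _) _; rewrite lerD// bfun_norm_ub.
Qed.

Lemma bfun_normZ a f : bfun_norm (a *: f) = `|a| * bfun_norm f.
Proof.
have le b g : bfun_norm (b *: g) <= `|b| * bfun_norm g.
  apply: bfun_norm_le => [|x]; first by rewrite mulr_ge0// bfun_norm_ge0.
  rewrite (_ : (b *: g) x = b * g x)// normrM.
  by rewrite ler_wpM2l// bfun_norm_ub.
have [->|a0] := eqVneq a 0.
  apply/eqP; rewrite normr0 mul0r eq_le bfun_norm_ge0 andbT.
  by have := le 0 f; rewrite normr0 mul0r.
apply/eqP; rewrite eq_le le/=.
have := le a^-1 (a *: f); rewrite scalerA mulVf// scale1r normfV.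
by rewrite ler_pdivlMl// normr_gt0.
Qed.

Lemma bfun_norm0_eq0 f : bfun_norm f = 0 -> f = 0.
Proof.
move=> f0; apply/val_inj/funext => x; apply/eqP.
by rewrite -normr_le0 -f0 bfun_norm_ub.
Qed.

HB.instance Definition _ :=
  Lmodule_isNormed.Build R bfun bfun_normD bfun_normZ bfun_norm0_eq0.

Lemma bfun_complete (F : set_system bfun) : ProperFilter F ->
  cauchy F -> cvg F.
Proof.
move=> FF /cauchyP Fc.
have pt x : cvg ((fun f : bfun => f x : R^o) @ F).
  apply: R_complete; apply/cauchyP => e e0.
  have [f Ff] := Fc e e0; exists (f x); rewrite /fmap/=.
  apply: filterS Ff => g; rewrite -!ball_normE /= => fg.
  exact: le_lt_trans (bfun_norm_ub (f - g) x) fg.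
pose g x : R^o := lim ((fun f : bfun => f x : R^o) @ F).
have gP e f : F (ball f e) -> forall x, `|f x - g x| <= e.
  move=> Ff x; apply/ler_addgt0Pr => r r0.
  have /cvgrPdist_lt /(_ r r0) hr := pt x.
  have [h [fh gh]] := filter_ex (filterI Ff hr).
  move: fh; rewrite -ball_normE /= => fh.
  have h1 := le_lt_trans (bfun_norm_ub (f - h) x) fh.
  rewrite (_ : f x - g x = (f - h) x - (g x - h x)).
    by apply: le_trans (ler_normB _ _) _; rewrite lerD// ltW.
  by rewrite opprB addrA subrK.
have gb : g \in bounded_pred.
  have [f Ff] := Fc 1 ltr01; apply/asboolP; exists (bfun_norm f + 1) => x.
  rewrite -[g x](subKr (f x)); apply: le_trans (ler_normB _ _) _.
  by rewrite lerD ?bfun_norm_ub ?gP.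
apply/cvg_ex; exists (Bfun gb); apply/cvgrPdist_le => e e0.
have [f Ff] := Fc _ (divr_gt0 e0 (ltr0Sn _ 1)).
near=> h; have fh : ball f (e / 2) h by near: h.
apply: bfun_norm_le => [|x]; first exact: ltW.
move: fh; rewrite -ball_normE /= => fh.
have h1 := le_lt_trans (bfun_norm_ub (f - h) x) fh.
suff: `|g x - h x| <= e by [].
have -> : g x - h x = (f - h) x - (f x - g x).
  have -> : (f - h) x = f x - h x by [].
  by rewrite opprB [RHS]addrC addrA subrK.
apply: le_trans (ler_normB _ _) _; rewrite [leRHS]splitr lerD ?gP// ltW//.
Unshelve. all: by end_near. Qed.

HB.instance Definition _ := Uniform_isComplete.Build bfun bfun_complete.

End BoundedFunctions.
Arguments bfun : clear implicits.

Lemma seminorm_sublinear (R : realType) (V : lmodType R) (N : V -> R) :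
  seminorm N -> sublinear N.
Proof. by move=> [ND NZ]; split=> // t x t0; rewrite NZ ger0_norm. Qed.

Lemma seminormN (R : realType) (V : lmodType R) (N : V -> R) x :
  seminorm N -> N (- x) = N x.
Proof. by move=> [_ NZ]; rewrite -scaleN1r NZ normrN1 mul1r. Qed.

(** A vector is sent to the function which evaluates the functionals dominated by [N];
    Hahn-Banach shows that the supremum norm of this function is the value of [N]. *)
Lemma seminorm_realize (R : realType) (V : lmodType R) (N : V -> R) :
  seminorm N -> exists (F : completeNormedModType R) (T : {linear V -> F}),
    forall v, `|T v| = N v.
Proof.
move=> sN.
pose dom (l : V -> R) := `[< functional l /\ forall x, l x <= N x >].
have domP l x : dom l -> `|l x| <= N x.
  move=> /asboolP[fl lN]; rewrite ler_norml lN andbT lerNl.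
  by rewrite -functionalN// -(seminormN x sN).
have N0 x : 0 <= N x.
  have [l [fl lN _]] := hahn_banach 0 (seminorm_sublinear sN).
  by apply: le_trans (domP l x _); [|apply/asboolP].
pose ev v (l : V -> R) : R^o := if dom l then l v else 0.
have evb v : ev v \in bounded_pred.
  apply/asboolP; exists (N v) => l; rewrite /ev; case: ifP => [/domP|_] //.
  by rewrite normr0.
pose T v : bfun R (V -> R) := Bfun (evb v).
have Tlin : linear T.
  move=> a x y; apply/val_inj/funext => l /=.
  rewrite /= !fctE /ev; case: ifP => [/asboolP[fl _]|_]; first exact: fl.
  by rewrite scaler0 addr0.
pose L := GRing.isLinear.Build R V (bfun R (V -> R)) *:%R T Tlin.
pose TL : {linear V -> bfun R (V -> R)} := HB.pack T L.
exists (bfun R (V -> R)), TL => v.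
apply/eqP; rewrite eq_le; apply/andP; split.
  apply: bfun_norm_le => // l /=; rewrite /ev.
  by case: ifP => [/domP|_] //; rewrite normr0.
have [l [fl lN <-]] := hahn_banach v (seminorm_sublinear sN).
apply: le_trans (ler_norm _) _; apply: le_trans (bfun_norm_ub _ l).
by rewrite /= /ev ifT//; apply/asboolP.
Qed.

(** * Compactness in finite dimension *)

(** Compactness as an induction principle: a property which passes to subsets and finite
    unions and holds locally holds on [K]. Otherwise the complements of the sets with
    the property generate a filter without cluster point. *)
Lemma compact_induct (T : topologicalType) (K : set T) (Q : set T -> Prop) :
  compact K -> Q set0 -> (forall A B, A `<=` B -> Q B -> Q A) ->
  (forall A B, Q A -> Q B -> Q (A `|` B)) ->
  (forall x, K x -> exists2 U, nbhs x U & Q (U `&` K)) -> Q K.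
Proof.
move=> cK Q0 mono QU loc; apply: contrapT => nQ.
pose F : set_system T := [set A | Q (K `\` A)].
have FF : ProperFilter F.
  apply: Build_ProperFilter_ex => [A QA|].
    apply: contrapT => nA; apply: nQ; apply: mono QA => x Kx; split=> // Ax.
    by apply: nA; exists x.
  split=> [|A B FA FB|A B AB].
  - by rewrite /F /= setDT.
  - by rewrite /F /= setDIr; exact: QU.
  - by apply: mono; exact: setDS.
have FK : F K by rewrite /F /= setDv.
have [x [Kx clx]] := cK F FF FK.
have [U xU QUK] := loc x Kx.
have FU : F (~` U) by rewrite /F /= setDE setCK setIC.
by have [z [? ?]] := clx _ _ FU xU.
Qed.

Lemma sum_continuous (R : realType) (T : topologicalType)
    (V : normedModType R) n (f : 'I_n -> T -> V) :
  (forall i, continuous (f i)) -> continuous (fun t => \sum_i f i t).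
Proof.
move=> cf t; apply: cvg_big => [|i _]; first exact: add_continuous.
exact: cf.
Qed.

Lemma norm_fun_continuous (R : realType) (T : topologicalType)
    (V : normedModType R) (f : T -> V) :
  continuous f -> continuous (fun t => `|f t|).
Proof. by move=> cf t; apply: cvg_norm; exact: cf. Qed.

Lemma scale_fun_continuous (R : realType) (T : topologicalType)
    (V : normedModType R) (f : T -> R^o) (x : V) :
  continuous f -> continuous (fun t => f t *: x).
Proof. by move=> cf t; apply: cvgZr_tmp; exact: cf. Qed.

Lemma mulr_fun_continuous (R : realType) (T : topologicalType)
    (f : T -> R^o) (a : R) :
  continuous f -> continuous (fun t => a * f t : R^o).
Proof. by move=> cf t; apply: cvgM; [exact: cvg_cst|exact: cf]. Qed.

Section FiniteDimension.
Context {R : realType} {E : normedModType R} (d : nat).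

Lemma has_coordinates (dimE : has_dim E d) : exists (b : 'I_d -> E) (c : E -> 'rV[R]_d),
  [/\ forall x, x = \sum_i c x 0 i *: b i,
      forall v : 'rV_d, c (\sum_i v 0 i *: b i) = v &
      forall i, functional (fun x => c x 0 i)].
Proof.
have [b hb] := dimE; have [c hc] := choice hb.
have cK (v : 'rV_d) : c (\sum_i v 0 i *: b i) = v by exact: (hc _).2.
exists b, c; split=> // [x|i a x y]; first exact: (hc x).1.
rewrite [in LHS](hc x).1 [in LHS](hc y).1 scaler_sumr -big_split /=.
rewrite (eq_bigr (fun i => (a *: c x + c y) 0 i *: b i)) => [|j _].
  by rewrite cK !mxE.
by rewrite !mxE scalerDl scalerA.
Qed.

Lemma combination_continuous (b : 'I_d -> E) :
  continuous (fun v : 'rV[R]_d => \sum_i v 0 i *: b i).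
Proof.
apply: (@sum_continuous _ _ _ _ (fun i (v : 'rV[R]_d) => v 0 i *: b i)) => i.
apply: (@scale_fun_continuous R _ E (fun v : 'rV[R]_d => v 0 i)).
exact: coord_continuous.
Qed.

Lemma row_coord_le (v : 'rV[R]_d) i : `|v 0 i| <= `|v|.
Proof.
have h : `|v 0 i| <= \big[Num.max/0]_ij `|v ij.1 ij.2|.
  exact: (@le_bigmax _ _ _ _ (fun ij : 'I_1 * 'I_d => `|v ij.1 ij.2|) (0, i)).
by rewrite -mx_normrE in h.
Qed.

Lemma row_norm_le (v : 'rV[R]_d) M : 0 <= M -> (forall i, `|v 0 i| <= M) ->
  `|v| <= M.
Proof.
move=> M0 h; rewrite (_ : `|v| = mx_norm v)// mx_normrE.
by apply: bigmax_le => // -[i j] _ /=; rewrite ord1.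
Qed.

Lemma nbhs_row (v : 'rV[R]_d) (s : R) : 0 < s ->
  nbhs v [set w | `|v - w| < s].
Proof.
move=> s0; exists (fun i j => [set t : R | `|v i j - t| < s / 2]) => [i j|w /= h].
  by apply/nbhs_normP; exists (s / 2) => //; rewrite /= divr_gt0.
have : `|v - w| <= s / 2.
  apply: row_norm_le => [|i]; first by rewrite ltW// divr_gt0.
  by have := ltW (h 0 i); rewrite !mxE.
by move=> /le_lt_trans; apply; lra.
Qed.

(** The continuous function [v => `|\sum_i v_i b_i|] has a positive minimum on the
    compact unit sphere of the row vectors. *)
Lemma bounded_coordinates (b : 'I_d -> E) (c : E -> 'rV[R]_d) :
  (forall x, x = \sum_i c x 0 i *: b i) ->
  (forall v : 'rV_d, c (\sum_i v 0 i *: b i) = v) ->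
  (forall i, functional (fun x => c x 0 i)) ->
  exists2 C, 0 < C & forall x i, `|c x 0 i| <= C * `|x|.
Proof.
move=> bE cK fc.
pose N (v : 'rV[R]_d) := `|\sum_i v 0 i *: b i|.
have cN : continuous N.
  by apply: norm_fun_continuous; exact: combination_continuous.
have c0 : c 0 = 0 by apply/rowP => i; rewrite (functional0 (fc i)) mxE.
have NZ a v : N (a *: v) = `|a| * N v.
  rewrite -normrZ scaler_sumr; congr `|_|; apply: eq_bigr => i _.
  by rewrite mxE scalerA.
pose S : set 'rV[R]_d := [set v | `|v| = 1].
have [S0|S0] := pselect (S !=set0); last first.
  exists 1 => // x i; have [->|cx0] := eqVneq (c x) 0.
    by rewrite mxE normr0 mul1r.
  exfalso; apply: S0; exists (`|c x|^-1 *: c x); rewrite /S /= normrZ normfV.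
  by rewrite normr_id mulVf// normr_eq0.
have cS : compact S.
  apply: bounded_closed_compact.
    by exists 1; split=> // M M1 v /= ->; exact: ltW.
  have -> : S = (fun v : 'rV[R]_d => `|v|) @^-1` [set 1] by [].
  apply: preimage_closed => [v _|]; first exact: norm_continuous.
  exact: closed_eq.
have [v0 vS min] := compact_EVT_min S0 cS (continuous_subspaceT cN).
have v0S : `|v0| = 1 by move: vS; rewrite inE.
have m0 : 0 < N v0.
  rewrite normr_gt0; apply/eqP => h0.
  have := cK v0; rewrite h0 c0 => v00.
  by move: v0S; rewrite -v00 normr0 => /esym/eqP; rewrite oner_eq0.
exists (N v0)^-1; first by rewrite invr_gt0.
move=> x i; rewrite ler_pdivlMl//.
have [->|cx0] := eqVneq (c x) 0; first by rewrite mxE normr0 mulr0.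
have cx0' : 0 < `|c x| by rewrite normr_gt0.
apply: le_trans (_ : N v0 * `|c x| <= _).
  by rewrite ler_wpM2l ?row_coord_le// ltW.
have /min : `|c x|^-1 *: c x \in S.
  by rewrite inE /S /= normrZ normfV normr_id mulVf// normr_eq0.
rewrite NZ normfV normr_id /N -bE mulrC ler_pdivlMr//.
Qed.

End FiniteDimension.

Section DualBall.
Context {R : realType} {E : normedModType R}.

Definition dual_unit (l : E -> R) := functional l /\ forall x, `|l x| <= `|x|.

(** The operator norm of [m - l] is at most [r]; this form applies to functions that are
    not yet known to be bounded. *)
Definition dnear (r : R) (l m : E -> R) := forall x, `|m x - l x| <= r * `|x|.

Lemma dual_unitP l : functional l -> (forall x, l x <= `|x|) -> dual_unit l.
Proof.
move=> fl h; split=> // x; rewrite ler_norml h andbT lerNl -functionalN//.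
by rewrite -(normrN x).
Qed.

Lemma dual_unit_le l x : dual_unit l -> l x <= `|x|.
Proof. by move=> [_ h]; apply: le_trans (ler_norm _) _. Qed.

Lemma dual_unit_ge l x : dual_unit l -> - `|x| <= l x.
Proof. by move=> [_ /(_ x)]; rewrite ler_norml => /andP[]. Qed.

Lemma dual_unit0 : dual_unit (fun _ => 0).
Proof. by split=> [a x y|x]; rewrite ?mulr0 ?addr0// normr0. Qed.

Lemma dual_unitN l : dual_unit l -> dual_unit (fun x => - l x).
Proof.
move=> [fl h]; split=> [a x y|x]; last by rewrite normrN.
by rewrite fl opprD mulrN.
Qed.

Lemma dual_unit_conv l m t : dual_unit l -> dual_unit m -> 0 <= t -> t <= 1 ->
  dual_unit (fun x => t * l x + (1 - t) * m x).
Proof.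
move=> hl hm t0 t1; have t1' : 0 <= 1 - t by rewrite subr_ge0.
apply: dual_unitP => [a x y|x].
  by rewrite (hl.1) (hm.1); ring.
apply: le_trans (_ : t * `|x| + (1 - t) * `|x| <= _).
  by rewrite lerD// ler_wpM2l// dual_unit_le.
by rewrite -mulrDl addrC subrK mul1r.
Qed.

Lemma dual_unitZ l t : dual_unit l -> `|t| <= 1 -> dual_unit (fun x => t * l x).
Proof.
move=> [fl h] t1; split=> [a x y|x]; first by rewrite fl mulrDr mulrCA.
by rewrite normrM; apply: le_trans (h x); rewrite ler_piMl.
Qed.

(** Closedness relative to the dual ball, for the norm of the dual. *)
Definition dual_closed (A : set (E -> R)) := forall l, dual_unit l -> ~ A l ->
  exists2 r : R, 0 < r & forall m, dual_unit m -> dnear r l m -> ~ A m.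

Definition dual_continuous (Phi : (E -> R) -> R) := forall l, dual_unit l ->
  forall e : R, 0 < e -> exists2 r : R, 0 < r &
    forall m, dual_unit m -> dnear r l m -> `|Phi m - Phi l| <= e.

Lemma dnear_mono r s l m : r <= s -> dnear r l m -> dnear s l m.
Proof. by move=> rs h x; apply: le_trans (h x) _; rewrite ler_wpM2r. Qed.

Context (d : nat) (dimE : has_dim E d).

(** The dual ball is, in coordinates, a closed bounded set of row vectors, so that
    [compact_induct] applies to it. *)
Lemma dual_induct (Q : set (E -> R) -> Prop) : Q set0 ->
  (forall A B, A `<=` B -> Q B -> Q A) ->
  (forall A B, Q A -> Q B -> Q (A `|` B)) ->
  (forall l, dual_unit l -> exists2 r : R, 0 < r &
     Q [set m | dual_unit m /\ dnear r l m]) ->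
  Q dual_unit.
Proof.
move=> Q0 mono QU loc.
have [b [c [bE cK fc]]] := has_coordinates dimE.
have [C C0 hC] := bounded_coordinates bE cK fc.
pose phi (v : 'rV[R]_d) (x : E) := \sum_i c x 0 i * v 0 i.
have fphi v : functional (phi v).
  move=> a x y; rewrite /phi mulr_sumr -big_split; apply: eq_bigr => i _ /=.
  by rewrite fc; ring.
have phib v i : phi v (b i) = v 0 i.
  have cb : c (b i) = delta_mx 0 i.
    rewrite -[RHS]cK; congr c; rewrite (bigD1 i)//= big1 => [|j ji].
      by rewrite mxE !eqxx scale1r addr0.
    by rewrite mxE eqxx (negbTE ji) scale0r.
  rewrite /phi (bigD1 i)//= big1 => [|j ji]; rewrite cb mxE eqxx.
    by rewrite eqxx mul1r addr0.
  by rewrite (negbTE ji) mul0r.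
have phiE l : functional l -> exists v, phi v = l.
  move=> fl; exists (\row_i l (b i)); apply/funext => x.
  rewrite [in RHS](bE x) functional_sum//; apply: eq_bigr => i _.
  by rewrite mxE.
have cphi x : continuous (phi^~ x).
  apply: (@sum_continuous R _ R^o _ (fun i (v : 'rV[R]_d) => c x 0 i * v 0 i)) => i.
  apply: (@mulr_fun_continuous R _ (fun v : 'rV[R]_d => v 0 i)).
  exact: coord_continuous.
pose K := [set v | dual_unit (phi v)].
have KE : K = \bigcap_(x in [set: E]) (phi^~ x @^-1` [set t : R | `|t| <= `|x|]).
  by apply/seteqP; split=> [v [_ h] x _ //|v h]; [exact: h|split=> // x; exact: h].
have cK' : compact K.
  apply: bounded_closed_compact.
    exists (\big[Num.max/0]_i `|b i|); split; first by rewrite num_real.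
    move=> M hM v [_ Kv]; apply: row_norm_le => [|i].
      by apply: le_trans (ltW hM); exact: bigmax_ge_id.
    rewrite -phib; apply: le_trans (Kv _) _; apply: le_trans (ltW hM).
    exact: le_bigmax.
  rewrite KE; apply: closed_bigI => x _; apply: preimage_closed.
    by move=> v _; exact: cphi.
  apply: (@preimage_closed _ _ (fun t : R => `|t|) [set t | t <= `|x|]).
    by move=> t _; exact: norm_continuous.
  exact: closed_le.
suff h : Q (phi @` K).
  apply: mono h => l [fl hl]; have [v vl] := phiE l fl.
  by exists v => //; rewrite /K /= vl.
apply: (@compact_induct _ K (fun A => Q (phi @` A))) => //.
- by rewrite image_set0.
- by move=> A B AB; apply: mono; exact: image_subset.
- by move=> A B QA QB; rewrite image_setU; exact: QU.
move=> v Kv; have [r r0 Qr] := loc _ Kv.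
pose s := r / (d.+1%:R * C).
have s0 : 0 < s by rewrite divr_gt0// mulr_gt0.
exists [set w | `|v - w| < s].
  exact: nbhs_row.
apply: mono Qr => _ [w [/= vw Kw] <-]; split=> // x.
rewrite /phi -sumrB; apply: le_trans (ler_norm_sum _ _ _) _.
apply: le_trans (_ : \sum_(i < d) C * `|x| * s <= _).
  apply: ler_sum => i _; rewrite -mulrBr normrM.
  apply: ler_pM => //; apply: le_trans (ltW vw).
  by rewrite distrC; have := row_coord_le (v - w) i; rewrite !mxE.
rewrite sumr_const card_ord -mulr_natl.
apply: le_trans (_ : d.+1%:R * (C * `|x| * s) <= _).
  rewrite ler_wpM2r ?ler_nat//.
  by apply: mulr_ge0; [apply: mulr_ge0 => //|]; exact: ltW.
rewrite le_eqVlt; apply/orP; left; apply/eqP; rewrite /s; field.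
by rewrite (gt_eqF C0) -[1]/(1%:R) -natrD pnatr_eq0.
Qed.

Lemma ball_induct (r : R) (Q : set E -> Prop) : Q set0 ->
  (forall A B, A `<=` B -> Q B -> Q A) ->
  (forall A B, Q A -> Q B -> Q (A `|` B)) ->
  (forall x, `|x| <= r -> exists2 s, 0 < s &
     Q [set y | `|y| <= r /\ `|y - x| <= s]) ->
  Q [set y | `|y| <= r].
Proof.
move=> Q0 mono QU loc.
have [b [c [bE cK fc]]] := has_coordinates dimE.
have [C C0 hC] := bounded_coordinates bE cK fc.
pose psi (v : 'rV[R]_d) := \sum_i v 0 i *: b i.
have cpsi : continuous psi by exact: combination_continuous.
have cN : continuous (fun v => `|psi v|) by exact: norm_fun_continuous.
pose K := [set v | `|psi v| <= r].
have cK' : compact K.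
  apply: bounded_closed_compact; last first.
    apply: (@preimage_closed _ _ (fun v => `|psi v|) [set t | t <= r]).
      by move=> v _; exact: cN.
    exact: closed_le.
  have [r0|r0] := ltP r 0.
    exists 0; split=> // M M0 v /= Kv; exfalso.
    by have := le_lt_trans Kv r0; rewrite ltNge normr_ge0.
  exists (C * r); split; first by rewrite num_real.
  move=> M hM v /= Kv; apply: le_trans (ltW hM).
  apply: row_norm_le => [|i]; first by rewrite mulr_ge0// ltW.
  rewrite -[v]cK; apply: le_trans (hC _ _) _.
  by rewrite ler_wpM2l// ltW.
suff h : Q (psi @` K).
  apply: mono h => x /= xr; exists (c x); last by rewrite /psi -bE.
  by rewrite /K /= /psi -bE.
apply: (@compact_induct _ K (fun A => Q (psi @` A))) => //.
- by rewrite image_set0.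
- by move=> A B AB; apply: mono; exact: image_subset.
- by move=> A B QA QB; rewrite image_setU; exact: QU.
move=> v Kv; have [s s0 Qs] := loc _ Kv.
exists [set w | `|psi v - psi w| < s].
  have /cvgrPdist_lt := cpsi v; exact.
apply: mono Qs => _ [w [/= vw Kw] <-]; split=> //.
by rewrite distrC ltW.
Qed.

Lemma finite_net (r e : R) : 0 < e -> exists N : seq E,
  forall y, `|y| <= r -> exists2 z, z \in N & `|y - z| <= e.
Proof.
move=> e0; pose Q (A : set E) := exists N : seq E,
  forall y, A y -> exists2 z, z \in N & `|y - z| <= e.
apply: (@ball_induct r Q).
- by exists [::].
- by move=> A B AB [N h]; exists N => y /AB /h.
- move=> A B [N h] [N' h']; exists (N ++ N') => y [/h|/h'] [z zN yz];
    by exists z => //; rewrite mem_cat zN ?orbT.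
- move=> x _; exists e => //; exists [:: x] => y [_ ?].
  by exists x => //; rewrite inE.
Qed.

(** If [l] does not attain the value [1] on the unit sphere, then by compactness of the
    unit ball its values there stay away from [1]. *)
Lemma norming_or_small l : dual_unit l ->
  (exists2 u, `|u| = 1 & l u = 1) \/
  (exists k, [/\ 0 <= k, k < 1 & forall x, `|l x| <= k * `|x|]).
Proof.
move=> hl; have [H|nH] := pselect (exists2 u, `|u| = 1 & l u = 1); [by left|right].
pose Q (A : set E) := exists k, [/\ 0 <= k, k < 1 & forall x, A x -> `|l x| <= k].
have [k [k0 k1 hk]] : Q [set x | `|x| <= 1].
  apply: ball_induct.
  - by exists 0.
  - by move=> A B AB [k [k0 k1 h]]; exists k; split=> // x /AB /h.
  - move=> A B [k [k0 k1 h]] [k' [k'0 k'1 h']]; exists (Num.max k k').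
    split; rewrite ?le_max ?gt_max ?k0 ?k1//.
    by move=> x [/h|/h'] hx; rewrite le_max hx ?orbT.
  move=> x x1; have lx1 : `|l x| < 1.
    rewrite lt_neqAle (le_trans (hl.2 x))// andbT; apply/eqP => lx.
    have x1' : `|x| = 1.
      by apply/eqP; rewrite eq_le x1 -lx hl.2.
    apply: nH; have [l0|l0] := leP 0 (l x).
      by exists x => //; rewrite -lx ger0_norm.
    exists (- x); rewrite ?normrN// functionalN ?hl.1//; last exact: hl.1.
    by rewrite -lx ltr0_norm.
  exists ((1 - `|l x|) / 2); first by lra.
  exists ((1 + `|l x|) / 2); split; [by have := normr_ge0 (l x); lra|lra|].
  move=> y [_ yx]; rewrite -(subrK x y) functionalD; last exact: hl.1.
  apply: le_trans (ler_normD _ _) _; have := le_trans (hl.2 (y - x)) yx.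
  by lra.
exists k; split=> // x; have [->|x0] := eqVneq x 0.
  by rewrite functional0 ?normr0 ?mulr0//; exact: hl.1.
have x0' : 0 < `|x| by rewrite normr_gt0.
have := hk (`|x|^-1 *: x); rewrite /= normrZ normfV normr_id mulVf ?gt_eqF//.
move=> /(_ (lexx _)); rewrite functionalZ ?normrM ?normfV ?normr_id; last exact: hl.1.
by rewrite mulrC ler_pdivrMr.
Qed.

(** If the supremum were not attained, each [l] would have a neighbourhood on which some
    element of [A] does strictly better at [y]; by [dual_induct] a single element of [A]
    would be strictly better than all, itself included. *)
Lemma dual_attain (y : E) (A : set (E -> R)) : dual_closed A ->
  (exists2 l, dual_unit l & A l) -> exists l, [/\ dual_unit l, A l &
    forall m, dual_unit m -> A m -> m y <= l y].
Proof.
move=> clA [l0 hl0 Al0]; apply: contrapT => nH.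
pose Q (B : set (E -> R)) := exists l, [/\ dual_unit l, A l &
    forall m, dual_unit m -> A m -> B m -> m y < l y].
have [l [hl Al]] : Q dual_unit; last by move=> /(_ l hl Al hl); rewrite ltxx.
have exl l : dual_unit l -> A l -> exists m, [/\ dual_unit m, A m & l y < m y].
  move=> hl Al; apply: contrapT => h; apply: nH; exists l; split=> // m hm Am.
  by rewrite leNgt; apply/negP => lm; apply: h; exists m.
apply: dual_induct.
- by exists l0.
- by move=> B C BC [l [? ? h]]; exists l; split=> // m hm Am /BC; exact: h.
- move=> B C [l [hl Al h]] [l' [hl' Al' h']].
  have [ll|ll] := leP (l y) (l' y).
    exists l'; split=> // m hm Am [Bm|]; last exact: h'.
    exact: lt_le_trans (h m hm Am Bm) ll.
  exists l; split=> // m hm Am [|Bm]; first exact: h.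
  exact: lt_trans (h' m hm Am Bm) ll.
move=> l hl; have [Al|nAl] := pselect (A l); last first.
  have [r r0 hr] := clA l hl nAl; exists r => //; exists l0; split=> //.
  by move=> m hm Am [_ lm]; exfalso; exact: hr Am.
have [m [hm Am lm]] := exl l hl Al.
exists ((m y - l y) / 2 / (`|y| + 1)).
  by rewrite !divr_gt0 ?subr_gt0// ltr_wpDl.
exists m; split=> // k hk Ak [_ /(_ y)].
have y1 : 0 < `|y| + 1 by rewrite ltr_wpDl.
have : (m y - l y) / 2 / (`|y| + 1) * `|y| <= (m y - l y) / 2.
  rewrite mulrAC ler_pdivrMr// ler_wpM2l//; last by rewrite lerDl.
  by lra.
move=> h1 h2; have := le_trans (ler_norm _) (le_trans h2 h1); lra.
Qed.

Lemma dual_bounded Phi : dual_continuous Phi ->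
  exists2 M, 0 <= M & forall l, dual_unit l -> `|Phi l| <= M.
Proof.
move=> cPhi; pose Q (A : set (E -> R)) := exists2 M, 0 <= M & forall l, A l -> `|Phi l| <= M.
apply: (@dual_induct Q).
- by exists 0.
- by move=> A B AB [M M0 h]; exists M => // l /AB /h.
- move=> A B [M M0 h] [M' M'0 h']; exists (Num.max M M'); first by rewrite le_max M0.
  by move=> l [/h|/h'] hl; rewrite le_max hl ?orbT.
move=> l hl; have [r r0 hr] := cPhi l hl 1 ltr01; exists r => //.
exists (`|Phi l| + 1) => [|m [hm lm]]; first by rewrite addr_ge0.
rewrite -(subrK (Phi l) (Phi m)) addrC; apply: le_trans (ler_normD _ _) _.
by rewrite lerD2l hr.
Qed.

(** Where [Psi] vanishes [Phi] is positive, hence also nearby; on the remaining compact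
    set [Psi] is bounded below by a positive constant and a large multiple of it wins. *)
Lemma penalty (A : set (E -> R)) (Phi Psi : (E -> R) -> R) : dual_closed A ->
  dual_continuous Phi -> dual_continuous Psi ->
  (forall l, dual_unit l -> A l -> 0 <= Psi l) ->
  (forall l, dual_unit l -> A l -> Psi l = 0 -> 0 < Phi l) ->
  exists2 k, 0 <= k & forall k', k <= k' -> forall l, dual_unit l -> A l ->
    0 < Phi l + k' * Psi l.
Proof.
move=> clA cPhi cPsi Psi0 Phi0.
pose Q (B : set (E -> R)) := exists2 k, 0 <= k & forall k', k <= k' ->
  forall l, B l -> dual_unit l -> A l -> 0 < Phi l + k' * Psi l.
suff [k k0 h] : Q dual_unit by exists k => // k' kk l hl; exact: h.
apply: dual_induct.
- by exists 0.
- by move=> B C BC [k k0 h]; exists k => // k' kk l /BC; exact: h.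
- move=> B C [k k0 h] [k' k'0 h']; exists (Num.max k k'); first by rewrite le_max k0.
  by move=> k''; rewrite ge_max => /andP[? ?] l [Bl|Cl]; [exact: h|exact: h'].
move=> l hl; have [Al|nAl] := pselect (A l); last first.
  have [r r0 hr] := clA l hl nAl; exists r => //; exists 0 => // k' _ m [hm lm] _ Am.
  by exfalso; exact: hr Am.
have := Psi0 l hl Al; rewrite le_eqVlt => /predU1P[Psil|Psil].
  have Phil := Phi0 l hl Al (esym Psil).
  have [r r0 hr] := cPhi l hl (Phi l / 2) ltac:(lra).
  exists r => //; exists 0 => // k' k'0 m [hm lm] _ Am.
  rewrite ltr_wpDr ?mulr_ge0 ?Psi0//.
  by have := hr m hm lm; rewrite ler_norml => /andP[? ?]; lra.
have [r r0 hr] := cPsi l hl (Psi l / 2) ltac:(lra).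
have [s s0 hs] := cPhi l hl 1 ltr01.
exists (Num.min r s); first by rewrite lt_min r0.
exists (2 * (`|Phi l| + 2) / Psi l).
  by rewrite divr_ge0 ?mulr_ge0 ?addr_ge0// ltW.
move=> k hk m [hm lm] _ Am.
have h1 := hr m hm (dnear_mono _ lm); have h2 := hs m hm (dnear_mono _ lm).
move: h1 h2; rewrite ge_min lexx => /(_ isT) h1; rewrite ge_min lexx orbT => /(_ isT) h2.
move: h1 h2; rewrite !ler_norml => /andP[a1 _] /andP[a2 _].
have h3 : `|Phi l| + 2 <= k * Psi m.
  apply: le_trans (_ : 2 * (`|Phi l| + 2) / Psi l * (Psi l / 2) <= _).
    rewrite le_eqVlt; apply/orP; left; apply/eqP; field; by rewrite gt_eqF.
  apply: ler_pM => //; last by lra.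
    by rewrite divr_ge0 ?mulr_ge0 ?addr_ge0// ltW.
  by lra.
by have := lerNnormlW (lexx `|Phi l|); lra.
Qed.

End DualBall.

(** * Linear algebra of functionals *)

Section LinearAlgebra.
Context {R : realType} {E : normedModType R} (d : nat) (dimE : has_dim E d).

Definition independent n (w : 'I_n -> E -> R) : Prop :=
  forall a : 'I_n -> R, (forall x, \sum_i a i * w i x = 0) -> forall i, a i = 0.

Lemma independent_row_free (b : 'I_d -> E) (c : E -> 'rV[R]_d) n
    (w : 'I_n -> E -> R) :
  (forall x, x = \sum_i c x 0 i *: b i) -> (forall i, functional (w i)) ->
  independent w -> row_free (\matrix_(i, j) w i (b j)).
Proof.
move=> bE fw iw; apply: inj_row_free => v /rowP v0.
apply/rowP => i; rewrite mxE; apply: (iw (fun i => v 0 i)) => x.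
rewrite (bE x) (eq_bigr (fun i => \sum_j c x 0 j * (v 0 i * w i (b j)))); last first.
  move=> k _; rewrite functional_sum// mulr_sumr; apply: eq_bigr => j _.
  by rewrite mulrCA.
rewrite exchange_big big1// => j _ /=; rewrite -mulr_sumr.
have := v0 j; rewrite !mxE (eq_bigr (fun i => v 0 i * w i (b j))) => [->|k _].
  by rewrite mulr0.
by rewrite mxE.
Qed.

Lemma interpolation n (w : 'I_n -> E -> R) (t : 'I_n -> R) :
  (forall i, functional (w i)) -> independent w ->
  exists x, forall i, w i x = t i.
Proof.
move=> fw iw; have [b [c [bE cK fc]]] := has_coordinates dimE.
have rf := independent_row_free bE fw iw.
set W := (\matrix_(_, _) _) in rf.
pose v := pinvmx W *m \col_i t i.
exists (\sum_j v j 0 *: b j) => i; rewrite functional_sum//.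
have : (W *m v) i 0 = t i by rewrite /v mulmxA mulmxVp// mul1mx mxE.
by rewrite mxE => <-; apply: eq_bigr => j _; rewrite [W i j]mxE mulrC.
Qed.

Lemma independent_le n (w : 'I_n -> E -> R) :
  (forall i, functional (w i)) -> independent w -> (n <= d)%N.
Proof.
move=> fw iw; have [b [c [bE cK fc]]] := has_coordinates dimE.
have := independent_row_free bE fw iw; rewrite /row_free => /eqP <-.
exact: rank_leq_col.
Qed.

Lemma independent_lt n (w : 'I_n -> E -> R) y :
  (forall i, functional (w i)) -> independent w -> y != 0 ->
  (forall i, w i y = 0) -> (n < d)%N.
Proof.
move=> fw iw y0 wy; rewrite ltn_neqAle (independent_le fw iw) andbT.
apply/eqP => nd; move: y0; have [b [c [bE cK fc]]] := has_coordinates dimE.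
have := independent_row_free bE fw iw; set W := (\matrix_(_, _) _) => rf.
have rW : row_full W by rewrite /row_full (eqP rf) nd.
have : W *m (c y)^T = 0.
  apply/colP => i; rewrite !mxE -[RHS](wy i) [in RHS](bE y) functional_sum//.
  by apply: eq_bigr => j _; rewrite !mxE mulrC.
move=> /(congr1 (mulmx (pinvmx W))); rewrite mulmxA mulVpmx// mul1mx mulmx0.
move=> /(congr1 trmx); rewrite trmxK trmx0 => cy.
by rewrite (bE y) big1 ?eqxx// => i _; rewrite cy mxE scale0r.
Qed.

(** The functionals [c_i(u) c_j - c_j(u) c_i], for coordinates [c_i], vanish at [u];
    their vanishing at [y] says that [y] and [u] have proportional coordinates. *)
Lemma separating_functional (u y : E) : u != 0 ->
  (forall nu, functional nu -> nu u = 0 -> nu y = 0) -> exists a, y = a *: u.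
Proof.
have [b [c [bE cK fc]]] := has_coordinates dimE.
move=> u0 h; have [i ci] : exists i, c u 0 i != 0.
  apply: contrapT => nex; move/eqP: u0; apply; rewrite (bE u) big1// => i _.
  have [->|ci] := eqVneq (c u 0 i) 0; first by rewrite scale0r.
  by exfalso; apply: nex; exists i.
exists (c y 0 i / c u 0 i); rewrite [LHS](bE y) [in X in _ *: X](bE u) scaler_sumr.
apply: eq_bigr => j _; rewrite scalerA; congr (_ *: _).
have /eqP : c u 0 i * c y 0 j - c u 0 j * c y 0 i = 0.
  apply: (h (fun x => c u 0 i * c x 0 j - c u 0 j * c x 0 i)).
    by move=> a x z; rewrite !fc; ring.
  by ring.
rewrite subr_eq0 => /eqP hc; apply: (mulfI ci).
by rewrite hc; field.
Qed.

Lemma functional_bounded (nu : E -> R) : functional nu ->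
  exists2 M, 0 < M & forall x, `|nu x| <= M * `|x|.
Proof.
have [b [c [bE cK fc]]] := has_coordinates dimE.
have [C C0 hC] := bounded_coordinates bE cK fc.
move=> fnu; exists (C * (1 + \sum_i `|nu (b i)|)).
  by rewrite mulr_gt0// ltr_wpDr// sumr_ge0.
move=> x; rewrite [in nu x](bE x) functional_sum//.
apply: le_trans (ler_norm_sum _ _ _) _.
apply: le_trans (_ : \sum_i C * `|x| * `|nu (b i)| <= _).
  by apply: ler_sum => i _; rewrite normrM ler_wpM2r.
rewrite -mulr_sumr mulrAC ler_wpM2r// ler_wpM2l//; first exact: ltW.
by rewrite lerDr.
Qed.

End LinearAlgebra.

(** * Katetov functions and envelopes *)

Section Katetov.
Context {R : realType} {E : normedModType R}.

Definition kc (f : E -> R) : Prop :=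
  [/\ forall x z t, 0 <= t -> t <= 1 ->
        f (t *: x + (1 - t) *: z) <= t * f x + (1 - t) * f z,
      forall x z, f x <= f z + `|x - z| &
      forall x z, `|x - z| <= f x + f z].

Lemma norm_sublinear : sublinear (fun x : E => `|x|).
Proof.
split=> [x y|t x t0]; first exact: ler_normD.
by rewrite normrZ ger0_norm.
Qed.

Lemma norming_functional (x : E) : exists2 l, dual_unit l & l x = `|x|.
Proof.
have [l [fl h lx]] := hahn_banach x norm_sublinear.
by exists l => //; exact: dual_unitP.
Qed.

Lemma kc_subgradient f y : kc f -> exists2 l, dual_unit l &
  forall z, f y + l (z - y) <= f z.
Proof.
move=> [cvx lip _]; have [l [fl h lz]] := subgradient y cvx lip.
by exists l => //; exact: dual_unitP.
Qed.

Lemma kc_ge0 f x : kc f -> 0 <= f x.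
Proof. by move=> [_ _ /(_ x x)]; rewrite subrr normr0 => ?; lra. Qed.

Definition fopp (l : E -> R) : E -> R := fun x => - l x.

Lemma foppK l : fopp (fopp l) = l.
Proof. by apply/funext => x; rewrite /fopp opprK. Qed.

(** The pair [(x, r)] stands for the constraint [f x <= r]; on the dual ball it becomes
    the affine function [l => l x - r], a lower bound for the conjugate
    [l => sup_x (l x - f x)] of every [f] satisfying the constraint. *)
Definition aff (p : E * R) (l : E -> R) : R := l p.1 - p.2.

(** This compatibility is necessary for the constraints to have a Katetov solution; the
    case [p = q] says that the bounds are nonnegative. *)
Definition admissible (L : seq (E * R)) :=
  forall p q, p \in L -> q \in L -> `|p.1 - q.1| <= p.2 + q.2.

(** That is, an affine function with slope [l] which satisfies the constraints takes the
    value [t] at [y]. *)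
Definition feasible (L : seq (E * R)) (y : E) (t : R) :=
  exists2 l, dual_unit l & forall p, p \in L -> t <= l y - aff p l.

Definition envelope (L : seq (E * R)) (y : E) : R :=
  sup [set t | feasible L y t].

Lemma min_attained (T : eqType) (L : seq T) (phi : T -> R) : L != [::] ->
  exists2 p, p \in L & forall q, q \in L -> phi p <= phi q.
Proof.
elim: L => // p [|q L] IH _.
  by exists p; rewrite ?mem_head// => q; rewrite inE => /eqP ->.
have [//|r rL hr] := IH.
have [pr|rp] := leP (phi p) (phi r).
  exists p; rewrite ?mem_head// => s; rewrite in_cons => /predU1P[->//|sL].
  exact: le_trans pr (hr s sL).
exists r; first by rewrite in_cons rL orbT.
move=> s; rewrite in_cons => /predU1P[->|sL]; [exact: ltW|exact: hr].
Qed.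

Section Envelope.
Variables (L : seq (E * R)) (L0 : L != [::]) (aL : admissible L).

Lemma feasible_le p y t : p \in L -> feasible L y t -> t <= `|y - p.1| + p.2.
Proof.
move=> pL [l hl /(_ p pL)]; rewrite /aff opprB addrA => /le_trans; apply.
rewrite addrAC -(functionalB _ _ hl.1).
by rewrite lerD2r dual_unit_le.
Qed.

Lemma feasible0 y : feasible L y 0.
Proof.
exists (fun=> 0); first exact: dual_unit0.
move=> p pL; rewrite /aff !sub0r opprK.
by have := aL pL pL; rewrite subrr normr0 => ?; lra.
Qed.

Lemma envelope_ge y t : feasible L y t -> t <= envelope L y.
Proof.
move=> ft; apply: ub_le_sup => //.
case: L L0 => // p M _ in ft *.
exists (`|y - p.1| + p.2) => s; move: ft => _.
case=> l hl /(_ p (mem_head _ _)); rewrite /aff opprB addrA => /le_trans; apply.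
rewrite addrAC -(functionalB _ _ hl.1).
by rewrite lerD2r dual_unit_le.
Qed.

Lemma envelope_le y M : (forall t, feasible L y t -> t <= M) ->
  envelope L y <= M.
Proof. by move=> h; apply: ge_sup => //; exists 0; exact: feasible0. Qed.

Lemma envelope_node p : p \in L -> envelope L p.1 <= p.2.
Proof.
move=> pL; apply: envelope_le => t /(feasible_le pL).
by rewrite subrr normr0 add0r.
Qed.

(** For the last inequality take [l] norming [x - z]. The affine functions with slopes
    [l] and [- l] which touch the constraints [p] and [q] give the values
    [l (x - p.1) + p.2] and [l (q.1 - z) + q.2], whose sum is
    [`|x - z| - l (p.1 - q.1) + p.2 + q.2 >= `|x - z|]. *)
Lemma envelope_kc : kc (envelope L).
Proof.
split=> [x z t t0 t1|x z|x z].
- have t1' : 0 <= 1 - t by rewrite subr_ge0.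
  apply: envelope_le => s [l hl h].
  pose m := s - l (t *: x + (1 - t) *: z).
  have fe y : m + l y <= envelope L y.
    apply: envelope_ge; exists l => // p /h; rewrite /m => ?; lra.
  have -> : s = t * (m + l x) + (1 - t) * (m + l z).
    rewrite /m; have -> : l (t *: x + (1 - t) *: z) = t * l x + (1 - t) * l z.
      by rewrite hl.1 (functionalZ _ _ hl.1).
    by ring.
  by rewrite lerD// ler_wpM2l.
- apply: envelope_le => s [l hl h]; rewrite -lerBlDr; apply: envelope_ge.
  exists l => // p /h.
  have := dual_unit_le (x - z) hl; rewrite (functionalB _ _ hl.1).
  by lra.
have [l hl lxz] := norming_functional (x - z).
have [p pL hp] := min_attained (fun p => l x - aff p l) L0.
have [q qL hq] := min_attained (fun p => fopp l z - aff p (fopp l)) L0.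
have h1 : l x - aff p l <= envelope L x by apply: envelope_ge; exists l.
have h2 : fopp l z - aff q (fopp l) <= envelope L z.
  by apply: envelope_ge; exists (fopp l) => //; exact: dual_unitN.
have := dual_unit_le (p.1 - q.1) hl; have := aL pL qL; move: h1 h2.
rewrite -lxz /fopp /aff !(functionalB _ _ hl.1).
by lra.
Qed.

(** The envelope is the largest solution: a subgradient of [f] at [y] is an affine
    function below [f], hence satisfies the constraints up to [e]. *)
Lemma envelope_max f e : kc f -> (forall p, p \in L -> f p.1 <= p.2 + e) ->
  forall y, f y <= envelope L y + e.
Proof.
move=> kf h y; have [l hl lz] := kc_subgradient y kf.
rewrite -lerBlDr; apply: envelope_ge; exists l => // p pL.
have := h p pL; have := lz p.1; rewrite (functionalB _ _ hl.1).
by rewrite /aff; lra.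
Qed.

End Envelope.

(** The convex continuous functions on the dual ball, which approximate conjugates of
    Katetov functions. For these the Katetov inequality reads
    [Phi l + Phi (- l) <= 0]. *)
Definition ccf (Phi : (E -> R) -> R) : Prop :=
  (forall l m t, dual_unit l -> dual_unit m -> 0 <= t -> t <= 1 ->
    Phi (fun x => t * l x + (1 - t) * m x) <= t * Phi l + (1 - t) * Phi m) /\
  dual_continuous Phi.

Lemma aff_conv p l m t :
  aff p (fun x => t * l x + (1 - t) * m x) = t * aff p l + (1 - t) * aff p m.
Proof. by rewrite /aff; ring. Qed.

Lemma aff_dnear p r l m : dnear r l m -> `|aff p m - aff p l| <= r * `|p.1|.
Proof. by move=> h; rewrite /aff opprB addrA subrK. Qed.

Lemma aff_continuous p : dual_continuous (aff p).
Proof.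
move=> l hl e e0; have p0 : 0 < `|p.1| + 1 by rewrite ltr_wpDl.
exists (e / (`|p.1| + 1)); first by rewrite divr_gt0.
move=> m _ lm; apply: le_trans (aff_dnear p lm) _.
by rewrite mulrAC ler_pdivrMr// ler_wpM2l ?lerDl// ltW.
Qed.

Lemma aff_ccf p : ccf (aff p).
Proof. by split; [move=> *; rewrite aff_conv|exact: aff_continuous]. Qed.

Lemma aff_bound p l : dual_unit l -> `|aff p l| <= `|p.1| + `|p.2|.
Proof. by move=> hl; rewrite /aff; apply: le_trans (ler_normB _ _) _; rewrite lerD2r hl.2. Qed.

Lemma dual_continuousD (Phi Psi : (E -> R) -> R) : dual_continuous Phi ->
  dual_continuous Psi -> dual_continuous (fun l => Phi l + Psi l).
Proof.
move=> h h' l hl e e0.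
have [r r0 hr] := h l hl (e / 2) ltac:(lra).
have [s s0 hs] := h' l hl (e / 2) ltac:(lra).
exists (Num.min r s) => [|m hm lm]; first by rewrite lt_min r0.
rewrite opprD addrACA; apply: le_trans (ler_normD _ _) _; rewrite [leRHS]splitr.
rewrite lerD// ?hr ?hs//; apply: dnear_mono lm; rewrite ge_min lexx ?orbT//.
Qed.

Lemma dual_continuousZ (Phi : (E -> R) -> R) a : dual_continuous Phi ->
  dual_continuous (fun l => a * Phi l).
Proof.
move=> h l hl e e0; have a0 : 0 < `|a| + 1 by rewrite ltr_wpDl.
have [r r0 hr] := h l hl (e / (`|a| + 1)) ltac:(by rewrite divr_gt0).
exists r => // m hm lm; rewrite -mulrBr normrM.
apply: le_trans (_ : `|a| * (e / (`|a| + 1)) <= _); first by rewrite ler_wpM2l// hr.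
rewrite mulrA ler_pdivrMr// mulrC ler_wpM2l ?lerDl//; exact: ltW.
Qed.

Lemma dual_continuous_fopp (Phi : (E -> R) -> R) : dual_continuous Phi ->
  dual_continuous (fun l => Phi (fopp l)).
Proof.
move=> h l hl e e0; have [r r0 hr] := h (fopp l) (dual_unitN hl) e e0.
exists r => // m hm lm; apply: hr; first exact: dual_unitN.
by move=> x; rewrite /fopp -opprD normrN.
Qed.

Lemma ccf_max Phi Psi : ccf Phi -> ccf Psi ->
  ccf (fun l => Num.max (Phi l) (Psi l)).
Proof.
move=> [c1 h1] [c2 h2]; split=> [l m t hl hm t0 t1|l hl e e0].
  have t1' : 0 <= 1 - t by rewrite subr_ge0.
  rewrite ge_max; apply/andP; split.
    apply: le_trans (c1 l m t hl hm t0 t1) _.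
    by rewrite lerD// ler_wpM2l// le_max lexx.
  apply: le_trans (c2 l m t hl hm t0 t1) _.
  by rewrite lerD// ler_wpM2l// le_max lexx orbT.
have [r r0 hr] := h1 l hl e e0.
have [s s0 hs] := h2 l hl e e0.
exists (Num.min r s) => [|m hm lm]; first by rewrite lt_min r0.
have lr : dnear r l m by apply: dnear_mono lm; rewrite ge_min lexx.
have ls : dnear s l m by apply: dnear_mono lm; rewrite ge_min lexx orbT.
have := hr m hm lr; have := hs m hm ls; rewrite !ler_norml.
move=> /andP[? ?] /andP[? ?]; rewrite lerBlDl lerBrDl.
by rewrite ge_max le_max; case: (leP (Phi l) (Psi l)) => ?;
   case: (leP (Phi m) (Psi m)) => ?; apply/andP; split;
   rewrite ?ge_max ?le_max; try (apply/andP; split); lra.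
Qed.

Lemma ccf_avg Phi Psi : ccf Phi -> ccf Psi ->
  ccf (fun l => 2^-1 * Phi l + 2^-1 * Psi l).
Proof.
move=> [c1 h1] [c2 h2]; split=> [l m t hl hm t0 t1|].
  by have := c1 l m t hl hm t0 t1; have := c2 l m t hl hm t0 t1; lra.
by apply: dual_continuousD; exact: dual_continuousZ.
Qed.

(** What a finite set of constraints says about the conjugate; [p0] makes the set nonempty. *)
Definition maxaff (p0 : E * R) (L : seq (E * R)) (l : E -> R) : R :=
  foldr (fun p t => Num.max (aff p l) t) (aff p0 l) L.

Lemma maxaff_ccf p0 L : ccf (maxaff p0 L).
Proof. by elim: L => [|p L IH]; [exact: aff_ccf|apply: ccf_max => //; exact: aff_ccf]. Qed.

Lemma maxaff_ge p0 L p l : p \in p0 :: L -> aff p l <= maxaff p0 L l.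
Proof.
elim: L => [|q L IH]; first by rewrite inE => /eqP ->.
rewrite !inE /= le_max => /orP[p0p|/orP[/eqP ->|pL]].
- by rewrite IH ?orbT// inE p0p.
- by rewrite lexx.
- by rewrite IH ?orbT// inE pL orbT.
Qed.

Lemma maxaff_attained p0 L l : exists2 p, p \in p0 :: L & maxaff p0 L l = aff p l.
Proof.
elim: L => [|q L [p pL IH]]; first by exists p0; rewrite ?mem_head.
rewrite /=; case: leP => h.
  exists p; last exact: IH.
  by move: pL; rewrite !inE => /orP[->//|->]; rewrite !orbT.
by exists q; rewrite // !inE eqxx orbT.
Qed.

End Katetov.

(** * Closing the gap on a boundary of the dual ball *)

Section Sandwich.
Context {R : realType} {E : normedModType R} (d : nat) (dimE : has_dim E d).
Implicit Types (l m : E -> R) (p q : E * R) (e r : R).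

Lemma affB p q l : functional l ->
  aff (p.1 - q.1, p.2 - q.2) l = aff p l - aff q l.
Proof. by move=> fl; rewrite /aff /= (functionalB _ _ fl); ring. Qed.

(** Near such a point a functional is [l] up to a small convex perturbation, so that an
    affine function bounded above on the dual ball can increase only slightly
    between [l] and its neighbours. *)
Definition good l := forall eta : R, 0 < eta -> eta < 1 ->
  exists2 r : R, 0 < r & forall m, dual_unit m -> dnear r l m ->
    exists2 w, dual_unit w & m = (fun x => (1 - eta) * l x + eta * w x).

(** On [S] one has [g <= - g (fopp _)]. Here [p] stays below the upper function, [q]
    above the lower one, and yet [p] nearly reaches [q] at [l], as if an
    affine function fitted between the two functions. *)
Definition sandwiched (S : set (E -> R)) l := forall g, ccf g ->
  (forall m, S m -> g m + g (fopp m) <= 0) -> forall e, 0 < e ->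
  exists p q, [/\ forall m, S m -> aff p m + g (fopp m) <= 0,
    forall m, S m -> g m <= aff q m & aff q l <= aff p l + e].

(** A boundary of the dual ball on which the inequality [h l + h (- l) <= 0] can be
    turned into an equality, and which is large enough to determine the norm. *)
Record gauge_boundary (S : set (E -> R)) : Prop := GaugeBoundary {
  gb_unit : forall l, S l -> dual_unit l;
  gb_opp : forall l, S l -> S (fopp l);
  gb_norming : forall x, x != 0 -> exists2 l, S l & l x = `|x|;
  gb_sphere : forall l, S l -> exists2 u, `|u| = 1 & l u = 1;
  gb_closed : dual_closed S;
  gb_good : forall l, dual_unit l -> ~ S l -> good l;
  gb_sandwiched : forall l, S l -> sandwiched S l }.

Variables (S : set (E -> R)) (hS : gauge_boundary S).

(** The sandwich at [l] in [S] provides affine functions [p] and [q'], below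
    [- g (fopp _)] on [S], with [p l + q' (- l)] almost nonnegative; the maximum of these
    with [g] works near [l]. Maxima of solutions are solutions,
    so that compactness gives a solution on all of [S]. *)
Lemma edwards_step g e : ccf g ->
  (forall m, S m -> g m + g (fopp m) <= 0) -> 0 < e ->
  exists v, [/\ ccf v, forall l, dual_unit l -> g l <= v l,
    forall m, S m -> v m + g (fopp m) <= 0 &
    forall m, S m -> - e <= v m + v (fopp m)].
Proof.
move=> cg g0 e0.
pose Q (A : set (E -> R)) := exists v, [/\ ccf v,
  forall l, dual_unit l -> g l <= v l, forall m, S m -> v m + g (fopp m) <= 0 &
  forall m, S m -> A m -> - e <= v m + v (fopp m)].
suff [v [cv gv vg h]] : Q dual_unit.
  by exists v; split=> // m Sm; apply: h => //; exact: gb_unit Sm.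
apply: (dual_induct dimE).
- by exists g; split.
- by move=> A B AB [v [? ? ? h]]; exists v; split=> // m Sm /AB; exact: h.
- move=> A B [v [cv gv vg h]] [v' [cv' gv' vg' h']].
  exists (fun l => Num.max (v l) (v' l)); split.
  + exact: ccf_max.
  + by move=> l hl; rewrite le_max gv.
  + by move=> m Sm; rewrite -lerBrDr ge_max !lerBrDr vg// vg'.
  + move=> m Sm [Am|Bm].
      by apply: le_trans (h m Sm Am) _; rewrite lerD// le_max lexx.
    by apply: le_trans (h' m Sm Bm) _; rewrite lerD// le_max lexx orbT.
move=> l hl; have [Sl|nSl] := pselect (S l); last first.
  have [r r0 hr] := gb_closed hS hl nSl; exists r => //; exists g; split=> //.
  by move=> m Sm [hm lm]; exfalso; exact: hr Sm.
have [p [q [hp hq pq]]] := gb_sandwiched hS Sl cg g0 (divr_gt0 e0 (ltr0Sn _ 1)).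
(* [q'] is the reflection of [q]: [aff q' m = - aff q (- m)] *)
pose q' : E * R := (q.1, - q.2).
have q'E m : aff q' m = - aff q (fopp m) by rewrite /aff /fopp /=; ring.
exists (e / 2 / (`|p.1| + `|q.1| + 1)).
  by rewrite !divr_gt0// ltr_wpDl// addr_ge0.
exists (fun l => Num.max (g l) (Num.max (aff p l) (aff q' l))); split.
- by do 2?[apply: ccf_max => //]; exact: aff_ccf.
- by move=> m hm; rewrite le_max lexx.
- move=> m Sm; rewrite -lerBrDr !ge_max !lerBrDr g0// hp//= q'E.
  by have := hq _ (gb_opp hS Sm); lra.
move=> m Sm [hm lm].
apply: le_trans (_ : aff p m + aff q' (fopp m) <= _); last first.
  by rewrite lerD// !le_max lexx ?orbT.
rewrite q'E foppK.
have h1 := aff_dnear p lm; have h2 := aff_dnear q lm.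
have D0 : 0 < `|p.1| + `|q.1| + 1 by rewrite ltr_wpDl// addr_ge0.
have : e / 2 / (`|p.1| + `|q.1| + 1) * (`|p.1| + `|q.1|) <= e / 2.
  rewrite mulrAC ler_pdivrMr// ler_wpM2l//; first by lra.
  by rewrite lerDl.
rewrite mulrDr; move: h1 h2; rewrite !ler_norml => /andP[h1 h1'] /andP[h2 h2'].
by lra.
Qed.

(** The average of [h] and the [v] produced by [edwards_step] satisfies the same inequality,
    because [v + h (fopp _) <= 0] holds crosswise, and the gap is halved up to [e / 2];
    the bound [2 M / 2 ^ n] on the gap is iterated until it is below [e / 2]. *)
Lemma edwards g e : ccf g -> (forall m, S m -> g m + g (fopp m) <= 0) -> 0 < e ->
  exists h, [/\ ccf h, forall l, dual_unit l -> g l <= h l,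
    forall m, S m -> h m + h (fopp m) <= 0 &
    forall m, S m -> - e <= h m + h (fopp m)].
Proof.
move=> cg g0 e0; have [M M0 hM] := dual_bounded dimE cg.2.
have step n : exists h, [/\ ccf h, forall l, dual_unit l -> g l <= h l,
    forall m, S m -> h m + h (fopp m) <= 0 &
    forall m, S m -> - (2 * M / 2 ^+ n + e / 2) <= h m + h (fopp m)].
  elim: n => [|n [h [ch gh h0 hn]]].
    exists g; split=> // m Sm; rewrite expr0 divr1.
    have := hM m (gb_unit hS Sm); have := hM _ (gb_unit hS (gb_opp hS Sm)).
    by rewrite !ler_norml => /andP[? _] /andP[? _]; lra.
  have [v [cv hv vh vv]] := edwards_step ch h0 (divr_gt0 e0 (ltr0Sn _ 1)).
  exists (fun l => 2^-1 * h l + 2^-1 * v l); split.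
  - exact: ccf_avg.
  - by move=> l hl; have := gh l hl; have := hv l hl; lra.
  - move=> m Sm; have := vh m Sm; have := vh _ (gb_opp hS Sm).
    by rewrite foppK; lra.
  move=> m Sm; have := hn m Sm; have := vv m Sm; rewrite exprS invfM.
  by set t := 2 * M / 2 ^+ n; rewrite mulrCA -[2 * M * _]/t; lra.
have [n hn] : exists n, 2 * M / 2 ^+ n <= e / 2.
  have [n hn] : exists n : nat, 2 * M / (e / 2) <= n%:R.
    exists (Num.bound (2 * M / (e / 2))); apply/ltW.
    by apply: archi_boundP; rewrite !mulr_ge0 ?invr_ge0//; lra.
  have e2 : 0 < e / 2 by lra.
  exists n; rewrite ler_pdivrMr ?exprn_gt0// [e / 2 * _]mulrC -ler_pdivrMr//.
  apply: le_trans hn _; rewrite -natrX ler_nat; apply: ltnW; exact: ltn_expl.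
have [h [ch gh h0 hh]] := step n; exists h; split=> // m Sm.
by have := hh m Sm; lra.
Qed.

(** An affine function [p] is maximised over the dual ball at a functional norming
    [p.1], and [S] contains one. *)
Lemma norm_principle p c : (forall m, S m -> aff p m <= c) -> - p.2 <= c ->
  forall l, dual_unit l -> aff p l <= c.
Proof.
move=> hm p2 l hl; rewrite /aff; have [->|p0] := eqVneq p.1 0.
  by rewrite (functional0 hl.1) sub0r.
have [s Ss sp] := gb_norming hS p0.
apply: le_trans (hm s Ss); rewrite /aff lerD2r sp; exact: dual_unit_le.
Qed.

Definition small (de : R) l := forall x, `|l x| <= (1 - de) * `|x|.

Section Minorants.
Variables (g h : (E -> R) -> R) (ep de C : R).
Hypotheses (ep0 : 0 < ep) (de0 : 0 < de) (de1 : de < 1).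
Hypotheses (ch : ccf h).
Hypotheses (hle : forall m, S m -> h m + h (fopp m) <= 0).
Hypotheses (hge : forall m, S m -> - ep <= h m + h (fopp m)).
Hypotheses (C0 : 0 <= C) (hC : forall l, dual_unit l -> `|h l| <= C)
  (gC : forall l, dual_unit l -> `|g l| <= C).

(** Constraints are taken below [h] on [S], where the gap is closed, but below the smaller
    [g] on the functionals of norm at most [1 - de]: this keeps the prescribed values, up to the shrinking factor
    [1 - de]. *)
Definition minorant p := (forall m, S m -> aff p m <= h m) /\
  (forall m, dual_unit m -> small de m -> aff p m <= g m).

Lemma small0 : small de (fun=> 0).
Proof. by move=> x; rewrite normr0 mulr_ge0// subr_ge0 ltW. Qed.

Lemma minorant_bound p l : minorant p -> dual_unit l -> aff p l <= C.
Proof.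
move=> [pS pg] hl; apply: norm_principle => //.
  move=> m Sm; apply: le_trans (pS m Sm) _; apply: le_trans (ler_norm _) _.
  exact: hC (gb_unit hS Sm).
have := pg _ dual_unit0 small0; rewrite /aff sub0r => /le_trans; apply.
by apply: le_trans (ler_norm _) _; exact: gC dual_unit0.
Qed.

(** At [l] in [S] the sandwich gives an affine [p0] below [- h (fopp _)], which is below
    [h + ep] on [S], and [q0] above [h]. Adding multiples of [m u - 1], which vanishes at
    [l] and is very negative on the interior, turns [p0] into a minorant and [q0] into
    an upper bound for all minorants, and the two agree at [l] up to [2 ep]. *)
Lemma minorant_boundary l : S l -> exists p r, [/\ minorant p, 0 < r,
  h l - 2 * ep <= aff p l &
  forall m, dual_unit m -> dnear r l m -> forall q, minorant q ->
    aff q m <= aff p m + 3 * ep].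
Proof.
have [ep1 de2 C1] := And3 ep0 de0 C0.
move=> Sl; have [p0 [q0 [hp hq pq]]] := gb_sandwiched hS Sl ch hle ep0.
have hl := gb_unit hS Sl.
have [u u1 lu] := gb_sphere hS Sl.
pose P := `|p0.1| + `|p0.2|; pose Q := `|q0.1| + `|q0.2|.
have P0 : 0 <= P by rewrite addr_ge0.
have Q0 : 0 <= Q by rewrite addr_ge0.
(* on [small de] one has [1 - m u >= de], so that [k (1 - m u)] exceeds all bounds *)
pose k := (P + Q + C) / de.
have k0 : 0 <= k by rewrite divr_ge0 ?addr_ge0// ltW.
have kde : k * de = P + Q + C by rewrite divfK// gt_eqF.
pose p : E * R := (p0.1 + k *: u, p0.2 + ep + k).
pose q : E * R := (q0.1 - k *: u, q0.2 - k).
have pE m : functional m -> aff p m = aff p0 m - ep - k * (1 - m u).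
  by move=> fm; rewrite /aff /= (functionalD _ _ fm) (functionalZ _ _ fm); ring.
have qE m : functional m -> aff q m = aff q0 m + k * (1 - m u).
  by move=> fm; rewrite /aff /= (functionalB _ _ fm) (functionalZ _ _ fm); ring.
have mu1 m : dual_unit m -> 0 <= k * (1 - m u).
  by move=> hm; rewrite mulr_ge0// subr_ge0 -u1 dual_unit_le.
have sm m : dual_unit m -> small de m -> P + Q + C <= k * (1 - m u).
  move=> hm /(_ u); rewrite u1 mulr1 => mu; rewrite -kde ler_wpM2l//.
  by have := ler_norm (m u); lra.
have mp : minorant p.
  split=> [m Sm|m hm msm].
    have hm := gb_unit hS Sm; rewrite pE; last exact: hm.1.
    by have := mu1 m hm; have := hp m Sm; have := hge Sm; lra.
  rewrite pE; last exact: hm.1.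
  have := sm m hm msm; have := aff_bound p0 hm; have := gC hm.
  by rewrite -/P !ler_norml => /andP[? ?] /andP[? ?] ?; lra.
have qmax q' m : minorant q' -> dual_unit m -> aff q' m <= aff q m.
  move=> [q'S q'g] hm; rewrite -subr_le0.
  rewrite -(affB q' q hm.1).
  apply: norm_principle => //= [n Sn|].
    have hn := gb_unit hS Sn; rewrite (affB q' q hn.1).
    rewrite qE; last exact: hn.1.
    by have := q'S n Sn; have := hq n Sn; have := mu1 n hn; lra.
  have h0 := q'g _ dual_unit0 small0.
  have h1 := gC dual_unit0; have := sm _ dual_unit0 small0.
  rewrite subr0 mulr1 => h2; have := aff_bound q0 dual_unit0.
  move: h0 h1; rewrite -/Q /aff /q !ler_norml => ? /andP[? ?] /andP[? ?] /=.
  by lra.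
have D0 : 0 < `|p.1| + `|q.1| + 1 by rewrite ltr_wpDl// addr_ge0.
exists p, (ep / (`|p.1| + `|q.1| + 1)); split=> //.
- by rewrite divr_gt0.
- rewrite pE; last exact: hl.1.
  by rewrite lu subrr mulr0; have := hq l Sl; lra.
move=> m hm lm q' hq'; apply: le_trans (qmax q' m hq' hm) _.
have : ep / (`|p.1| + `|q.1| + 1) * (`|p.1| + `|q.1|) <= ep.
  rewrite mulrAC ler_pdivrMr// ler_wpM2l//; first exact: ltW.
  by rewrite lerDl.
have h1 := aff_dnear p lm; have h2 := aff_dnear q lm.
have := pE l hl.1; have := qE l hl.1; rewrite lu subrr mulr0.
rewrite mulrDr; move: h1 h2; rewrite !ler_norml => /andP[? ?] /andP[? ?].
by lra.
Qed.

(** Off [S] all minorants are bounded above by [C] on the dual ball; as [l] is good, a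
    minorant which is almost the largest at [l] is almost the largest around [l]. *)
Lemma minorant_local p0 l : minorant p0 -> dual_unit l -> exists p r,
  [/\ minorant p, 0 < r &
  forall m, dual_unit m -> dnear r l m -> forall q, minorant q ->
    aff q m <= aff p m + 3 * ep].
Proof.
have [ep1 de2 C1] := And3 ep0 de0 C0.
move=> mp0 hl; have [Sl|nSl] := pselect (S l).
  by have [p [r [? ? ? ?]]] := minorant_boundary Sl; exists p, r.
pose A := [set aff q l | q in minorant].
have supA : has_sup A.
  split; first by exists (aff p0 l), p0.
  by exists C => _ [q hq <-]; exact: minorant_bound.
have [_ [p hp <-] ph] := sup_adherent ep0 supA.
have qp q : minorant q -> aff q l <= aff p l + ep.
  move=> hq; have : aff q l <= sup A.
    by apply: ub_le_sup; [exact: supA.2|exists q].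
  by lra.
pose M := C + (`|p.1| + `|p.2|) + ep + 1.
have M0 : 0 < M by rewrite ltr_wpDl// !addr_ge0// ltW.
(* [eta] times the oscillation [M] of the minorants is at most [ep / 2] *)
pose eta := ep / M / 2.
have eta0 : 0 < eta by rewrite !divr_gt0.
have etaM : eta * M = ep / 2 by rewrite /eta; field; rewrite gt_eqF.
have eta1 : eta < 1.
  have : ep / M <= 1.
    by rewrite ler_pdivrMr// mul1r /M; have := normr_ge0 p.1; have := normr_ge0 p.2; lra.
  by rewrite /eta; lra.
have [r r0 hr] := gb_good hS hl nSl eta0 eta1.
exists p, r; split=> // m hm lm q hq.
have [w hw ->] := hr m hm lm.
have affE s : aff s (fun x => (1 - eta) * l x + eta * w x) =
  (1 - eta) * aff s l + eta * aff s w by rewrite /aff; ring.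
rewrite !affE.
have h1 : (1 - eta) * aff q l <= (1 - eta) * (aff p l + ep).
  by rewrite ler_wpM2l ?qp// subr_ge0 ltW.
have h2 : eta * aff q w <= eta * C by rewrite ler_wpM2l ?minorant_bound// ltW.
have h3 : - (eta * (`|p.1| + `|p.2|)) <= eta * aff p w.
  rewrite -mulrN ler_wpM2l//; first exact: ltW.
  by have := aff_bound p hw; rewrite ler_norml => /andP[].
have h4 : eta * C + eta * (`|p.1| + `|p.2|) <= ep / 2.
  rewrite -mulrDr -etaM; apply: ler_wpM2l; first exact: ltW.
  by rewrite /M; lra.
have h5 : 0 <= eta * ep by rewrite mulr_ge0// ltW.
by lra.
Qed.

Lemma minorants_finite p0 : minorant p0 -> exists L : seq (E * R),
  (forall p, p \in L -> minorant p) /\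
  (forall l q, dual_unit l -> minorant q ->
     exists2 p, p \in L & aff q l <= aff p l + 3 * ep).
Proof.
move=> mp0; pose Q (A : set (E -> R)) := exists L : seq (E * R),
  (forall p, p \in L -> minorant p) /\
  (forall l q, A l -> minorant q ->
     exists2 p, p \in L & aff q l <= aff p l + 3 * ep).
apply: (@dual_induct _ _ _ dimE Q).
- by exists [::].
- by move=> A B AB [L [hL hh]]; exists L; split=> // l q /AB; exact: hh.
- move=> A B [L [hL hh]] [L' [hL' hh']]; exists (L ++ L'); split.
    by move=> p; rewrite mem_cat => /orP[/hL|/hL'].
  move=> l q [Al|Bl] hq.
    by have [p pL pq] := hh l q Al hq; exists p => //; rewrite mem_cat pL.
  by have [p pL pq] := hh' l q Bl hq; exists p => //; rewrite mem_cat pL orbT.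
move=> l hl; have [p [r [mp r0 hr]]] := minorant_local mp0 hl.
exists r => //; exists [:: p]; split=> [q|m q [hm lm] hq].
  by rewrite inE => /eqP ->.
by exists p; rewrite ?mem_head//; exact: hr.
Qed.

End Minorants.

Lemma minorant_le g h de p : 0 < de -> ccf h -> (forall l, dual_unit l -> g l <= h l) ->
  (forall l, dual_unit l -> aff p l <= g l) -> minorant g h de p.
Proof.
move=> de0 ch gh pg; split=> [m Sm|m hm _]; last exact: pg.
by have hm := gb_unit hS Sm; apply: le_trans (pg m hm) _; exact: gh.
Qed.

(** The function is the envelope of finitely many minorants approximating all minorants.
    Any [f'] close to it on the nodes lies below it up to an error, by maximality.
    Far away from the origin, [f' y >= `|y - x| - f' x >= s y - s x - f' x] for [s] in
    [S] and each node [(x, r)]; if the node nearly attains [h (- s)], this is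
    about [s y - h s], and the supremum over [S] of these values bounds the
    envelope as well, because the node [(y, sup)] is itself a minorant. On a ball a
    finite net suffices. *)
Lemma approx_isolated f (K : seq E) e0 e : kc f -> 0 < e0 -> 0 < e ->
  exists f1 (K1 : seq E) rho, [/\ kc f1, 0 < rho,
    forall x, x \in K -> `|f1 x - f x| <= e0 &
    forall f', kc f' -> (forall x, x \in K1 -> `|f' x - f1 x| <= rho) ->
      forall y, `|f' y - f1 y| <= e].
Proof.
move=> kf e00 epos; have [fcvx flip fkat] := kf.
(* the errors in the final estimates add up to less than [20 ep] *)
pose ep := e / 20; have ep0 : 0 < ep by rewrite divr_gt0.
pose K0 := 0 :: K.
pose L0 := [seq (x, f x) | x <- K0].
pose p0 : E * R := (0, f 0).
pose g := maxaff p0 [seq (x, f x) | x <- K].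
have L0E : L0 = p0 :: [seq (x, f x) | x <- K] by [].
have pg p l : p \in L0 -> aff p l <= g l by rewrite L0E; exact: maxaff_ge.
have gE l : exists2 p, p \in L0 & g l = aff p l.
  by have [p pL hp] := maxaff_attained p0 [seq (x, f x) | x <- K] l; exists p.
have L0f p : p \in L0 -> p.2 = f p.1 by move=> /mapP[x _ ->].
have cg : ccf g by exact: maxaff_ccf.
have gg l : dual_unit l -> g l + g (fopp l) <= 0.
  move=> hl; have [p pL ->] := gE l; have [q qL ->] := gE (fopp l).
  have := fkat p.1 q.1; have := dual_unit_le (p.1 - q.1) hl.
  by rewrite (functionalB _ _ hl.1) /aff /fopp (L0f p)// (L0f q)//; lra.
have [h [ch gh hle hge]] := edwards cg (fun m Sm => gg m (gb_unit hS Sm)) ep0.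
have [C1 C10 hC1] := dual_bounded dimE ch.2.
have [C2 C20 gC2] := dual_bounded dimE cg.2.
pose C := C1 + C2; have C0 : 0 <= C by rewrite addr_ge0.
have hC l : dual_unit l -> `|h l| <= C by move=> /hC1 ?; rewrite /C; lra.
have gC l : dual_unit l -> `|g l| <= C by move=> /gC2 ?; rewrite /C; lra.
have [D D0 hD] : exists2 D, 0 <= D & forall x z, x \in K -> z \in K0 -> `|x - z| <= D.
  exists (\sum_(x <- K) \sum_(z <- K0) `|x - z|).
    by rewrite sumr_ge0// => ? _; rewrite sumr_ge0.
  move=> x z xK zK.
  have h1 (F : E -> R) (M : seq E) y : (forall y, 0 <= F y) -> y \in M -> F y <= \sum_(y <- M) F y.
    move=> F0; elim: M => // y' M IH; rewrite in_cons big_cons => /predU1P[->|yM].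
      by rewrite lerDl sumr_ge0.
    by apply: le_trans (IH yM) _; rewrite lerDr.
  apply: le_trans (h1 (fun x => \sum_(z <- K0) `|x - z|) K x _ xK); last first.
    by move=> y; rewrite sumr_ge0.
  exact: (h1 (fun z => `|x - z|)).
(* shrinking a slope by [1 - de] changes the values on [K] by at most [de D <= e0] *)
pose de := Num.min (2^-1) (e0 / (D + 1)).
have de0 : 0 < de by rewrite lt_min invr_gt0 ltr0Sn divr_gt0// ltr_wpDl.
have de1 : de < 1 by rewrite gt_min; apply/orP; left; lra.
have deD : de * D <= e0.
  apply: le_trans (_ : e0 / (D + 1) * D <= _).
    by rewrite ler_wpM2r// ge_min lexx orbT.
  rewrite mulrAC ler_pdivrMr; last by lra.
  by rewrite ler_wpM2l//; lra.
have mL0 p : p \in L0 -> minorant g h de p.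
  by move=> pL; apply: minorant_le => // l _; exact: pg.
have mp0 : minorant g h de p0 by apply: mL0; rewrite L0E mem_head.
have [L [mL hL]] := minorants_finite ep0 de0 de1 ch hle hge C0 hC gC mp0.
pose M := L0 ++ L.
have mM p : p \in M -> minorant g h de p by rewrite mem_cat => /orP[/mL0|/mL].
have Mn : M != [::] by [].
have sm0 : small de (fun _ : E => 0) by exact: small0.
have aM : admissible M.
  move=> p q /mM [pS pg'] /mM [qS qg'].
  have [l hl lpq] := norming_functional (p.1 - q.1).
  have affE m : functional m -> aff (p.1 - q.1, p.2 + q.2) m = aff p m + aff q (fopp m).
    by move=> fm; rewrite /aff /fopp /= (functionalB _ _ fm); ring.
  suff : aff (p.1 - q.1, p.2 + q.2) l <= 0 by rewrite /aff /= lpq subr_le0.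
  apply: norm_principle => //.
    move=> m Sm; have hm := gb_unit hS Sm; rewrite affE; last exact: hm.1.
    apply: le_trans (hle m Sm); rewrite lerD ?pS ?qS//; exact: gb_opp Sm.
  have := pg' _ dual_unit0 sm0; have := qg' _ dual_unit0 sm0.
  have := gg _ dual_unit0; rewrite /aff /=.
  have -> : fopp (fun _ : E => 0 : R) = (fun _ => 0) by apply/funext => x; rewrite /fopp oppr0.
  by rewrite oppr_le0; lra.
pose f1 := envelope M.
(* beyond this radius [(y, s)] below is a minorant also on the interior *)
have [N hN] := finite_net dimE (2 * C / de) ep0.
have kf1 : kc f1 by exact: envelope_kc.
exists f1, ([seq p.1 | p <- M] ++ N), ep; split=> //.
- move=> x xK; have xL0 : (x, f x) \in L0 by apply: map_f; rewrite inE xK orbT.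
  have up : f1 x <= f x.
    by apply: (@envelope_node _ _ M _ (x, f x)) => //; rewrite mem_cat xL0.
  suff : f x - e0 <= f1 x by rewrite ler_norml => ?; apply/andP; split; lra.
  have [l hl lz] := kc_subgradient x kf.
  have de' : `|1 - de| <= 1 by rewrite ger0_norm ?subr_ge0 ?(ltW de1)//; lra.
  pose m y := (1 - de) * l y.
  have hm : dual_unit m by exact: dual_unitZ.
  have smm : small de m.
    move=> y; rewrite /m normrM ger0_norm ?subr_ge0 ?(ltW de1)//.
    by rewrite ler_wpM2l ?subr_ge0 ?(ltW de1)// hl.2.
  apply: envelope_ge => //; exists m => // p /mM [_ /(_ m hm smm) pm].
  have [q qL gq] := gE m.
  have /mapP[z zK qE] := qL.
  have h1 := lz z; have h2 := hD x z xK zK.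
  have h3 : de * l (x - z) <= de * D.
    by rewrite ler_wpM2l ?(ltW de0)//; apply: le_trans (dual_unit_le _ hl) _.
  move: h1 h3 pm; rewrite gq qE {2 3}/m /aff /= !(functionalB _ _ hl.1) /m => h1 h3 pm.
  by rewrite /aff in pm *; lra.
move=> f' kf' hf' y; have [_ lip' kat'] := kf'; have [_ lip1 _] := kf1.
have hfM p : p \in M -> `|f' p.1 - f1 p.1| <= ep.
  by move=> pM; apply: hf'; rewrite mem_cat map_f.
have up : f' y <= f1 y + ep.
  apply: envelope_max => // p pM; have := envelope_node aM pM.
  by have := hfM p pM; rewrite ler_norml -/f1 => /andP[_ ?] ?; lra.
suff lo : f1 y - 20 * ep <= f' y.
  have h20 : 20 * ep = e by rewrite /ep; field.
  by rewrite ler_norml; apply/andP; split; lra.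
have [yR|yR] := leP `|y| (2 * C / de).
  have [z zN yz] := hN y yR.
  have := hf' z; rewrite mem_cat zN orbT => /(_ isT); rewrite ler_norml => /andP[? _].
  have := lip1 y z; have := lip' z y; rewrite (distrC z) => ? ?; lra.
have y0 : y != 0.
  apply: contraTneq yR => ->; rewrite normr0 -leNgt divr_ge0 ?mulr_ge0//.
  exact: ltW.
have [s0 Ss0 s0y] := gb_norming hS y0.
pose A := [set m y - h m | m in S].
have supA : has_sup A.
  split; first by exists (s0 y - h s0), s0.
  exists (`|y| + C) => _ [m Sm <-]; have hm := gb_unit hS Sm.
  have := dual_unit_le y hm; have := hC m hm; rewrite ler_norml => /andP[? _] ?; lra.
pose s := sup A.
have sS m : S m -> m y - h m <= s.
  by move=> Sm; apply: ub_le_sup; [exact: supA.2|exists m].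
have [_ [sg Ssg <-] sgs] := sup_adherent ep0 supA.
(* the supremum of [m y - h m] over [S] is the least height at which [y] may be added *)
have mb : minorant g h de (y, s).
  split=> [m Sm|m hm sm]; rewrite /aff /=; first by have := sS m Sm; lra.
  have := sS s0 Ss0; rewrite s0y; have := hC s0 (gb_unit hS Ss0).
  have := gC m hm; rewrite !ler_norml => /andP[? ?] /andP[? ?] ?.
  have := le_trans (ler_norm _) (sm y).
  have : 2 * C <= `|y| * de by rewrite -ler_pdivrMr// ltW.
  by rewrite mulrBl mul1r [`|y| * _]mulrC; lra.
have f1s : f1 y <= s + 3 * ep.
  apply: envelope_le => // t [l hl ht].
  have [p pL hp] := hL l (y, s) hl mb.
  have := ht p; rewrite mem_cat pL orbT => /(_ isT).
  by rewrite {1}/aff /= in hp; lra.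
have hsg := gb_unit hS Ssg.
have [p1 [r1 [mp1 _ hp1 _]]] := minorant_boundary ep0 de0 de1 ch hle hge C0 gC (gb_opp hS Ssg).
have [p pL hp] := hL _ p1 (dual_unitN hsg) mp1.
have pM : p \in M by rewrite mem_cat pL orbT.
have := kat' y p.1; have := dual_unit_le (y - p.1) hsg.
rewrite (functionalB _ _ hsg.1).
have := hfM p pM; have := envelope_node aM pM; rewrite -/f1.
rewrite ler_norml => ? /andP[? ?] ? ?.
have := hge _ Ssg; have : aff p (fopp sg) = - sg p.1 - p.2 by [].
have hp' : aff p1 (fopp sg) <= aff p (fopp sg) + 3 * ep := hp.
by rewrite -/s in sgs; move=> ? ?; lra.
Qed.

End Sandwich.

(** * From approximately isolated to isolated *)

Section Pointwise.
Context {R : realType} {U : topologicalType} (A : set {ptws U -> R}).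

(** The filter generated by the finite constraints converges pointwise to [f], hence it
    contains all neighbourhoods of [f]. *)
Lemma ptws_nbhsP (f : A) (P : set A) : nbhs f P <->
  exists (K : seq U) (r : R), 0 < r /\
    forall g : A, (forall x, x \in K -> `|val g x - val f x| < r) -> P g.
Proof.
split; last first.
  move=> [K [r [r0 h]]].
  have near1 x : nbhs f [set g : A | `|val g x - val f x| < r].
    have cval : continuous (set_val : A -> {ptws U -> R}).
      exact: initial_continuous.
    have cx : continuous (fun g : {ptws U -> R} => (g x : R)).
      exact: (@proj_continuous U (fun _ => R) x).
    have c : continuous (fun g : A => (set_val g x : R)).
      by move=> g; apply: (@continuous_comp A {ptws U -> R} R set_val (fun g => g x)); [exact: cval|exact: cx].
    have /cvgrPdist_lt /(_ r r0) := c f.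
    by apply: filterS => g /=; rewrite set_valE distrC.
  suff : nbhs f [set g : A | forall x, x \in K -> `|val g x - val f x| < r].
    by apply: filterS => g; exact: h.
  elim: K {h} => [|x K IH]; first by apply: filterS filterT => g _ x.
  apply: filterS (filterI (near1 x) IH) => g [gx gK] y.
  by rewrite in_cons => /predU1P[->|/gK].
move=> [_ [[W oW <-] /= Wf WP]].
pose F : set_system {ptws U -> R} := [set Q | exists (K : seq U) (r : R),
  0 < r /\ forall g : {ptws U -> R}, (forall x, x \in K -> `|g x - val f x| < r) -> Q g].
have FF : Filter F.
  split=> [|Q Q' [K [r [r0 h]]] [K' [r' [r'0 h']]]|Q Q' QQ' [K [r [r0 h]]]].
  - by exists [::], 1.
  - exists (K ++ K'), (Num.min r r'); split; first by rewrite lt_min r0.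
    move=> g hg; split; [apply: h|apply: h'] => x xK.
      by have := hg x; rewrite mem_cat xK lt_min => /(_ isT) /andP[].
    by have := hg x; rewrite mem_cat xK orbT lt_min => /(_ isT) /andP[].
  - by exists K, r; split=> // g /h /QQ'.
have Ff : {ptws, F --> (val f : {ptws U -> R})}.
  apply/pointwise_cvgP => x; apply/cvgrPdist_lt => e e0.
  by exists [:: x], e; split=> // g /(_ x (mem_head _ _)) /=; rewrite distrC.
have [K [r [r0 h]]] : F W.
  apply: Ff; apply: open_nbhs_nbhs; split=> //.
by exists K, r; split=> // g hg; apply: WP; exact: h.
Qed.

End Pointwise.

(** The intervals [[u n - d n, u n + d n]] meet pairwise, hence have a common point. *)
Lemma real_limit (R : realType) (u d : nat -> R) :
  (forall m n, `|u m - u n| <= d m + d n) ->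
  exists g, forall n, `|g - u n| <= d n.
Proof.
move=> h; pose A := range (fun n => u n - d n).
have ub n : ubound A (u n + d n).
  move=> _ [m _ <-]; have := h m n; rewrite ler_norml => /andP[_ ?]; lra.
exists (sup A) => n; rewrite ler_norml; apply/andP; split.
  rewrite lerBrDr addrC; apply: ub_le_sup; last by exists n.
  by exists (u 0%N + d 0%N).
rewrite lerBlDl; apply: ge_sup => //; by exists (u n - d n), n.
Qed.

Lemma half_exp_small (R : realType) (e : R) : 0 < e -> exists n, 2^-1 ^+ n < e :> R.
Proof.
move=> e0; exists (Num.bound e^-1).
have h : e^-1 < (Num.bound e^-1)%:R by apply: archi_boundP; rewrite invr_ge0 ltW.
rewrite exprVn invf_plt ?posrE ?exprn_gt0//; apply: lt_le_trans h _.
by rewrite -natrX ler_nat ltnW// ltn_expl.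
Qed.

Lemma le_half_exp (R : realType) (a b c : R) :
  (forall n : nat, a <= b + c * 2^-1 ^+ n) -> a <= b.
Proof.
move=> h; apply/ler_addgt0Pr => e e0.
have c0 : 0 < `|c| + 1 by rewrite ltr_wpDl.
have [n hn] := half_exp_small (divr_gt0 e0 c0).
apply: le_trans (h n) _; rewrite lerD2l.
have p0 : 0 <= 2^-1 ^+ n :> R by rewrite exprn_ge0// invr_ge0.
apply: le_trans (_ : (`|c| + 1) * 2^-1 ^+ n <= _).
  by rewrite ler_wpM2r// (le_trans (ler_norm _))// lerDl.
by rewrite mulrC -ler_pdivlMr// ltW.
Qed.

Section Density.
Context {R : realType} {E : normedModType R}.

Lemma KCP (f : {ptws E -> R}) : KC E f <-> kc (f : E -> R).
Proof.
split=> [[cvx lip kat]|[cvx lip kat]]; split=> //.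
- move=> x z t t0 t1; have t01 : Itv.spec (@Itv.num_sem R) (Itv.Real `[0%Z, 1%Z]) t.
    by rewrite /Itv.num_sem /= ger0_real//= in_itv/= t0.
  by have := cvx (Itv.mk t01) x z (in_setT _) (in_setT _).
- move=> t x z _ _; rewrite convRE; apply: (cvx x z t%:num).
    by [].
  by [].
Qed.

Lemma KC_dist_lt (f g : KC E) (e a : R) : a < e ->
  (forall x, `|val f x - val g x| <= a) -> KC_dist f g < e.
Proof.
move=> ae h; apply: le_lt_trans ae; apply: ge_sup.
  by exists (`|val f 0 - val g 0|), 0.
by move=> _ [x _ <-].
Qed.

(** A basic neighbourhood of a Katetov function, as it occurs in the proof of the Baire
    category theorem. *)
Record state : Type := State {
  st_fun : E -> R; st_pts : seq E; st_rad : R;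
  st_kc : kc st_fun; st_pos : 0 < st_rad }.

Definition in_state (s : state) (f : E -> R) : Prop :=
  forall x, x \in st_pts s -> `|f x - st_fun s x| <= st_rad s.

(** The halves and quarters of radii make the closed sets of a sequence of refinements
    nested with room to spare: the limit stays inside every one of them together with a
    neighbourhood. *)
Definition refines (n : nat) (s s' : state) : Prop :=
  [/\ forall x, x \in st_pts s -> `|st_fun s' x - st_fun s x| <= st_rad s / 2,
    {subset st_pts s <= st_pts s'}, st_rad s' <= st_rad s / 4 &
    forall f, kc f -> in_state s' f -> forall y, `|f y - st_fun s' y| <= 2^-1 ^+ n].

Lemma refines_in n s s' f : refines n s s' -> in_state s' f ->
  forall x, x \in st_pts s -> `|f x - st_fun s x| <= st_rad s * (3 / 4).
Proof.
move=> [h1 h2 h3 _] h x xs; have := h x (h2 x xs); have := h1 x xs.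
by have := ler_distD (st_fun s' x) (f x) (st_fun s x); lra.
Qed.

Context (d : nat) (dimE : has_dim E d) (S : set (E -> R)).
Hypothesis hS : gauge_boundary S.

Lemma refinement n s : exists s', refines n s s'.
Proof.
have r0 := st_pos s.
have e0 : 0 < 2^-1 ^+ n :> R by rewrite exprn_gt0// invr_gt0.
have [f1 [K1 [rho [kf1 rho0 h1 h2]]]] :=
  approx_isolated dimE hS (st_pts s) (st_kc s) (divr_gt0 r0 (ltr0Sn _ 1)) e0.
have rp : 0 < Num.min rho (st_rad s / 4) by rewrite lt_min rho0 divr_gt0.
exists (State (K1 ++ st_pts s) kf1 rp); split=> //=.
- by move=> x xs; rewrite mem_cat xs orbT.
- by rewrite ge_min lexx orbT.
move=> f kf hf; apply: h2 => // x xK; apply: le_trans (hf x _) _ => /=.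
  by rewrite mem_cat xK.
by rewrite ge_min lexx.
Qed.

(** Baire category: the limit of a nested sequence of states, the [n]-th of which, for
    positive [n], has diameter at most [2 / 2 ^ n] for the uniform distance, is isolated, and it lies in
    the given open set since the first state does. *)
Theorem dense_isolated : dense (isolated_KC E).
Proof.
move=> O [f Of] oO.
have /ptws_nbhsP [K0 [r0 [r00 hO]]] : nbhs f O by apply: open_nbhs_nbhs.
have kf : kc (val f : E -> R) by apply/KCP; exact: set_mem (valP f).
have r02 : 0 < r0 / 2 by rewrite divr_gt0.
pose s0 := State K0 kf r02.
have [step hstep] := choice (fun ns : nat * state => refinement ns.1 ns.2).
pose s := fix s n := if n is m.+1 then step (m.+1, s m) else s0.
have sS n : refines n.+1 (s n) (s n.+1) by exact: (hstep (n.+1, s n)).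
have inS n f' : in_state (s n.+1) f' -> in_state (s n) f'.
  move=> h x xs; apply: le_trans (refines_in (sS n) h xs) _.
  by have := st_pos (s n); lra.
have inle m n f' : in_state (s (n + m)%N) f' -> in_state (s n) f'.
  by elim: m => [|m IH]; rewrite ?addn0// addnS => /inS.
have self n : in_state (s n) (st_fun (s n)).
  by move=> x _; rewrite subrr normr0 ltW// st_pos.
have far m n : in_state (s n) (st_fun (s (n + m)%N)) by apply: (inle m); exact: self.
pose u n := st_fun (s n.+1).
have uu m n x : `|u (n + m)%N x - u n x| <= 2^-1 ^+ n.
  apply: le_trans (_ : 2^-1 ^+ n.+1 <= _).
    have [_ _ _ h] := sS n; apply: h; first exact: st_kc.
    by rewrite /u -addSn; exact: far.
  by rewrite exprS ler_piMl// ?exprn_ge0 ?invr_ge0// invf_le1//; lra.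
have [g hg] : exists g : E -> R, forall x n, `|g x - u n x| <= 2^-1 ^+ n.
  suff /choice[g hg] : forall x, exists gx, forall n, `|gx - u n x| <= 2^-1 ^+ n by exists g.
  move=> x; apply: (@real_limit _ (fun n => u n x)) => m n.
  have pos k : 0 <= 2^-1 ^+ k :> R by rewrite exprn_ge0// invr_ge0.
  have [mn|nm] := leqP m n.
    rewrite distrC -(subnKC mn); apply: le_trans (uu _ _ _) _.
    by rewrite lerDl.
  rewrite -(subnKC (ltnW nm)); apply: le_trans (uu _ _ _) _.
  by rewrite lerDr.
have gu x n : g x <= u n x + 2^-1 ^+ n /\ u n x <= g x + 2^-1 ^+ n.
  by have := hg x n; rewrite ler_norml => /andP[? ?]; split; lra.
have kg : kc g.
  split=> [x z t t0 t1|x z|x z].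
  - apply: (@le_half_exp _ _ _ 2) => n; have [cvx _ _] := st_kc (s n.+1).
    have := cvx x z t t0 t1; rewrite -/(u n).
    have [h1 _] := gu (t *: x + (1 - t) *: z) n.
    have [_ h2] := gu x n; have [_ h3] := gu z n.
    have t1' : 0 <= 1 - t by rewrite subr_ge0.
    have := ler_wpM2l t0 h2; have := ler_wpM2l t1' h3.
    by rewrite !mulrDr; lra.
  - apply: (@le_half_exp _ _ _ 2) => n; have [_ lip _] := st_kc (s n.+1).
    have := lip x z; rewrite -/(u n).
    by have [h1 _] := gu x n; have [_ h2] := gu z n; lra.
  - apply: (@le_half_exp _ _ _ 2) => n; have [_ _ kat] := st_kc (s n.+1).
    have := kat x z; rewrite -/(u n).
    by have [_ h1] := gu x n; have [_ h2] := gu z n; lra.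
have gin n : in_state (s n) g.
  move=> x xs; apply: (@le_half_exp _ _ _ 1) => m.
  have h1 := far m.+1 n x xs; have h2 := hg x (n + m)%N.
  apply: le_trans (ler_distD (u (n + m)%N x) _ _) _.
  rewrite addrC lerD//; first by rewrite /u -addnS.
  apply: le_trans h2 _; rewrite mul1r addnC exprD ler_piMr//.
  by rewrite exprn_ile1// ?invr_ge0// invf_le1//; lra.
have KCg : (g : {ptws E -> R}) \in KC E by apply/mem_set/KCP.
pose gK : KC E := exist _ (g : {ptws E -> R}) KCg.
exists gK; split.
  apply: hO => x xK; apply: le_lt_trans (gin 0%N x xK) _.
  by rewrite /=; lra.
move=> e e0; have [n hn] := half_exp_small (divr_gt0 e0 (ltr0Sn _ 2)).
have [_ _ _ huni] := sS n.
have rn := st_pos (s n.+1).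
apply/ptws_nbhsP; exists (st_pts (s n.+1)), (st_rad (s n.+1) / 4).
split; first by lra.
move=> h hh; have kh : kc (val h : E -> R) by apply/KCP; exact: set_mem (valP h).
have hin : in_state (s n.+1) (val h).
  move=> x xs; have := hh x xs; have := refines_in (sS n.+1) (gin n.+2) xs.
  by have := ler_distD (g x) (val h x) (st_fun (s n.+1) x); rewrite /=; lra.
apply: (@KC_dist_lt _ _ _ (2 * 2^-1 ^+ n)) => [|x]; first by lra.
have h1 := huni _ kh hin x; have h2 := huni _ kg (gin n.+1) x.
have h3 := ler_distD (st_fun (s n.+1) x) (g x) (val h x).
have h4 : 2^-1 ^+ n.+1 = 2^-1 * 2^-1 ^+ n :> R by rewrite exprS.
have h5 : 0 <= 2^-1 ^+ n :> R by rewrite exprn_ge0// invr_ge0.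
rewrite [`|st_fun _ x - val h x|]distrC in h3.
by rewrite h4 in h1 h2; rewrite /=; lra.
Qed.

End Density.

(** * The dual norm *)

Section DualNorm.
Context {R : realType} {E : normedModType R}.

Lemma linear_functionalP (l : E -> R^o) : linear l <-> functional l.
Proof. by split=> h a x y; exact: h. Qed.

Lemma bounded_functional_continuous (l : E -> R^o) M : functional l ->
  (forall x, `|l x| <= M * `|x|) -> continuous l.
Proof.
move=> fl h x; apply/cvgrPdist_lt => e e0.
have M1 : 0 < `|M| + 1 by rewrite ltr_wpDl.
apply/nbhs_normP; exists (e / (`|M| + 1)); first by rewrite /= divr_gt0.
move=> y /= xy; rewrite -(functionalB _ _ fl); apply: le_lt_trans (h _) _.
apply: le_lt_trans (_ : (`|M| + 1) * `|x - y| < _).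
  by rewrite ler_wpM2r// (le_trans (ler_norm _))// lerDl.
by rewrite mulrC -ltr_pdivlMr.
Qed.

Lemma dual_norm_has_sup (l : E -> R^o) : dual_space E l ->
  has_sup [set `|l x| | x in unit_ball E].
Proof.
move=> [/linear_functionalP fl cl]; split; first by exists `|l 0|, 0; rewrite /unit_ball /= ?normr0.
have /cvgrPdist_lt /(_ 1 ltr01) /nbhs_normP [r /= r0 hr] := cl 0.
exists (2 / r) => _ [x x1 <-].
have : `|l 0 - l ((r / 2) *: x)| < 1.
  apply: hr => /=; rewrite sub0r normrN normrZ gtr0_norm ?divr_gt0//.
  apply: le_lt_trans (_ : r / 2 * 1 < _); last by lra.
  by rewrite ler_wpM2l// ltW// divr_gt0.
rewrite (functional0 fl) sub0r normrN (functionalZ _ _ fl) normrM.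
rewrite gtr0_norm ?divr_gt0// => h; rewrite ler_pdivlMr// mulrC.
by move: h; rewrite mulrAC ltr_pdivrMr// mul1r => /ltW.
Qed.

Lemma dual_norm_ge0 (l : E -> R^o) : dual_space E l -> 0 <= dual_norm l.
Proof.
move=> hl; apply: le_trans (_ : `|l 0| <= _) => //.
apply: ub_le_sup; first exact: (dual_norm_has_sup hl).2.
by exists 0 => //; rewrite /unit_ball /= normr0.
Qed.

Lemma dual_norm_bound (l : E -> R^o) x : dual_space E l ->
  `|l x| <= dual_norm l * `|x|.
Proof.
move=> hl; have [/linear_functionalP fl _] := hl.
have [->|x0] := eqVneq x 0; first by rewrite (functional0 fl) !normr0 mulr0.
have x0' : 0 < `|x| by rewrite normr_gt0.
rewrite -ler_pdivrMr// mulrC -[`|x|^-1]ger0_norm ?invr_ge0// -normrM.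
rewrite -(functionalZ _ _ fl); apply: ub_le_sup.
  exact: (dual_norm_has_sup hl).2.
exists (`|x|^-1 *: x) => //.
by rewrite /unit_ball /= normrZ normfV normr_id mulVf// gt_eqF.
Qed.

Lemma dual_norm_le (l : E -> R^o) M : functional l -> 0 <= M ->
  (forall x, `|l x| <= M * `|x|) -> dual_space E l /\ dual_norm l <= M.
Proof.
move=> fl M0 h; split.
  by split; [exact/linear_functionalP|exact: bounded_functional_continuous h].
apply: ge_sup; first by exists `|l 0|, 0; rewrite /unit_ball /= ?normr0.
move=> _ [x x1 <-]; apply: le_trans (h x) _.
by rewrite -[leRHS]mulr1 ler_wpM2l.
Qed.

Lemma dual_ballP (l : E -> R^o) : dual_ball E l <-> dual_unit l.
Proof.
split=> [[hl l1]|[fl hl]].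
  split=> [|x]; first by apply/linear_functionalP; exact: hl.1.
  apply: le_trans (dual_norm_bound x hl) _.
  by rewrite -[leRHS]mul1r ler_wpM2r.
have [] := @dual_norm_le l 1 fl ler01; last by split.
by move=> x; rewrite mul1r.
Qed.

End DualNorm.

(** * Exposed faces and their relative boundaries *)

Section FacetInterior.
Context {R : realType} {E : normedModType R} (d : nat) (dimE : has_dim E d).
Implicit Types (l m : E -> R).

(** The functionals which are normed by some [u] without lying inside a facet
    [{m | m u = 1}]. The vector [y] exposes a subface of [{m | m u = 1}] which, lying in the kernel of [y] and in an affine hyperplane, has
    dimension at most [d - 2]. *)
Definition lower_point : set (E -> R) := [set l | dual_unit l /\
  exists u y, [/\ `|u| = 1, `|y| = 1, l u = 1, l y = 0 &
    forall m, dual_unit m -> m u = 1 -> m y <= 0]].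

(** The face [{m | m u = 1}] is a facet and contains a ball of radius [r] around [l] in
    its affine span. *)
Definition facet_interior l u (r : R) := [/\ dual_unit l, `|u| = 1, l u = 1, 0 < r &
  forall nu, functional nu -> nu u = 0 -> (forall x, `|nu x| <= r * `|x|) ->
    dual_unit (fun x => l x + nu x)].

(** For each unit vector [y] with [l y = 0] some [m] in the face has [m y > 0]; by
    compactness [m y >= c] with one [c]. Perturbing [l] by [nu] with norm at most [c]
    stays in the ball: along the component [y] of a vector, [nu] is dominated by
    such an [m]. *)
Lemma not_lower_facet_interior l u : dual_unit l -> ~ lower_point l ->
  `|u| = 1 -> l u = 1 -> exists r, facet_interior l u r.
Proof.
move=> hl nl u1 lu.
pose Q (A : set E) := exists2 c : R, 0 < c & forall y, A y -> `|y| = 1 -> l y = 0 ->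
  exists2 m, dual_unit m & m u = 1 /\ c <= m y.
have [c c0 hc] : Q [set y | `|y| <= 1].
  apply: (ball_induct dimE).
  - by exists 1.
  - by move=> A B AB [c c0 h]; exists c => // y /AB; exact: h.
  - move=> A B [c c0 h] [c' c'0 h']; exists (Num.min c c'); first by rewrite lt_min c0.
    move=> y [Ay|By] y1 ly; [have [m hm [mu my]] := h y Ay y1 ly|
      have [m hm [mu my]] := h' y By y1 ly]; exists m => //; split=> //.
      by rewrite ge_min my.
    by rewrite ge_min my orbT.
  move=> y0 y01; have [ny|y1] := eqVneq `|y0| 1; last first.
    have y0lt : `|y0| < 1 by rewrite lt_neqAle y1.
    exists ((1 - `|y0|) / 2); first by lra.
    exists 1 => // y [_ yy0] y1'; exfalso.
    by have := lerB_dist y y0; rewrite y1'; lra.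
  have [ly0|ly0] := eqVneq (l y0) 0; last first.
    exists (`|l y0| / 2); first by rewrite divr_gt0// normr_gt0.
    exists 1 => // y [_ yy0] _ ly; exfalso.
    have : 0 < `|l y0| by rewrite normr_gt0.
    have := hl.2 (y - y0); rewrite (functionalB _ _ hl.1) ly sub0r normrN.
    by lra.
  have [m [hm mu my]] : exists m, [/\ dual_unit m, m u = 1 & 0 < m y0].
    apply: contrapT => h; apply: nl; split=> //; exists u, y0; split=> // m hm mu.
    by rewrite leNgt; apply/negP => my; apply: h; exists m.
  exists (m y0 / 2); first by lra.
  exists (m y0 / 2); first by lra.
  move=> y [_ yy0] _ _; exists m => //; split=> //.
  have := dual_unit_ge (y - y0) hm; rewrite (functionalB _ _ hm.1).
  by lra.
exists c; split=> // nu fnu nuu hnu; apply: dual_unitP => [a x z|z].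
  by rewrite fnu hl.1; ring.
pose y := z - l z *: u.
have zE : z = l z *: u + y by rewrite /y addrC subrK.
have ly : l y = 0 by rewrite /y (functionalB _ _ hl.1) (functionalZ _ _ hl.1) lu; ring.
have nuz : nu z = nu y.
  by rewrite [in LHS]zE (functionalD _ _ fnu) (functionalZ _ _ fnu) nuu; ring.
have [y0|y0] := eqVneq y 0.
  by rewrite nuz y0 (functional0 fnu) addr0 dual_unit_le.
have y0' : 0 < `|y| by rewrite normr_gt0.
have [|||m hm [mu my]] := hc (`|y|^-1 *: y).
- by rewrite /= normrZ normfV normr_id mulVf ?gt_eqF.
- by rewrite normrZ normfV normr_id mulVf ?gt_eqF.
- by rewrite (functionalZ _ _ hl.1) ly mulr0.
move: my; rewrite (functionalZ _ _ hm.1) ler_pdivlMl// mulrC => my.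
apply: le_trans (dual_unit_le z hm).
have -> : m z = l z + m y.
  by rewrite [in LHS]zE (functionalD _ _ hm.1) (functionalZ _ _ hm.1) mu mulr1.
rewrite nuz lerD2l; apply: le_trans (le_trans (ler_norm _) (hnu y)) my.
Qed.

(** A functional near [l] is a multiple of [l] plus a small functional killing [u]. *)
Lemma facet_decomposition l u r m rho : facet_interior l u r -> dual_unit m ->
  dnear rho l m -> exists s nu, [/\ s <= 0 /\ - rho <= s, functional nu, nu u = 0,
    forall x, `|nu x| <= 2 * rho * `|x| & forall x, m x = (1 + s) * l x + nu x].
Proof.
move=> [hl u1 lu r0 _] hm lm; pose s := m u - 1.
have s0 : s <= 0 by rewrite subr_le0 -u1 dual_unit_le.
have srho : - rho <= s.
  by have := lm u; rewrite lu u1 mulr1 ler_norml /s => /andP[].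
exists s, (fun x => m x - l x - s * l x); split=> //.
- by move=> a x y; rewrite hm.1 hl.1; ring.
- by rewrite lu /s; ring.
- move=> x; apply: le_trans (ler_normB _ _) _.
  have -> : 2 * rho * `|x| = rho * `|x| + rho * `|x| by ring.
  rewrite lerD ?lm// normrM.
  apply: ler_pM => //; last exact: hl.2.
  by rewrite ler0_norm//; lra.
- by move=> x; ring.
Qed.

(** In [m = (1 + s) l + nu] with [s <= 0], both the loss [s] along [l] and the small
    displacement [nu] within the facet are absorbed by a point of the segment from the
    origin to the facet. *)
Lemma facet_interior_good l u r : facet_interior l u r -> good l.
Proof.
move=> fi eta eta0 eta1; have [hl u1 lu r0 hfi] := fi.
exists (Num.min (eta / 2) (eta * r / 4)).
  by rewrite lt_min !divr_gt0 ?mulr_gt0.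
set rho := Num.min _ _ => m hm lm.
have rho1 : rho <= eta / 2 by rewrite ge_min lexx.
have rho2 : rho <= eta * r / 4 by rewrite ge_min lexx orbT.
have [s [nu [[s0 srho] fnu nuu hnu mE]]] := facet_decomposition fi hm lm.
pose c := 1 + s / eta.
have c1 : c <= 1 by rewrite gerDl pmulr_lle0// invr_gt0.
have c2 : 2^-1 <= c.
  have : - 2^-1 <= s / eta by rewrite ler_pdivlMr//; lra.
  by rewrite /c; lra.
have c0 : 0 < c by lra.
pose w x := c * (l x + (eta * c)^-1 * nu x).
exists w.
  apply: dual_unitZ; last by rewrite gtr0_norm.
  apply: hfi; first by move=> a x y; rewrite fnu; ring.
    by rewrite nuu mulr0.
  move=> x; rewrite normrM gtr0_norm ?invr_gt0 ?mulr_gt0//.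
  rewrite ler_pdivrMl ?mulr_gt0//; apply: le_trans (hnu x) _.
  rewrite mulrA ler_wpM2r//.
  have : eta * 2^-1 * r <= eta * c * r by rewrite ler_wpM2r ?(ltW r0)// ler_wpM2l// ltW.
  by lra.
apply/funext => x; rewrite mE /w /c; field.
by rewrite (gt_eqF eta0); have := c0; rewrite /c => h; apply/negP => /eqP h'; nra.
Qed.

Lemma scaled_functional (nu : E -> R) (r : R) : functional nu -> 0 < r ->
  exists2 t, 0 < t & forall x, `|t * nu x| <= r * `|x|.
Proof.
move=> fnu r0; have [M M0 hM] := functional_bounded dimE fnu.
exists (r / M); first by rewrite divr_gt0.
move=> x; rewrite normrM gtr0_norm ?divr_gt0// mulrAC ler_pdivrMr//.
by rewrite -mulrA ler_wpM2l ?hM ?(mulrC _ M)// ltW.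
Qed.

(** If [m] is near [l] and is normed by [u'], then [m] lies in the facet itself, inside
    it; so all small [nu'] killing [u] may be added to or subtracted from [m]. As
    [u'] and [y'] are extremal for [m], they are killed by all these [nu'],
    hence are multiples of [u]; this leaves [u' = u] and [y' = 0]. *)
Lemma facet_interior_misses l u r : facet_interior l u r ->
  exists2 rho : R, 0 < rho & forall m, dual_unit m -> dnear rho l m -> ~ lower_point m.
Proof.
move=> fi; have [hl u1 lu r0 hfi] := fi.
exists (Num.min (2^-1) (r / 8)); first by rewrite lt_min invr_gt0 ltr0Sn divr_gt0.
set rho := Num.min _ _ => m hm lm [_ [u' [y' [u'1 y'1 mu' my' hy']]]].
have rho1 : rho <= 2^-1 by rewrite ge_min lexx.
have rho2 : rho <= r / 8 by rewrite ge_min lexx orbT.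
have [s [nu [[s0 srho] fnu nuu hnu mE]]] := facet_decomposition fi hm lm.
have s1 : 2^-1 <= 1 + s by lra.
have s1' : 0 < 1 + s by lra.
have hl' : dual_unit (fun x => l x + (1 + s)^-1 * nu x).
  apply: hfi; first by move=> a x y; rewrite fnu; ring.
    by rewrite nuu mulr0.
  move=> x; rewrite normrM gtr0_norm ?invr_gt0// ler_pdivrMl//.
  apply: le_trans (hnu x) _; rewrite mulrA ler_wpM2r//.
  have : 2^-1 * r <= (1 + s) * r by rewrite ler_wpM2r// ltW.
  by lra.
have sE : s = 0.
  apply/eqP; rewrite eq_le s0/=.
  have : m u' = (1 + s) * (l u' + (1 + s)^-1 * nu u').
    by rewrite mE; field; rewrite gt_eqF.
  have : (1 + s) * (l u' + (1 + s)^-1 * nu u') <= (1 + s) * 1.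
    apply: ler_wpM2l; first exact: ltW.
    by have := dual_unit_le u' hl'; rewrite u'1.
  by move=> h1 h2; rewrite -h2 mu' in h1; lra.
have mnu nu' : functional nu' -> nu' u = 0 -> (forall x, `|nu' x| <= r / 2 * `|x|) ->
    dual_unit (fun x => m x + nu' x).
  move=> fnu' nu'u hnu'.
  have -> : (fun x => m x + nu' x) = (fun x => l x + (nu x + nu' x)).
    by apply/funext => x; rewrite mE sE; ring.
  apply: hfi; first by move=> a x y; rewrite fnu fnu'; ring.
    by rewrite nuu nu'u addr0.
  move=> x; apply: le_trans (ler_normD _ _) _.
  have := hnu x; have := hnu' x.
  have : 2 * rho * `|x| <= r / 2 * `|x| by rewrite ler_wpM2r//; lra.
  by have := normr_ge0 x; lra.
have r2 : 0 < r / 2 by rewrite divr_gt0.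
have u0 : u != 0 by rewrite -normr_gt0 u1.
have [a u'E] : exists a, u' = a *: u.
  apply: (separating_functional dimE u0) => nu' fnu' nu'u.
  have [t t0 ht] := scaled_functional fnu' r2.
  have h1 : m u' + t * nu' u' <= 1.
    rewrite -u'1; apply: (@dual_unit_le _ _ (fun x => m x + t * nu' x)).
    by apply: mnu => //; [move=> b x y; rewrite fnu'; ring|rewrite nu'u mulr0].
  have h2 : m u' + - t * nu' u' <= 1.
    rewrite -u'1; apply: (@dual_unit_le _ _ (fun x => m x + - t * nu' x)).
    apply: mnu => //; [by move=> b x y; rewrite fnu'; ring|by rewrite nu'u mulr0|].
    by move=> x; rewrite mulNr normrN.
  have : t * nu' u' = 0 by lra.
  by move/eqP; rewrite mulf_eq0 gt_eqF//= => /eqP.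
have mu : m u = 1 by rewrite mE sE lu nuu; ring.
have uE : u' = u.
  have : a = 1 by move: mu'; rewrite u'E (functionalZ _ _ hm.1) mu mulr1.
  by move=> a1; rewrite u'E a1 scale1r.
have [b y'E] : exists b, y' = b *: u.
  apply: (separating_functional dimE u0) => nu' fnu' nu'u.
  have [t t0 ht] := scaled_functional fnu' r2.
  have h1 : m y' + t * nu' y' <= 0.
    apply: (hy' (fun x => m x + t * nu' x)).
      by apply: mnu => //; [move=> b x y; rewrite fnu'; ring|rewrite nu'u mulr0].
    by rewrite uE mu nu'u mulr0 addr0.
  have h2 : m y' + - t * nu' y' <= 0.
    apply: (hy' (fun x => m x + - t * nu' x)).
      apply: mnu => //; [by move=> b x y; rewrite fnu'; ring|by rewrite nu'u mulr0|].
      by move=> x; rewrite mulNr normrN.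
    by rewrite uE mu nu'u mulr0 addr0.
  have : t * nu' y' = 0 by rewrite my' in h1 h2; lra.
  by move/eqP; rewrite mulf_eq0 gt_eqF//= => /eqP.
have b0 : b = 0 by move: my'; rewrite y'E (functionalZ _ _ hm.1) mu mulr1.
by move: y'1; rewrite y'E b0 scale0r normr0 => /eqP; rewrite eq_sym oner_eq0.
Qed.

Lemma interior_good l k : dual_unit l -> 0 <= k -> k < 1 ->
  (forall x, `|l x| <= k * `|x|) -> good l.
Proof.
move=> hl k0 k1 hk eta eta0 eta1; have e0 : eta != 0 by rewrite gt_eqF.
exists (eta * (1 - k)); first by rewrite mulr_gt0// subr_gt0.
move=> m hm lm; exists (fun x => l x + eta^-1 * (m x - l x)); last first.
  by apply/funext => x; field.
split=> [a x y|x]; first by rewrite hl.1 hm.1; ring.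
apply: le_trans (ler_normD _ _) _; rewrite normrM gtr0_norm ?invr_gt0//.
have : eta^-1 * `|m x - l x| <= (1 - k) * `|x|.
  by rewrite ler_pdivrMl// mulrA lm.
by have := hk x; lra.
Qed.

Lemma interior_misses l k : dual_unit l -> 0 <= k -> k < 1 ->
  (forall x, `|l x| <= k * `|x|) ->
  exists2 rho : R, 0 < rho & forall m, dual_unit m -> dnear rho l m ->
    forall u, `|u| = 1 -> m u != 1.
Proof.
move=> hl k0 k1 hk; exists ((1 - k) / 2); first by lra.
move=> m hm lm u u1; apply/eqP => mu.
have := lm u; have := hk u; rewrite u1 mu !mulr1.
by rewrite !ler_norml => /andP[_ ?] /andP[_ ?]; lra.
Qed.

Lemma lower_point_closed : dual_closed lower_point.
Proof.
move=> l hl nl; have [[u u1 lu]|[k [k0 k1 hk]]] := norming_or_small dimE hl.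
  have [r fi] := not_lower_facet_interior hl nl u1 lu.
  exact: facet_interior_misses fi.
have [rho rho0 h] := interior_misses hl k0 k1 hk; exists rho => // m hm lm.
by move=> [_ [u [y [u1 _ mu _ _]]]]; have := h m hm lm u u1; rewrite mu eqxx.
Qed.

Lemma not_lower_good l : dual_unit l -> ~ lower_point l -> good l.
Proof.
move=> hl nl; have [[u u1 lu]|[k [k0 k1 hk]]] := norming_or_small dimE hl.
  have [r fi] := not_lower_facet_interior hl nl u1 lu.
  exact: facet_interior_good fi.
exact: interior_good hk.
Qed.

Lemma eval_closed (u : E) (a : R) : dual_closed [set m | m u = a].
Proof.
move=> l hl /= /eqP lu; have u0 : 0 < `|u| + 1 by rewrite ltr_wpDl.
have la : 0 < `|l u - a| by rewrite normr_gt0 subr_eq0.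
exists (`|l u - a| / 2 / (`|u| + 1)); first by rewrite !divr_gt0.
move=> m hm /(_ u) lm mu.
have : `|l u - a| / 2 / (`|u| + 1) * `|u| <= `|l u - a| / 2.
  by rewrite mulrAC ler_pdivrMr// ler_wpM2l// ?lerDl//; lra.
by move: lm; rewrite mu distrC; lra.
Qed.

(** Among the functionals norming [x], one which maximises an evaluation at a vector
    outside the line of [x] lies on the relative boundary of the exposed face. *)
Lemma lower_point_norming x : (2 <= d)%N -> x != 0 ->
  exists2 l, lower_point l & l x = `|x|.
Proof.
move=> d2 x0; have x0' : 0 < `|x| by rewrite normr_gt0.
pose u := `|x|^-1 *: x.
have u1 : `|u| = 1 by rewrite normrZ normfV normr_id mulVf ?gt_eqF.
have [y0 hy0] : exists y0, forall a, y0 != a *: u.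
  apply: contrapT => h; have {}h y : exists a, y = a *: u.
    apply: contrapT => h'; apply: h; exists y => a; apply/eqP => ya; apply: h'.
    by exists a.
  have [b [c [bE cK fc]]] := has_coordinates dimE.
  have i0 : (0 < d)%N by exact: ltn_trans d2.
  pose i := Ordinal i0; pose j := Ordinal d2.
  have cb k : c (b k) = delta_mx 0 k.
    rewrite -[RHS]cK; congr c; rewrite (bigD1 k)//= big1 => [|n nk].
      by rewrite mxE !eqxx scale1r addr0.
    by rewrite mxE eqxx (negbTE nk) scale0r.
  have [p hp] := h (b i); have [q hq] := h (b j).
  have e1 : p * c u 0 i = 1 by rewrite -(functionalZ _ _ (fc i)) -hp cb mxE !eqxx.
  have e2 : q * c u 0 i = 0 by rewrite -(functionalZ _ _ (fc i)) -hq cb mxE eqxx.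
  have e3 : q * c u 0 j = 1 by rewrite -(functionalZ _ _ (fc j)) -hq cb mxE !eqxx.
  have : q = 0.
    apply/eqP; move/eqP: e2; rewrite mulf_eq0 => /orP[//|/eqP c0].
    by move: e1; rewrite c0 mulr0 => /eqP; rewrite eq_sym oner_eq0.
  by move=> q0; move: e3; rewrite q0 mul0r => /eqP; rewrite eq_sym oner_eq0.
have [l0 hl0 l0u] := norming_functional u.
have [|l [hl lu lmax]] := dual_attain dimE y0 (@eval_closed u 1).
  by exists l0 => //=; rewrite l0u.
exists l; last first.
  have xE : x = `|x| *: u by rewrite scalerA divff ?gt_eqF// scale1r.
  by rewrite [in LHS]xE (functionalZ _ _ hl.1) lu mulr1.
pose y' := y0 - l y0 *: u.
have y'0 : y' != 0 by rewrite subr_eq0.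
have y'p : 0 < `|y'| by rewrite normr_gt0.
split=> //; exists u, (`|y'|^-1 *: y'); split=> //.
- by rewrite normrZ normfV normr_id mulVf ?gt_eqF.
- by rewrite (functionalZ _ _ hl.1) (functionalB _ _ hl.1) (functionalZ _ _ hl.1) lu mulr1 subrr mulr0.
move=> m hm mu; rewrite (functionalZ _ _ hm.1) (functionalB _ _ hm.1) (functionalZ _ _ hm.1) mu mulr1.
by rewrite mulr_ge0_le0 ?invr_ge0// subr_le0 lmax.
Qed.

End FacetInterior.

Section FaceDimension.
Context {R : realType} {E : normedModType R} (d : nat) (dimE : has_dim E d).

Lemma affine_independent_independent n (w : 'I_n -> E -> R^o) (u : E) :
  (forall i, w i u = 1) -> affinely_independent w ->
  independent (w : 'I_n -> E -> R).
Proof.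
move=> wu aw a h; apply: aw.
  by have := h u; rewrite (eq_bigr a)// => i _; rewrite wu mulr1.
by apply/funext => x; rewrite fct_sumE -[RHS](h x).
Qed.

Lemma independent_extend n (v : 'I_n -> E -> R) (m : E -> R) :
  independent v ->
  (forall c : 'I_n -> R, m <> (fun x => \sum_i c i * v i x)) ->
  independent (fun i : 'I_n.+1 => if unlift ord0 i is Some j then v j else m).
Proof.
move=> iv hm a ha; have {}ha x : a ord0 * m x + \sum_i a (lift ord0 i) * v i x = 0.
  rewrite -[RHS](ha x) big_ord_recl unlift_none; congr (_ + _).
  by apply: eq_bigr => i _; rewrite liftK.
have a0 : a ord0 = 0.
  apply: contrapT => /eqP a0; apply: (hm (fun i => - a (lift ord0 i) / a ord0)).
  apply/funext => x; have := ha x; move/eqP; rewrite addr_eq0 => /eqP h.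
  have -> : m x = (a ord0)^-1 * (a ord0 * m x) by rewrite mulKf.
  rewrite h mulrN mulr_sumr -sumrN; apply: eq_bigr => i _.
  by field.
move=> i; case: (unliftP ord0 i) => [j ->|->] //.
by apply: (iv (fun i => a (lift ord0 i))) => x; have := ha x; rewrite a0 mul0r add0r.
Qed.

(** A maximal independent family in [F] spans [F] linearly, and affinely because all its
    elements take the value [1] at [u]; since [y] is killed, it has fewer than [d]
    elements. *)
Lemma affine_dim_exists (F : set (E -> R^o)) (u y : E) :
  F !=set0 -> (forall l, F l -> functional l) ->
  (forall l, F l -> l u = 1) -> y != 0 -> (forall l, F l -> l y = 0) ->
  exists m, affine_dim F m /\ (m + 2 <= d)%N.
Proof.
move=> [l0 Fl0] fF Fu y0 Fy.
pose P n := `[< exists v : 'I_n -> E -> R, (forall i, F (v i)) /\ independent v >].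
have P1 : P 1%N.
  apply/asboolP; exists (fun=> l0); split=> // a /(_ u).
  by rewrite big_ord1 Fu// mulr1 => a0 i; rewrite ord1.
have Pd n : P n -> (n <= d)%N.
  move=> /asboolP[v [Fv iv]]; apply: (independent_le dimE _ iv) => i.
  exact: fF (Fv i).
have [n /asboolP[v [Fv iv]] nmax] := ex_maxnP (ex_intro _ 1%N P1) Pd.
have nd : (n < d)%N.
  apply: (independent_lt dimE _ iv y0) => i; first exact: fF (Fv i).
  exact: Fy (Fv i).
case: n v Fv iv nmax nd => [|m] v Fv iv nmax nd; first by have := nmax 1%N P1.
exists m; split; last by rewrite addn2.
have span l : F l -> exists2 c : 'I_m.+1 -> R, \sum_i c i = 1 &
    l = \sum_i c i *: (v i : E -> R^o).
  move=> Fl; apply: contrapT => h.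
  have : P m.+2; last by move=> /nmax; rewrite ltnn.
  apply/asboolP; exists (fun i => if unlift ord0 i is Some j then v j else l); split.
    by move=> i; case: unliftP => [j _|_]; [exact: Fv|].
  apply: independent_extend iv _ => c lE; apply: h; exists c.
    rewrite -(Fu l Fl) lE; apply: eq_bigr => i _; by rewrite Fu ?mulr1.
  by apply/funext => x; rewrite fct_sumE lE.
exists v; split.
  move=> c _ cv; apply: iv => x; have := congr1 (fun f : E -> R^o => f x) cv.
  by rewrite fct_sumE.
apply/seteqP; split=> l [k [w [c [hw c1 ->]]]].
  exists k, w, c; split=> // i; have [j _ <-] := hw i; exact: Fv.
have /choice[a ha] : forall i, exists a : 'I_m.+1 -> R, \sum_j a j = 1 /\
    w i = \sum_j a j *: (v j : E -> R^o).
  by move=> i; have [a a1 aE] := span (w i) (hw i); exists a.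
exists m.+1, v, (fun j => \sum_i c i * a i j); split.
- by move=> i; exists i.
- rewrite exchange_big /= -[RHS]c1; apply: eq_bigr => i _.
  by rewrite -mulr_sumr (ha i).1 mulr1.
rewrite (eq_bigr (fun i => \sum_j (c i * a i j) *: (v j : E -> R^o))) => [|i _].
  by rewrite exchange_big /=; apply: eq_bigr => j _; rewrite scaler_suml.
by rewrite (ha i).2 scaler_sumr; apply: eq_bigr => j _; rewrite scalerA.
Qed.

(** Spells out convexity with real coefficients in place of interval-typed ones. *)
Lemma convex_setP (V : lmodType R) (A : set V) :
  (forall x y t, A x -> A y -> 0 <= t -> t <= 1 -> A (t *: x + (1 - t) *: y)) <->
  @convex_set R V A.
Proof.
split=> h.
  by move=> x y t /set_mem Ax /set_mem Ay; apply/mem_set/h.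
move=> x y t Ax Ay t0 t1.
have t01 : Itv.spec (@Itv.num_sem R) (Itv.Real `[0%Z, 1%Z]) t.
  by rewrite /Itv.num_sem /= ger0_real//= in_itv/= t0.
exact: set_mem (h x y (Itv.mk t01) (mem_set Ax) (mem_set Ay)).
Qed.

Lemma hull_min (V : lmodType R) (A B : set V) :
  @convex_set R V B -> A `<=` B -> convex_hull A `<=` B.
Proof. by move=> cB AB x; apply; split. Qed.

Lemma sub_hull (V : lmodType R) (A : set V) : A `<=` convex_hull A.
Proof. by move=> x Ax B [_ AB]; exact: AB. Qed.

Lemma hull_convex (V : lmodType R) (A : set V) : @convex_set R V (convex_hull A).
Proof.
apply/convex_setP => x y t hx hy t0 t1 B [cB AB].
by have /convex_setP := cB; apply=> //; [exact: hx|exact: hy].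
Qed.

End FaceDimension.

(** * Spaces whose small dual faces are simplices *)

Section LowerFaces.
Context {R : realType} {E : normedModType R} (d : nat) (dimE : has_dim E d).
Hypothesis sfs : small_faces_simplices E d.

(** The functionals with [m u = 1] and [m y = 0] form a simplex. Choose [x] with
    [m x = g m] at its vertices [m]: convexity of [g], and of [g] composed with [fopp],
    extends the two inequalities from the vertices to the simplex. *)
Lemma small_face_interpolation (u y : E) (g : (E -> R) -> R) l0 : y != 0 ->
  (forall m, dual_unit m -> m u = 1 -> m y <= 0) ->
  `|u| = 1 -> dual_unit l0 -> l0 u = 1 -> l0 y = 0 ->
  ccf g -> (forall m, dual_unit m -> m u = 1 -> m y = 0 -> g m + g (fopp m) <= 0) ->
  exists x, forall m, dual_unit m -> m u = 1 -> m y = 0 ->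
    g m <= m x /\ m x <= - g (fopp m).
Proof.
move=> y0 hy u1 hl0 l0u l0y cg g0.
pose F : set (E -> R^o) := [set m | [/\ dual_unit m, m u = 1 & m y = 0]].
have faceF : face (dual_ball E) F.
  split.
  - apply/convex_setP => m n t [hm mu my] [hn nu ny] t0 t1; split.
    + exact: dual_unit_conv.
    + by rewrite !fctE /= mu nu /GRing.scale/=; ring.
    + by rewrite !fctE /= my ny /GRing.scale/=; ring.
  - by move=> m [hm _ _]; apply/dual_ballP.
  move=> m n t /dual_ballP hm /dual_ballP hn t0 t1 [_ mnu mny].
  move: mnu mny; rewrite !fctE /GRing.scale/= => mnu mny.
  have mu1 := dual_unit_le u hm; have nu1 := dual_unit_le u hn; rewrite u1 in mu1 nu1.
  have [mu nu] : m u = 1 /\ n u = 1 by split; nra.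
  have my := hy m hm mu; have ny := hy n hn nu.
  by split; split=> //; nra.
have [k [dimF kd]] : exists m, affine_dim F m /\ (m + 2 <= d)%N.
  apply: (affine_dim_exists dimE (u := u) (y := y)) => //.
  - by exists l0.
  - by move=> l [[]].
  - by move=> l [].
  - by move=> l [].
have [n [w [aw FE]]] := sfs faceF dimF kd.
have wF i : F (w i) by rewrite FE; apply: sub_hull; exists i.
have [x hx] : exists x, forall i, w i x = g (w i).
  apply: (interpolation dimE (w := w : 'I_n -> E -> R)).
    by move=> i; have [[]] := wF i.
  by apply: (affine_independent_independent (u := u)) aw => i; have [] := wF i.
exists x => m hm mu my.
pose G : set (E -> R^o) := [set m | [/\ dual_unit m, g m <= m x & m x <= - g (fopp m)]].
have : F `<=` G.
  rewrite FE; apply: hull_min; last first.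
    move=> _ [i _ <-]; have [hw wu wy] := wF i; rewrite /G /= hx; split=> //.
    by have := g0 _ hw wu wy; lra.
  apply/convex_setP => a b t [ha a1 a2] [hb b1 b2] t0 t1.
  have t1' : 0 <= 1 - t by rewrite subr_ge0.
  split; first exact: dual_unit_conv.
    apply: le_trans (cg.1 a b t ha hb t0 t1) _.
    by rewrite !fctE /GRing.scale/= lerD// ler_wpM2l.
  have := cg.1 _ _ t (dual_unitN ha) (dual_unitN hb) t0 t1.
  have -> : (fun x => t * - a x + (1 - t) * - b x) = fopp (t *: a + (1 - t) *: b).
    by apply/funext => z; rewrite /fopp !fctE /GRing.scale/=; ring.
  rewrite !fctE /GRing.scale/= => h.
  have := ler_wpM2l t0 a2; have := ler_wpM2l t1' b2.
  by rewrite /fopp in h *; lra.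
by move=> FG; have [] : G m by exact: FG.
Qed.

Lemma ccf_oppr_continuous (g : (E -> R) -> R) : ccf g -> dual_continuous (fun m => - g (fopp m)).
Proof.
move=> cg; have := dual_continuousZ (-1) (dual_continuous_fopp cg.2).
rewrite (_ : (fun l => -1 * g (fopp l)) = (fun m => - g (fopp m)))//.
by apply/funext => m; rewrite mulN1r.
Qed.

(** The interpolating [x] of [small_face_interpolation] gives the required bounds, up to
    [e], on the face where [m u = 1] and [m y = 0]. Multiples of the penalties [- m y],
    nonnegative on the face [m u = 1], and [1 - m u], nonnegative on the dual ball,
    extend them to all functionals without changing the values at [l]. *)
Lemma lower_sandwiched l : @lower_point R E l -> sandwiched lower_point l.
Proof.
move=> [hl [u [y [u1 y1 lu ly hy]]]] g cg g0 e e0.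
have y0 : y != 0 by rewrite -normr_gt0 y1.
have [|x hx] := small_face_interpolation y0 hy u1 hl lu ly cg.
  by move=> m hm mu my; apply: g0; split=> //; exists u, y.
pose Phi1 m := - g (fopp m) + aff (- x, - (e / 2)) m.
pose Phi2 m := aff (x, - (e / 2)) m + -1 * g m.
have P1E m : functional m -> Phi1 m = - g (fopp m) - m x + e / 2.
  by move=> fm; rewrite /Phi1 /aff /= (functionalN _ fm); ring.
have P2E m : Phi2 m = m x + e / 2 - g m by rewrite /Phi2 /aff /=; ring.
have cP1 : dual_continuous Phi1.
  by apply: dual_continuousD; [exact: ccf_oppr_continuous|exact: aff_continuous].
have cP2 : dual_continuous Phi2.
  by apply: dual_continuousD; [exact: aff_continuous|apply: dual_continuousZ; exact: cg.2].
pose Psi := aff (- y, 0); have cPsi : dual_continuous Psi by exact: aff_continuous.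
have PsiE m : functional m -> Psi m = - m y by move=> fm; rewrite /Psi /aff /= (functionalN _ fm) subr0.
have Psi0 m : dual_unit m -> [set m | m u = 1] m -> 0 <= Psi m.
  by move=> hm mu; rewrite PsiE ?oppr_ge0 ?hy//; exact: hm.1.
have [|k1 k10 hk1] := penalty dimE (@eval_closed _ _ u 1) cP1 cPsi Psi0.
  move=> m hm mu; rewrite PsiE ?P1E; try exact: hm.1.
  by move=> /eqP; rewrite oppr_eq0 => /eqP my; have [] := hx m hm mu my; lra.
have [|k2 k20 hk2] := penalty dimE (@eval_closed _ _ u 1) cP2 cPsi Psi0.
  move=> m hm mu; rewrite PsiE ?P2E; try exact: hm.1.
  by move=> /eqP; rewrite oppr_eq0 => /eqP my; have [] := hx m hm mu my; lra.
pose k := Num.max k1 k2.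
have k1k : k1 <= k by rewrite le_max lexx.
have k2k : k2 <= k by rewrite le_max lexx orbT.
pose Chi := aff (- u, - 1); have cChi : dual_continuous Chi by exact: aff_continuous.
have ChiE m : functional m -> Chi m = 1 - m u by move=> fm; rewrite /Chi /aff /= (functionalN _ fm); ring.
have Chi0 m : dual_unit m -> setT m -> 0 <= Chi m.
  move=> hm _; rewrite ChiE; last exact: hm.1.
  by have := dual_unit_le u hm; rewrite u1 => ?; lra.
have clT : dual_closed [set: E -> R] by move=> m _ [].
have Chi1 m : dual_unit m -> Chi m = 0 -> m u = 1.
  by move=> hm; rewrite ChiE; [lra|exact: hm.1].
have [|K1 K10 hK1] := penalty dimE clT (dual_continuousD cP1 (dual_continuousZ k cPsi)) cChi Chi0.
  by move=> m hm _ /(Chi1 m hm) mu; exact: hk1.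
have [|K2 K20 hK2] := penalty dimE clT (dual_continuousD cP2 (dual_continuousZ k cPsi)) cChi Chi0.
  by move=> m hm _ /(Chi1 m hm) mu; exact: hk2.
pose K := Num.max K1 K2.
have K1K : K1 <= K by rewrite le_max lexx.
have K2K : K2 <= K by rewrite le_max lexx orbT.
exists (x + k *: y + K *: u, e / 2 + K), (x - k *: y - K *: u, - (e / 2) - K).
have pE m : functional m ->
    aff (x + k *: y + K *: u, e / 2 + K) m = m x + k * m y + K * m u - (e / 2 + K).
  by move=> fm; rewrite /aff /= !(functionalD _ _ fm) !(functionalZ _ _ fm).
have qE m : functional m ->
    aff (x - k *: y - K *: u, - (e / 2) - K) m = m x - k * m y - K * m u + (e / 2 + K).
  by move=> fm; rewrite /aff /= !(functionalB _ _ fm) !(functionalZ _ _ fm); ring.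
split.
- move=> m [hm _]; have := hK1 K K1K m hm I; rewrite pE ?P1E ?PsiE ?ChiE; try exact: hm.1.
  by lra.
- move=> m [hm _]; have := hK2 K K2K m hm I; rewrite qE ?P2E ?PsiE ?ChiE; try exact: hm.1.
  by lra.
rewrite pE ?qE ?lu ?ly; try exact: hl.1.
by lra.
Qed.

Lemma lower_gauge_boundary : (2 <= d)%N -> gauge_boundary (@lower_point R E).
Proof.
move=> d2; split.
- by move=> l [].
- move=> l [hl [u [y [u1 y1 lu ly hy]]]]; split; first exact: dual_unitN.
  exists (- u), (- y); split; rewrite ?normrN//.
  + by rewrite /fopp (functionalN _ hl.1) opprK.
  + by rewrite /fopp (functionalN _ hl.1) opprK.
  move=> m hm; rewrite !(functionalN _ hm.1) => mu.
  by have := hy _ (dual_unitN hm); rewrite mu => /(_ erefl).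
- by move=> x x0; exact: (lower_point_norming dimE).
- by move=> l [_ [u [y [u1 _ lu _ _]]]]; exists u.
- exact: (lower_point_closed dimE).
- exact: (not_lower_good dimE).
- exact: lower_sandwiched.
Qed.

End LowerFaces.

(** * Polyhedral spaces *)

Lemma count_le_in (T : eqType) (P Q : pred T) (s : seq T) :
  {in s, forall v, P v -> Q v} -> (count P s <= count Q s)%N.
Proof.
elim: s => //= v s IH h; apply: leq_add.
  by case: (P v) (h v (mem_head _ _)) => // ->.
by apply: IH => w ws; apply: h; rewrite in_cons ws orbT.
Qed.

Lemma count_lt_in (T : eqType) (P Q : pred T) (s : seq T) w :
  {in s, forall v, P v -> Q v} -> w \in s -> ~~ P w -> Q w ->
  (count P s < count Q s)%N.
Proof.
elim: s => //= v s IH h; rewrite in_cons => ws Pw Qw.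
have hs : {in s, forall v, P v -> Q v}.
  by move=> c cs; apply: h; rewrite in_cons cs orbT.
case/predU1P: ws => [wv|ws].
  by rewrite -wv (negbTE Pw) Qw add0n add1n ltnS count_le_in.
rewrite -addnS leq_add ?IH//.
by case: (P v) (h v (mem_head _ _)) => // ->.
Qed.

Section Polyhedral.
Context {R : realType} {E : normedModType R} (d : nat) (dimE : has_dim E d).
Implicit Types (l m nu : E -> R).

(** For a polyhedral space these are the vertices of the unit ball and their opposites,
    which describe the dual ball by finitely many inequalities. *)
Definition norming_points (vs : seq E) := [/\ forall v, v \in vs -> `|v| <= 1,
  forall v, v \in vs -> - v \in vs &
  forall l, functional l -> (forall v, v \in vs -> l v <= 1) -> dual_unit l].

Variables (vs : seq E) (hvs : norming_points vs).

(** The vertices of the polytope [B], characterised by their active constraints: these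
    determine the functional. *)
Definition vertex_point : set (E -> R) := [set l | [/\ dual_unit l,
  exists2 u, `|u| = 1 & l u = 1 &
  forall nu, functional nu -> (forall v, v \in vs -> l v = 1 -> nu v = 0) ->
    forall x, nu x = 0]].

Lemma vs_le l v : dual_unit l -> v \in vs -> l v <= 1.
Proof.
by move=> hl vv; have [v1 _ _] := hvs; apply: le_trans (dual_unit_le v hl) (v1 v vv).
Qed.

Lemma slack l : dual_unit l -> exists2 r : R, 0 < r &
  forall v, v \in vs -> l v != 1 -> l v <= 1 - r.
Proof.
move=> hl; have vle := vs_le hl; elim: vs vle => [|v ws IH] vle; first by exists 1.
have [|r r0 hr] := IH; first by move=> w ww; apply: vle; rewrite in_cons ww orbT.
have [lv|lv] := eqVneq (l v) 1.
  exists r => // w; rewrite in_cons => /predU1P[->|/hr //].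
  by rewrite lv eqxx.
have lv1 : l v < 1 by rewrite lt_neqAle lv vle// mem_head.
exists (Num.min r (1 - l v)); first by rewrite lt_min r0 subr_gt0.
move=> w; rewrite in_cons lerBrDl -lerBrDr => /predU1P[-> _|ww lw].
  by rewrite ge_min lexx orbT.
by rewrite ge_min; have := hr w ww lw; rewrite lerBrDl -lerBrDr => ->.
Qed.

Lemma near_slack l m r : (forall v, v \in vs -> l v != 1 -> l v <= 1 - r) ->
  0 < r -> dnear (r / 2) l m -> forall v, v \in vs -> m v = 1 -> l v = 1.
Proof.
move=> hr r0 lm v vv mv; apply/eqP; apply: contraT => lv.
have := hr v vv lv; have := lm v; have [v1 _ _] := hvs; have := v1 v vv.
rewrite mv => a; rewrite ler_norml => /andP[_ b] c.
have : r / 2 * `|v| <= r / 2 * 1 by rewrite ler_wpM2l//; lra.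
by lra.
Qed.

(** A functional near [l] has no other active constraints than [l], so that a vertex
    near [l] is equal to [l]. *)
Lemma vertex_closed : dual_closed vertex_point.
Proof.
move=> l hl nl; have [r r0 hr] := slack hl.
exists (r / 2); first by lra.
move=> m hm lm mv; apply: nl; have [_ mu h] := mv.
suff -> : l = m by [].
apply/funext => x; apply/eqP; rewrite -subr_eq0; apply/eqP.
apply: (h (fun x => l x - m x)); first by move=> a y z; rewrite hl.1 hm.1; ring.
by move=> v vv mv1; rewrite mv1 (near_slack hr r0 lm vv mv1) subrr.
Qed.

(** The inactive constraints at [l] have a margin [r], which allows to move past a nearby
    point by the factor [1 / eta] while staying in the ball. *)
Lemma polyhedral_good l : dual_unit l -> good l.
Proof.
move=> hl eta eta0 eta1; have [r r0 hr] := slack hl.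
have e0 : eta != 0 by rewrite gt_eqF.
exists (eta * r); first by rewrite mulr_gt0.
move=> m hm lm; exists (fun x => l x + eta^-1 * (m x - l x)); last first.
  by apply/funext => x; field.
have [v1 _ vsP] := hvs; apply: vsP => [a x y|v vv]; first by rewrite hl.1 hm.1; ring.
have [lv|lv] := eqVneq (l v) 1.
  rewrite lv; have := vs_le hm vv => mv.
  have : eta^-1 * (m v - 1) <= 0 by rewrite mulr_ge0_le0 ?invr_ge0 ?subr_le0// ltW.
  by lra.
have := hr v vv lv.
have : eta^-1 * (m v - l v) <= r.
  rewrite ler_pdivrMl//; apply: le_trans (le_trans (ler_norm _) (lm v)) _.
  by rewrite ler_piMr ?v1// mulr_ge0// ltW.
by lra.
Qed.

(** Moving from [l] along [nu], the first inactive constraint reached becomes active. *)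
Lemma push_to_face l nu v0 : dual_unit l -> functional nu ->
  (forall v, v \in vs -> l v = 1 -> nu v = 0) -> v0 \in vs -> 0 < nu v0 ->
  exists t, [/\ 0 < t, dual_unit (fun x => l x + t * nu x) &
    exists v, [/\ v \in vs, l v != 1 & l v + t * nu v = 1]].
Proof.
move=> hl fnu hnu vv0 nv0.
pose ws := [seq v <- vs | 0 < nu v].
have ws0 : ws != [::].
  apply/eqP => wsE; have : v0 \in ws by rewrite mem_filter nv0.
  by rewrite wsE.
have [v + hv] := min_attained (fun v => (1 - l v) / nu v) ws0.
rewrite mem_filter => /andP[nv vv].
have lv : l v != 1 by apply: contraTneq nv => /(hnu v vv) ->; rewrite ltxx.
have lv1 : l v < 1 by rewrite lt_neqAle lv vs_le.
exists ((1 - l v) / nu v); split.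
- by rewrite divr_gt0// subr_gt0.
- have [_ _ vsP] := hvs; apply: vsP => [a x y|w ww]; first by rewrite hl.1 fnu; ring.
  have [nw|nw] := ltP 0 (nu w).
    have := hv w; rewrite mem_filter nw ww => /(_ isT); rewrite ler_pdivlMr//.
    by lra.
  have : (1 - l v) / nu v * nu w <= 0.
    by rewrite mulr_ge0_le0// divr_ge0// ?subr_ge0 ltW.
  by have := vs_le hl ww; lra.
by exists v; split=> //; field; rewrite gt_eqF.
Qed.

Lemma positive_vertex nu x : functional nu -> nu x != 0 ->
  exists2 v, v \in vs & 0 < nu v.
Proof.
move=> fnu nx; apply: contrapT => h.
have nule v : v \in vs -> nu v <= 0.
  by move=> vv; rewrite leNgt; apply/negP => nv; apply: h; exists v.
have [_ vN vsP] := hvs.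
have : dual_unit (fun z => (`|x| + 1) / `|nu x| * nu z).
  apply: vsP => [a y z|v vv]; first by rewrite fnu; ring.
  apply: le_trans (_ : 0 <= _) => //.
  by rewrite mulr_ge0_le0 ?nule// divr_ge0// addr_ge0.
move=> [_ /(_ x)]; rewrite normrM gtr0_norm; last first.
  by rewrite divr_gt0 ?normr_gt0// ltr_wpDl.
by rewrite divfK ?normr_eq0// gerDl ler10.
Qed.

(** Among the functionals norming [x], take one with the largest number of active
    constraints. If it were not a vertex, one could move in both directions along
    some [nu] preserving the active constraints; hence [nu x = 0], and
    [push_to_face] would add a constraint. *)
Lemma vertex_norming x : x != 0 -> exists2 l, vertex_point l & l x = `|x|.
Proof.
move=> x0; have x0' : 0 < `|x| by rewrite normr_gt0.
pose P n := `[< exists l, [/\ dual_unit l, l x = `|x| &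
  count (fun v => l v == 1) vs = n] >].
have exP : exists n, P n.
  have [l hl lx] := norming_functional x.
  by exists (count (fun v => l v == 1) vs); apply/asboolP; exists l.
have leP' n : P n -> (n <= size vs)%N.
  by move=> /asboolP[l [_ _ <-]]; exact: count_size.
have [n /asboolP[l [hl lx ln]] nmax] := ex_maxnP exP leP'.
exists l => //; split=> //.
  exists (`|x|^-1 *: x); first by rewrite normrZ normfV normr_id mulVf// gt_eqF.
  by rewrite (functionalZ _ _ hl.1) lx mulVf// gt_eqF.
move=> nu fnu hnu; apply: contrapT => /existsNP[z /eqP nz].
have [v vv nv] := positive_vertex fnu nz.
have [t [t0 ht [w [ww lw wt]]]] := push_to_face hl fnu hnu vv nv.
pose nu' z := - nu z.
have fnu' : functional nu' by move=> a b c; rewrite /nu' fnu; ring.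
have [v' vv' nv'] : exists2 v, v \in vs & 0 < nu' v.
  by apply: (@positive_vertex nu' z) => //; rewrite oppr_eq0.
have [|t' [t'0 ht' _]] := push_to_face hl fnu' _ vv' nv'.
  by move=> c cv lc; rewrite /nu' hnu// oppr0.
have h1 : l x + t * nu x <= `|x| := dual_unit_le x ht.
have h2 : l x + t' * nu' x <= `|x| := dual_unit_le x ht'.
have nux : nu x = 0.
  apply/eqP; rewrite eq_le; apply/andP; split.
    by rewrite -(pmulr_rle0 _ t0); lra.
  by rewrite -oppr_le0 -(pmulr_rle0 _ t'0); rewrite /nu' in h2; lra.
have Pk : P (count (fun v => l v + t * nu v == 1) vs).
  by apply/asboolP; exists (fun x => l x + t * nu x); split=> //; rewrite nux mulr0 addr0.
have := nmax _ Pk; rewrite leqNgt => /negP; apply.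
rewrite -ln; apply: (@count_lt_in _ _ _ _ w) => //.
  by move=> c cv /eqP lc; rewrite lc hnu// mulr0 addr0.
by rewrite wt.
Qed.

Lemma sum_slack (ws : seq E) m : functional m ->
  \sum_(v <- ws) (1 - m v) = aff (- \sum_(v <- ws) v, - \sum_(v <- ws) (1 : R)) m.
Proof.
move=> fm; rewrite /aff /= (functionalN _ fm) opprK addrC.
elim: ws => [|v ws IH]; rewrite ?big_nil ?(functional0 fm) ?subr0// !big_cons.
by rewrite IH (functionalD _ _ fm); ring.
Qed.

Lemma sum_slack_eq0 (ws : seq E) m : (forall w, w \in ws -> 0 <= 1 - m w) ->
  \sum_(v <- ws) (1 - m v) = 0 -> forall v, v \in ws -> m v = 1.
Proof.
elim: ws => // w ws IH h; rewrite big_cons => P0 v.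
have hs c : c \in ws -> 0 <= 1 - m c by move=> cw; apply: h; rewrite in_cons cw orbT.
have s0 : 0 <= \sum_(v <- ws) (1 - m v) by rewrite big_seq sumr_ge0.
have w0 := h w (mem_head _ _).
rewrite in_cons => /predU1P[->|vw]; first by lra.
by apply: IH => //; lra.
Qed.

(** At a single point constants do the job; the sum of the slacks of the constraints
    active at [l] vanishes on the dual ball only at [l] and serves as a penalty. *)
Lemma vertex_sandwiched l : vertex_point l -> sandwiched vertex_point l.
Proof.
move=> vl g cg g0 e e0; have [hl _ hnu] := vl.
pose act := [seq v <- vs | l v == 1].
pose Psi m := \sum_(v <- act) (1 - m v).
pose V := \sum_(v <- act) v; pose N := \sum_(v <- act) (1 : R).
have PsiE m : functional m -> Psi m = aff (- V, - N) m by exact: sum_slack.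
have Psi_ge0 m : dual_unit m -> setT m -> 0 <= aff (- V, - N) m.
  move=> hm _; rewrite -PsiE; last exact: hm.1.
  rewrite /Psi big_seq sumr_ge0// => v; rewrite mem_filter => /andP[_ vv].
  by rewrite subr_ge0 vs_le.
have Psi0 m : dual_unit m -> aff (- V, - N) m = 0 -> m = l.
  move=> hm; rewrite -PsiE; last exact: hm.1.
  move=> P0; apply/funext => x; apply/eqP; rewrite -subr_eq0; apply/eqP.
  apply: (hnu (fun x => m x - l x)); first by move=> a y z; rewrite hl.1 hm.1; ring.
  move=> v vv lv; rewrite lv; apply/eqP; rewrite subr_eq0; apply/eqP.
  apply: (sum_slack_eq0 _ P0); last by rewrite mem_filter lv eqxx.
  by move=> w; rewrite mem_filter subr_ge0 => /andP[_ ww]; exact: vs_le.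
have cPsi : dual_continuous (aff (- V, - N)) by exact: aff_continuous.
have Psil : aff (- V, - N) l = 0.
  rewrite -PsiE; last exact: hl.1.
  rewrite /Psi big_seq big1// => v; rewrite mem_filter => /andP[/eqP -> _].
  by rewrite subrr.
have clT : dual_closed [set: E -> R] by move=> m _ [].
pose Phi1 m := - g (fopp m) + aff (0, - g (fopp l) - e / 2) m.
pose Phi2 m := aff (0, - g l - e / 2) m + -1 * g m.
have P1E m : functional m -> Phi1 m = - g (fopp m) + g (fopp l) + e / 2.
  by move=> fm; rewrite /Phi1 /aff /= (functional0 fm); ring.
have P2E m : functional m -> Phi2 m = g l + e / 2 - g m.
  by move=> fm; rewrite /Phi2 /aff /= (functional0 fm); ring.
have cP1 : dual_continuous Phi1.
  by apply: dual_continuousD; [exact: ccf_oppr_continuous|exact: aff_continuous].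
have cP2 : dual_continuous Phi2.
  by apply: dual_continuousD; [exact: aff_continuous|apply: dual_continuousZ; exact: cg.2].
have [|K1 K10 hK1] := penalty dimE clT cP1 cPsi Psi_ge0.
  by move=> m hm _ /(Psi0 m hm) ->; rewrite P1E; [lra|exact: hl.1].
have [|K2 K20 hK2] := penalty dimE clT cP2 cPsi Psi_ge0.
  by move=> m hm _ /(Psi0 m hm) ->; rewrite P2E; [lra|exact: hl.1].
pose K := Num.max K1 K2.
have K1K : K1 <= K by rewrite le_max lexx.
have K2K : K2 <= K by rewrite le_max lexx orbT.
pose p : E * R := (K *: V, g (fopp l) + e / 2 + K * N).
pose q : E * R := (- (K *: V), - g l - e / 2 - K * N).
have pE m : functional m -> aff p m = - g (fopp l) - e / 2 - K * aff (- V, - N) m.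
  by move=> fm; rewrite /p /aff /= (functionalN _ fm) (functionalZ _ _ fm); ring.
have qE m : functional m -> aff q m = g l + e / 2 + K * aff (- V, - N) m.
  by move=> fm; rewrite /q /aff /= !(functionalN _ fm) (functionalZ _ _ fm); ring.
exists p, q; split.
- move=> m [hm _ _]; have := hK1 K K1K m hm I; rewrite P1E ?pE; try exact: hm.1.
  by lra.
- move=> m [hm _ _]; have := hK2 K K2K m hm I; rewrite P2E ?qE; try exact: hm.1.
  by lra.
rewrite pE ?qE ?Psil; try exact: hl.1.
by have := g0 l vl; lra.
Qed.

Lemma vertex_gauge_boundary : gauge_boundary vertex_point.
Proof.
have [_ vN _] := hvs; split.
- by move=> l [].
- move=> l [hl [u u1 lu] h]; split; first exact: dual_unitN.
    by exists (- u); rewrite ?normrN// /fopp (functionalN _ hl.1) opprK.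
  move=> nu fnu hnu; apply: h => // v vv lv; apply/eqP.
  rewrite -oppr_eq0 -(functionalN _ fnu); apply/eqP; apply: hnu; first exact: vN.
  by rewrite /fopp (functionalN _ hl.1) opprK.
- exact: vertex_norming.
- by move=> l [].
- exact: vertex_closed.
- by move=> l hl _; exact: polyhedral_good.
- exact: vertex_sandwiched.
Qed.

End Polyhedral.

(** * Density of the isolated types *)

Section Boundary.
Context {R : realType} {E : normedModType R} (d : nat) (dimE : has_dim E d).

Lemma polyhedral_norming_points : polyhedral E -> exists vs : seq E, norming_points vs.
Proof.
move=> [B /finite_seqP[s ->] ballE].
have sv v : v \in s -> `|v| <= 1.
  by move=> vs; have : unit_ball E v by rewrite ballE; exact: sub_hull.
exists (s ++ map -%R s); split.
- move=> v; rewrite mem_cat => /orP[/sv //|/mapP[w /sv h ->]].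
  by rewrite normrN.
- move=> v; rewrite !mem_cat => /orP[vs|/mapP[w ws ->]].
    by rewrite map_f ?orbT.
  by rewrite opprK ws.
move=> l fl hl; have ball1 x : `|x| <= 1 -> l x <= 1.
  move=> x1; have : unit_ball E x by [].
  rewrite ballE; apply: (@hull_min R E [set` s] [set z | l z <= 1]) => [|v vs]; last by apply: hl; rewrite mem_cat vs.
  apply/convex_setP => y z t /= hy hz t0 t1; rewrite fl (functionalZ _ _ fl).
  have t1' : 0 <= 1 - t by rewrite subr_ge0.
  by have := ler_wpM2l t0 hy; have := ler_wpM2l t1' hz; lra.
apply: dual_unitP => // x; have [->|x0] := eqVneq x 0.
  by rewrite (functional0 fl).
have x0' : 0 < `|x| by rewrite normr_gt0.
have := ball1 (`|x|^-1 *: x); rewrite normrZ normfV normr_id mulVf ?gt_eqF//.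
by move=> /(_ (lexx _)); rewrite (functionalZ _ _ fl) ler_pdivrMl// mulr1.
Qed.

(** A space of dimension at most one is polyhedral. *)
Lemma low_dim_norming_points : (d < 2)%N -> exists vs : seq E, norming_points vs.
Proof.
move=> d2; have [b [c [bE cK fc]]] := has_coordinates dimE.
have [e he] : exists e : E, forall x, exists a, x = a *: e.
  case: d d2 b c bE {cK fc} => [|[|//]] _ b c bE.
    by exists 0 => x; exists 0; rewrite (bE x) big_ord0 scaler0.
  by exists (b 0) => x; exists (c x 0 0); rewrite [LHS](bE x) big_ord1.
have [e0|e0] := eqVneq e 0.
  exists [::]; split=> // l fl _; apply: dual_unitP => // x.
  by have [a ->] := he x; rewrite e0 scaler0 (functional0 fl).
pose v := `|e|^-1 *: e; have v1 : `|v| = 1.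
  by rewrite normrZ normfV normr_id mulVf// normr_eq0.
exists [:: v; - v]; split.
- by move=> w; rewrite !inE => /orP[]/eqP ->; rewrite ?normrN v1.
- by move=> w; rewrite !inE => /orP[]/eqP ->; rewrite ?opprK eqxx ?orbT.
move=> l fl hl; split=> // x; have [a ->] := he x.
have -> : a *: e = (a * `|e|) *: v.
  by rewrite scalerA mulfK ?normr_eq0.
rewrite (functionalZ _ _ fl) normrM (normrZ _ v) v1 mulr1 ler_piMr//.
have := hl v (mem_head _ _); have := hl (- v); rewrite !inE eqxx orbT => /(_ isT).
by rewrite (functionalN _ fl) ler_norml => ? ?; apply/andP; split; lra.
Qed.

Lemma gauge_boundary_exists : small_faces_simplices E d \/ polyhedral E ->
  exists S : set (E -> R), gauge_boundary S.
Proof.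
move=> [sfs|/polyhedral_norming_points[vs hvs]].
  have [d2|d2] := ltnP d 2; last by exists lower_point; exact: (lower_gauge_boundary dimE).
  have [vs hvs] := low_dim_norming_points d2.
  by exists (vertex_point vs); exact: (vertex_gauge_boundary dimE).
by exists (vertex_point vs); exact: (vertex_gauge_boundary dimE).
Qed.

Theorem isolated_dense : small_faces_simplices E d \/ polyhedral E ->
  dense (isolated_KC E).
Proof. by move=> /gauge_boundary_exists[S hS]; exact: (dense_isolated dimE hS). Qed.

End Boundary.

(** * Faces of the dual ball in low dimension and for smooth spaces *)

Section AffineSpans.
Context {R : realType} {V : lmodType R}.
Implicit Type A : set V.

Lemma sub_affine_span A : A `<=` affine_span A.
Proof.
by move=> x Ax; exists 1%N, (fun=> x), (fun=> 1); split=> //; rewrite big_ord1// scale1r.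
Qed.

Lemma affine_span_range n (v : 'I_n -> V) x : affine_span (range v) x ->
  exists2 a : 'I_n -> R, \sum_j a j = 1 & x = \sum_j a j *: v j.
Proof.
move=> [k [w [c [hw c1 ->]]]].
have /choice[f hf] : forall i, exists j, v j = w i by move=> i; have [j _ <-] := hw i; exists j.
exists (fun j => \sum_(i < k | f i == j) c i).
  by rewrite -c1 [RHS](partition_big f predT).
rewrite (partition_big f predT)//=; apply: eq_bigr => j _.
rewrite scaler_suml; apply: eq_bigr => i /eqP <-.
by rewrite hf.
Qed.

Lemma affine_dim_spanned A m : affine_dim A m -> exists v : 'I_m.+1 -> V,
  forall x, A x -> exists2 a : 'I_m.+1 -> R, \sum_j a j = 1 & x = \sum_j a j *: v j.
Proof.
move=> [v [_ vA]]; exists v => x Ax; apply: affine_span_range.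
by rewrite vA; exact: sub_affine_span.
Qed.

Lemma simplex_subsingleton A : (forall x y, A x -> A y -> x = y) -> simplex A.
Proof.
move=> hA; have [[x Ax]|A0] := pselect (A !=set0).
  exists 1%N, (fun=> x); split=> [c|]; first by rewrite big_ord1 => c0 _ i; rewrite ord1.
  apply/seteqP; split=> y; first by move=> Ay; rewrite (hA y x)//; apply: sub_hull; exists 0.
  move=> /(_ A); apply; split=> [|_ [_ _ <-]//].
  apply/convex_setP => a b t Aa Ab _ _; rewrite (hA b a)// -scalerDl.
  by rewrite addrCA subrr addr0 scale1r.
exists 0%N, (fun=> 0); split=> [c _ _ []//|].
apply/seteqP; split=> y; first by move=> Ay; case: A0; exists y.
by move=> /(_ set0)[]; split=> [|_ [[]]//]; apply/convex_setP => a b t [].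
Qed.

End AffineSpans.

Section Faces.
Context {R : realType} {E : normedModType R} (d : nat) (dimE : has_dim E d).
Implicit Types (l m p q : E -> R^o) (F : set (E -> R^o)).

(** The supremum [b] of the parameters [t] is attained: at vectors where [q - p] is
    positive this is a limit argument, and elsewhere [b >= 1] makes the value at most
    that of [q]. *)
Lemma line_end p q : dual_unit p -> dual_unit q -> p <> q ->
  exists b : R, [/\ 1 <= b, dual_unit (fun x => p x + b * (q x - p x)) &
    forall t, dual_unit (fun x => p x + t * (q x - p x)) -> t <= b].
Proof.
move=> hp hq pq; pose T := [set t : R | dual_unit (fun x => p x + t * (q x - p x))].
have T1 : T 1.
  by rewrite /T /= (_ : (fun x => _) = q)//; apply/funext => x; ring.
have [y pqy] : exists y, p y != q y.
  apply: contrapT => h; apply: pq; apply/funext => y; apply/eqP; apply: contraT => h'.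
  by exfalso; apply: h; exists y.
have D0 : 0 < `|q y - p y| by rewrite normr_gt0 subr_eq0 eq_sym.
have ubT : has_ubound T.
  exists (2 * `|y| / `|q y - p y|) => t [_ /(_ y) ht].
  apply: le_trans (ler_norm _) _; rewrite ler_pdivlMr// -normrM.
  have -> : t * (q y - p y) = (p y + t * (q y - p y)) - p y by ring.
  by apply: le_trans (ler_normB _ _) _; have [_ /(_ y)] := hp; lra.
exists (sup T); split; last 1 first.
- by move=> t ht; exact: (ub_le_sup ubT).
- exact: (ub_le_sup ubT).
have b1 : 1 <= sup T by exact: (ub_le_sup ubT).
apply: dual_unitP => [a x z|x]; first by rewrite hp.1 hq.1; ring.
have hpx := dual_unit_le x hp; have hqx := dual_unit_le x hq.
have [D|D] := ltP 0 (q x - p x); last by nra.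
have : sup T <= (`|x| - p x) / (q x - p x).
  apply: ge_sup; first by exists 1.
  by move=> t /(dual_unit_le x) ht; rewrite ler_pdivlMr//; lra.
by rewrite ler_pdivlMr//; lra.
Qed.

(** A face contained in a line is the intersection of the line with the dual ball: the
    midpoint of two of its points lies strictly between the ends of this
    intersection, which are therefore in the face. *)
Lemma simplex_collinear F : face (dual_ball E) F ->
  (forall p q r, F p -> F q -> p <> q -> F r ->
     exists t, forall x, r x = p x + t * (q x - p x)) ->
  simplex F.
Proof.
move=> [cF FB extF] hF.
have [[p [q [Fp Fq pq]]]|h] := pselect (exists p q, [/\ F p, F q & p <> q]); last first.
  apply: simplex_subsingleton => p q Fp Fq; apply: contrapT => pq; apply: h.
  by exists p, q.
have hp : dual_unit p by apply/dual_ballP/FB.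
have hq : dual_unit q by apply/dual_ballP/FB.
have [b [b1 hb bmax]] := line_end hp hq pq.
have [b' [b'1 hb' b'max]] := line_end hq hp (nesym pq).
pose v0 : E -> R^o := fun x => q x + b' * (p x - q x).
pose v1 : E -> R^o := fun x => p x + b * (q x - p x).
have bb : 0 < b + b' - 1 by lra.
have [F0 F1] : F v0 /\ F v1.
  (* the midpoint has parameter [1 / 2] on the segment from [1 - b'] to [b] *)
  pose s := (b - 1 / 2) / (b + b' - 1).
  have s0 : 0 < s by rewrite divr_gt0//; lra.
  have s1 : s < 1 by rewrite ltr_pdivrMr//; lra.
  apply: (extF v0 v1 s) => //; try by apply/dual_ballP.
  rewrite (_ : s *: v0 + _ = (1 / 2) *: p + (1 - 1 / 2) *: q); last first.
    apply/funext => x; rewrite !fctE /GRing.scale/= /s /v0 /v1; field.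
    by rewrite gt_eqF.
  by have /convex_setP := cF; apply=> //; lra.
exists 2, (fun i : 'I_2 => if i == 0 then v0 else v1); split.
  move=> c; rewrite !big_ord_recl !big_ord0 !addr0 /= => c0 h.
  have c1 : c (lift ord0 ord0) = 0.
    apply: contrapT => /eqP c1; apply: pq; apply/funext => x.
    have := congr1 (fun f : E -> R^o => f x) h.
    rewrite !fctE /GRing.scale/= /v0 /v1 => hx.
    have : c (lift ord0 ord0) * (b + b' - 1) * (q x - p x) = 0.
      rewrite -[RHS]hx; have -> : c ord0 = - c (lift ord0 ord0) by lra.
      by ring.
    move/eqP; rewrite !mulf_eq0 (negbTE c1) gt_eqF//= subr_eq0 => /eqP ->.
    by [].
  move=> i; case: (unliftP ord0 i) => [j ->|->]; first by rewrite ord1.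
  by move: c0; rewrite c1 addr0.
apply/seteqP; split; last first.
  by apply: hull_min => // _ [i _ <-]; case: ifP.
move=> r Fr; have [t rE] := hF p q r Fp Fq pq Fr.
have hr : dual_unit r by apply/dual_ballP/FB.
have tb : t <= b by apply: bmax; rewrite (_ : (fun x => _) = r)//; apply/funext => x.
have tb' : 1 - t <= b'.
  by apply: b'max; rewrite (_ : (fun x => _) = r)//; apply/funext => x; rewrite rE; ring.
pose s := (b - t) / (b + b' - 1).
have -> : r = s *: v0 + (1 - s) *: v1.
  apply/funext => x; rewrite rE !fctE /GRing.scale/= /s /v0 /v1; field.
  by rewrite gt_eqF.
have s0 : 0 <= s by rewrite divr_ge0//; lra.
have s1 : s <= 1 by rewrite ler_pdivrMr//; lra.
have /convex_setP h := @hull_convex _ _ (range (fun i : 'I_2 => if i == 0 then v0 else v1)).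
by apply: h => //; apply: sub_hull; [exists 0|exists 1].
Qed.

Lemma low_dim_small_faces : (d <= 3)%N -> small_faces_simplices E d.
Proof.
move=> d3 F m faceF dimF md; apply: simplex_collinear => // p q r Fp Fq pq Fr.
have [v hv] := affine_dim_spanned dimF.
have {d3 md} : (m <= 1)%N by rewrite -(leq_add2r 2); exact: leq_trans md d3.
case: m v hv {dimF} => [|[|//]] v hv _.
  have [a a1 pE] := hv p Fp; have [b b1 qE] := hv q Fq; case: pq.
  by move: a1 b1 pE qE; rewrite !big_ord1 => -> -> -> ->.
have {}hv l : F l -> exists a, forall x, l x = v ord0 x + a * (v (lift ord0 ord0) x - v ord0 x).
  move=> /hv[a]; rewrite !big_ord_recl !big_ord0 !addr0 => a1 ->.
  exists (a (lift ord0 ord0)) => x; rewrite !fctE /GRing.scale/=.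
  by have -> : a ord0 = 1 - a (lift ord0 ord0); [lra|ring].
have [a pE] := hv p Fp; have [b qE] := hv q Fq; have [c rE] := hv r Fr.
have ab : b - a != 0.
  apply: contra_notN pq; rewrite subr_eq0 => /eqP ba; apply/funext => x.
  by rewrite pE qE ba.
by exists ((c - a) / (b - a)) => x; rewrite pE qE rE; field.
Qed.

(** Small multiples of the coordinate functionals lie in the ball, hence in the linear
    span of the [n + 1] points. *)
Lemma dual_ball_dim (n : nat) : affine_dim (dual_ball E) n -> (d <= n.+1)%N.
Proof.
move=> /affine_dim_spanned[v hv].
have [b [c [bE cK fc]]] := has_coordinates dimE.
have /choice[s hs] : forall i, exists s, 0 < s /\ dual_unit (fun x => s * c x 0 i).
  move=> i; have [M M0 hM] := functional_bounded dimE (fc i); exists M^-1.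
  split; rewrite ?invr_gt0//; split=> [a x y|x]; first by rewrite (fc i); ring.
  by rewrite normrM gtr0_norm ?invr_gt0// ler_pdivrMl.
have /choice[a ha] : forall i, exists a : 'I_n.+1 -> R,
    forall x, s i * c x 0 i = \sum_j a j * v j x.
  move=> i; have [|a _ aE] := hv (fun x => s i * c x 0 i).
    by apply/dual_ballP; have [] := hs i.
  exists a => x; have := congr1 (fun f : E -> R^o => f x) aE => /= ->.
  by rewrite fct_sumE.
suff /eqP <- : row_free (\matrix_(i < d, j < n.+1) a i j) by exact: rank_leq_col.
apply/inj_row_free => w wA; apply/rowP => k; rewrite mxE.
have e x : \sum_i w 0 i * (s i * c x 0 i) = 0.
  rewrite (eq_bigr (fun i => \sum_j w 0 i * a i j * v j x)) => [|i _]; last first.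
    by rewrite ha mulr_sumr; apply: eq_bigr => j _; rewrite mulrA.
  rewrite exchange_big big1// => j _; rewrite -mulr_suml.
  have := congr1 (fun M : 'rV_n.+1 => M 0 j) wA; rewrite !mxE.
  by rewrite (eq_bigr (fun i => w 0 i * a i j)) => [->|i _]; rewrite ?mul0r// mxE.
have := e (\sum_i (delta_mx 0 k : 'rV_d) 0 i *: b i); rewrite cK (bigD1 k)//= big1 => [|i ik].
  rewrite mxE !eqxx mulr1 addr0 => /eqP; rewrite mulf_eq0 => /orP[/eqP //|].
  by rewrite gt_eqF//; have [] := hs k.
by rewrite mxE (negbTE ik) andbF !mulr0.
Qed.

Lemma proper_small_faces : proper_faces_simplices E -> small_faces_simplices E d.
Proof.
move=> pfs F m faceF dimF md; apply: pfs; split=> // FB.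
have := dual_ball_dim (n := m); rewrite -FB => /(_ dimF) dm.
by have := leq_trans md dm; rewrite addn2 ltnn.
Qed.

(** If [l] had norm less than one, every [m] in the ball would be the end of a segment of
    the ball with [l] in its interior, and the face would be everything. *)
Lemma proper_face_normed F l : proper_face (dual_ball E) F -> F l ->
  exists2 u, `|u| = 1 & l u = 1.
Proof.
move=> [[cF FB extF] FnB] Fl; have hl : dual_unit l by apply/dual_ballP/FB.
have [//|[k [k0 k1 hk]]] := norming_or_small dimE hl.
exfalso; apply: FnB; apply/seteqP; split=> // m Bm.
have hm : dual_unit m by apply/dual_ballP.
(* [m] and [l] have norms at most [1] and [k], so that [(l - t m) / (1 - t)] has norm at most
   [(k + t) / (1 - t) = 1] *)
pose t := (1 - k) / 2; have t0 : 0 < t by rewrite /t; lra.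
have t1 : 0 < 1 - t by rewrite /t; lra.
pose n : E -> R^o := fun x => (l x - t * m x) / (1 - t).
have [] : F m /\ F n; last by [].
apply: (extF m n t) => //; [|by lra|].
  apply/dual_ballP; split=> [a x y|x].
    by rewrite /n hl.1 hm.1; field; rewrite gt_eqF.
  rewrite /n normrM (gtr0_norm (x := _^-1)) ?invr_gt0// ler_pdivrMr//.
  apply: le_trans (ler_normB _ _) _; rewrite normrM (gtr0_norm t0).
  have := ler_wpM2l (ltW t0) (hm.2 x); have := hk x; rewrite /t.
  by lra.
rewrite (_ : t *: m + _ = l)//; apply/funext => x.
by rewrite !fctE /GRing.scale/= /n; field; rewrite gt_eqF.
Qed.

(** A vector norming the barycentre norms the three points. *)
Lemma common_normed (p q r : E -> R) F : proper_face (dual_ball E) F ->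
  F p -> F q -> F r -> exists u, [/\ `|u| = 1, p u = 1, q u = 1 & r u = 1].
Proof.
move=> pF Fp Fq Fr; have [[cF FB _] _] := pF; have /convex_setP h := cF.
have Fs : F ((1 / 3) *: (p : E -> R^o) + (1 - 1 / 3) *: ((1 / 2) *: (q : E -> R^o) + (1 - 1 / 2) *: (r : E -> R^o))).
  have /h h2 := Fp; apply: h2; [|lra|lra].
  by have /h h2 := Fq; apply: h2 => //; lra.
have [u u1] := proper_face_normed pF Fs; rewrite !fctE /GRing.scale/= => e.
exists u; have /dual_ballP/(dual_unit_le u) hp := FB _ Fp.
have /dual_ballP/(dual_unit_le u) hq := FB _ Fq.
have /dual_ballP/(dual_unit_le u) hr := FB _ Fr.
by split=> //; lra.
Qed.

(** Two independent differences of points of the face would both kill the common norming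
    vector, which takes dimension three. *)
Lemma low_dim_proper_faces : (d <= 2)%N -> proper_faces_simplices E.
Proof.
move=> d2 F pF; have [faceF _] := pF; have [_ FB _] := faceF.
apply: simplex_collinear => // p q r Fp Fq pq Fr.
have [u [u1 pu qu ru]] := common_normed pF Fp Fq Fr.
have /dual_ballP hp := FB _ Fp; have /dual_ballP hq := FB _ Fq.
have /dual_ballP hr := FB _ Fr.
apply: contrapT => h; pose w (i : 'I_2) x := if i == 0 then q x - p x else r x - p x.
have fw i : functional (w i).
  by rewrite /w; case: (i == 0) => a x y; rewrite hp.1 ?hq.1 ?hr.1; ring.
have u0 : u != 0 by rewrite -normr_eq0 u1 oner_eq0.
suff iw : independent w.
  have := independent_lt dimE fw iw u0; rewrite ltnNge d2 => /(_ _)/negP; apply=> // i.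
  by rewrite /w; case: ifP => _; lra.
move=> a ha; have {}ha x : a 0 * (q x - p x) + a 1 * (r x - p x) = 0.
  rewrite -[RHS](ha x) !big_ord_recl big_ord0 addr0 /w /=.
  by congr (_ + a _ * _); apply/val_inj.
have a1 : a 1 = 0.
  apply: contrapT => /eqP a1; apply: h; exists (- a 0 / a 1) => x.
  have -> : r x = (a 1)^-1 * (a 1 * (r x - p x)) + p x by field.
  have /eqP := ha x; rewrite addrC addr_eq0 => /eqP ->.
  by field.
have a0 : a 0 = 0.
  apply: contrapT => /eqP a0; apply: pq; apply/funext => x; apply/eqP.
  have /eqP := ha x; rewrite a1 mul0r addr0 mulf_eq0 (negbTE a0)/= subr_eq0.
  by rewrite eq_sym.
by move=> i; case: (unliftP 0 i) => [j ->|->//]; rewrite ord1 -[RHS]a1; congr a; apply/val_inj.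
Qed.

Lemma norming_unit l u : dual_unit l -> `|u| = 1 -> l u = 1 -> norming u l.
Proof.
move=> hl u1 lu; have [dl l1] : dual_space E l /\ dual_norm l <= 1.
  by apply: dual_norm_le => // [|x]; [exact: hl.1|rewrite mul1r; exact: hl.2].
split; rewrite ?u1//; apply/eqP; rewrite eq_le l1.
by have := dual_norm_bound u dl; rewrite lu u1 normr1 mulr1.
Qed.

Lemma smooth_proper_faces : smooth_space E -> proper_faces_simplices E.
Proof.
move=> sE F pF; have [[_ FB _] _] := pF.
apply: simplex_subsingleton => p q Fp Fq.
have [u [u1 pu qu _]] := common_normed pF Fp Fq Fq.
have u0 : u != 0 by rewrite -normr_eq0 u1 oner_eq0.
have [m [_ um]] := sE u u0.
have hp : dual_unit p by apply/dual_ballP/FB.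
have hq : dual_unit q by apply/dual_ballP/FB.
by have <- := um p (norming_unit hp u1 pu); have <- := um q (norming_unit hq u1 qu).
Qed.

End Faces.

(** * The distance between types *)

Section Amalgam.
Context {R : realType}.

(** On two copies of [X], the semi-norm
    [(p, q) => inf_i (xi (p + i) + zeta (q - i) + delta i)] restricts to [xi] and [zeta] on
    the two copies, which are at distance [delta] of each other. *)
Lemma seminorm_amalgam (X : lmodType R) (xi zeta delta : X -> R) :
  seminorm xi -> seminorm zeta -> seminorm delta ->
  (forall x, `|xi x - zeta x| <= delta x) ->
  exists (F : completeNormedModType R) (S T : {linear X -> F}),
    [/\ forall x, `|S x| = xi x, forall x, `|T x| = zeta x &
        forall x, `|S x - T x| <= delta x].
Proof.
move=> sx sz sd h.
have ge0 (N : X -> R) x : seminorm N -> 0 <= N x.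
  move=> sN; have := sublinear_ge x (seminorm_sublinear sN).
  by rewrite (seminormN x sN) => ?; lra.
have at0 (N : X -> R) : seminorm N -> N 0 = 0.
  by move=> /seminorm_sublinear; exact: sublinear0.
pose phi (i : X) (v : X * X) := xi (v.1 + i) + zeta (v.2 - i) + delta i.
have phi_ge0 i v : 0 <= phi i v by rewrite !addr_ge0// ge0.
have [||||||sN Nle] := @inf_sublinear R (X * X)%type X [set: X] phi (fun=> 0).
- by exists 0.
- by move=> i v _.
- by move=> i _.
- by exists 0 => //; rewrite /phi /= !addr0 subr0 !at0// !addr0.
- move=> i j v w _ _; exists (i + j) => //; rewrite /phi /=.
  have := sx.1 (v.1 + i) (w.1 + j); have := sz.1 (v.2 - i) (w.2 - j); have := sd.1 i j.
  by rewrite [v.2 - i + _]addrACA [v.1 + i + _]addrACA -opprD; lra.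
- move=> i t v _ t0; exists (t *: i) => //; rewrite /phi /=.
  by rewrite -scalerDr -scalerBr sx.2 sz.2 sd.2 !gtr0_norm// !mulrDr.
set N := (fun v => inf _) in sN Nle.
have Nge v a : (forall i, a <= phi i v) -> a <= N v.
  move=> ha; apply: lb_le_inf; first by exists (phi 0 v), 0.
  by move=> _ [i _ <-].
have NN v : N (- v) <= N v.
  apply: Nge => i; apply: le_trans (Nle (- i) _ I) _; rewrite /phi /=.
  have -> : - v.2 - - i = - (v.2 - i) by rewrite opprD.
  by rewrite -opprD (seminormN _ sx) (seminormN _ sz) (seminormN _ sd).
have semN : seminorm N.
  split=> [|c v]; first exact: sN.1.
  have [c0|c0] := leP 0 c; first by rewrite sN.2// ger0_norm.
  rewrite -[c]opprK scaleNr normrN ger0_norm ?oppr_ge0 ?ltW//.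
  rewrite -sN.2 ?oppr_ge0 ?ltW//; apply/eqP; rewrite eq_le NN /=.
  by rewrite -[X in N X <= _]opprK NN.
have [F [T hT]] := seminorm_realize semN.
pose T1 x := T (x, 0); pose T2 x := T (0, x).
have lT1 : linear T1.
  by move=> a x y; rewrite /T1 -linearP; congr (T _); congr pair; rewrite /= scaler0 addr0.
have lT2 : linear T2.
  by move=> a x y; rewrite /T2 -linearP; congr (T _); congr pair; rewrite /= scaler0 addr0.
pose L1 := GRing.isLinear.Build R X F *:%R T1 lT1.
pose L2 := GRing.isLinear.Build R X F *:%R T2 lT2.
pose S1 : {linear X -> F} := HB.pack T1 L1.
pose S2 : {linear X -> F} := HB.pack T2 L2.
exists F, S1, S2; split=> x /=.
- rewrite /T1 hT; apply/eqP; rewrite eq_le; apply/andP; split.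
    by apply: le_trans (Nle 0 _ I) _; rewrite /phi /= !addr0 subr0 !at0// !addr0.
  apply: Nge => i; rewrite /phi /= sub0r (seminormN _ sz).
  have := sx.1 (x + i) (- i); rewrite addrK (seminormN _ sx).
  by have := h i; rewrite ler_norml => /andP[? ?]; lra.
- rewrite /T2 hT; apply/eqP; rewrite eq_le; apply/andP; split.
    by apply: le_trans (Nle 0 _ I) _; rewrite /phi /= !addr0 subr0 !at0// addr0 add0r.
  apply: Nge => i; rewrite /phi /= add0r.
  have := sz.1 (x - i) i; rewrite subrK.
  by have := h i; rewrite ler_norml => /andP[? ?]; lra.
rewrite /T1 /T2 -linearB hT; apply: le_trans (Nle (- x) _ I) _.
by rewrite /phi /= !subr0 sub0r opprK subrr addNr !at0// !add0r (seminormN _ sd).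
Qed.

End Amalgam.

Section TypeDistance.
Context {R : realType} {E : normedModType R} (n : nat).
Implicit Types (xi zeta : ntypes E n).

Lemma type_seminorm xi : seminorm (val xi : E * 'rV[R]_n -> R).
Proof. by have := valP xi; rewrite inE => -[]. Qed.

Lemma type_base xi b : val xi (b, 0) = `|b|.
Proof. by have := valP xi; rewrite inE => -[]. Qed.

Lemma l1_seminorm (D : R) : 0 <= D ->
  seminorm (fun x : E * 'rV[R]_n => D * \sum_i `|x.2 0 i|).
Proof.
move=> D0; split=> [x y|c x].
  rewrite -mulrDr -big_split ler_wpM2l// ler_sum// => i _.
  by rewrite /= mxE ler_normD.
rewrite mulrCA [in RHS]mulr_sumr; congr (D * _); apply: eq_bigr => i _.
by rewrite mxE normrM.
Qed.

Lemma row_pair (e : E) (w : 'rV[R]_n) :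
  (e, w) = (e, 0) + \sum_i w 0 i *: ((0 : E), delta_mx (0 : 'I_1) i : 'rV[R]_n).
Proof.
have -> : \sum_i w 0 i *: ((0 : E), delta_mx (0 : 'I_1) i : 'rV[R]_n) = (0, w).
  rewrite [in RHS](row_sum_delta w); elim/big_rec2: _ => // i y z _ ->.
  by congr pair; rewrite /= scaler0 addr0.
by congr pair; rewrite ?addr0 ?add0r.
Qed.

Lemma tp_linear (F : normedModType R) (f : {linear E -> F}) (hf : isometric f)
    (S : {linear (E * 'rV[R]_n)%type -> F}) xi :
  (forall x, `|S x| = val xi x) -> (forall e, f e = S (e, 0)) ->
  tp hf (fun i => S (0, delta_mx 0 i)) = xi.
Proof.
move=> SN fS; apply/val_inj/funext => -[e w] /=; rewrite /tp_fun -SN; congr `|_|.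
rewrite [in RHS]row_pair linearD linear_sum -fS; congr (_ + _).
by apply: eq_bigr => i _; rewrite linearZ.
Qed.

Lemma type_row_le xi e w v :
  val xi (e, w) <= val xi (e, v) + \sum_i `|w 0 i - v 0 i| * val xi (0, delta_mx 0 i).
Proof.
have [xD xZ] := type_seminorm xi.
have -> : (e, w) = (e, v) + (0, w - v) by congr pair; rewrite /= ?addr0// addrC subrK.
apply: le_trans (xD _ _) _; rewrite lerD2l row_pair.
apply: le_trans (xD _ _) _; rewrite type_base normr0 add0r.
elim/big_rec2: _ => [|i y z _ h]; first by rewrite type_base normr0.
by apply: le_trans (xD _ _) _; rewrite xZ !mxE lerD.
Qed.

Definition realised_at xi zeta r :=
  exists (F : completeNormedModType R) (f : {linear E -> F})
      (hf : isometric f) (a b : 'I_n -> F),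
    [/\ tp hf a = xi, tp hf b = zeta
      & r = \big[Num.max/0]_(i < n) `|a i - b i|].

(** Amalgamates the two types over [E], on which the semi-norm [D \sum_i `|w_i|]
    vanishes. *)
Lemma types_amalgam xi zeta D : 0 <= D ->
  (forall e w, `|val xi (e, w) - val zeta (e, w)| <= D * \sum_i `|w 0 i|) ->
  exists2 r, r <= D & realised_at xi zeta r.
Proof.
move=> D0 h; have [|F [S [T [SN TN ST]]]] :=
  seminorm_amalgam (type_seminorm xi) (type_seminorm zeta) (l1_seminorm D0).
  by case=> e w; exact: h.
pose f e := S (e, 0).
have lf : linear f.
  by move=> a x y; rewrite /f -linearP; congr (S _); congr pair; rewrite /= scaler0 addr0.
pose Lf := GRing.isLinear.Build R E F *:%R f lf.
pose fl : {linear E -> F} := HB.pack f Lf.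
have hf : isometric fl by move=> x; rewrite /= /f SN type_base.
have fT e : fl e = T (e, 0).
  apply/eqP; rewrite -subr_eq0 -normr_le0; apply: le_trans (ST _) _.
  by rewrite /= big1 ?mulr0// => i _; rewrite mxE normr0.
exists (\big[Num.max/0]_(i < n) `|S (0, delta_mx 0 i) - T (0, delta_mx 0 i)|).
  apply: bigmax_le => // i _; apply: le_trans (ST _) _; rewrite /=.
  rewrite (bigD1 i)//= big1 => [|j ji]; first by rewrite mxE !eqxx normr1 addr0 mulr1.
  by rewrite mxE (negbTE ji) andbF normr0.
exists F, fl, hf, (fun i => S (0, delta_mx 0 i)), (fun i => T (0, delta_mx 0 i)).
by split=> //; exact: tp_linear.
Qed.

Lemma realised_ge0 xi zeta r : realised_at xi zeta r -> 0 <= r.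
Proof.
move=> [F [f [hf [a [b [_ _ ->]]]]]].
by apply: (big_ind (fun x => 0 <= x)) => // x y x0 _; rewrite le_max x0.
Qed.

Lemma realised_close xi zeta r e w : realised_at xi zeta r ->
  `|val xi (e, w) - val zeta (e, w)| <= r * \sum_i `|w 0 i|.
Proof.
move=> [F [f [hf [a [b [<- <- ->]]]]]]; rewrite /= /tp_fun /=.
apply: le_trans (ler_dist_dist _ _) _.
rewrite opprD addrACA subrr add0r -sumrB mulr_sumr.
apply: le_trans (ler_norm_sum _ _ _) _; apply: ler_sum => i _.
rewrite -scalerBr normrZ mulrC ler_wpM2r//.
exact: (@le_bigmax _ _ _ _ (fun i => `|a i - b i|) i).
Qed.

Lemma type_dist_le xi zeta D : 0 <= D ->
  (forall e w, `|val xi (e, w) - val zeta (e, w)| <= D * \sum_i `|w 0 i|) ->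
  type_dist xi zeta <= D.
Proof.
move=> D0 h; have [r rD hr] := types_amalgam D0 h.
apply: le_trans rD; apply: ge_inf => //.
by exists 0 => s; exact: realised_ge0.
Qed.

(** Two types have a common realisation at some distance, so that the infimum which
    defines their distance is not that of the empty set. *)
Lemma type_dist_close xi zeta D e w : type_dist xi zeta < D ->
  `|val xi (e, w) - val zeta (e, w)| <= D * \sum_i `|w 0 i|.
Proof.
pose M := \sum_i (val xi (0, delta_mx 0 i) + val zeta (0, delta_mx 0 i)).
have ge0 x i : 0 <= val (x : ntypes E n) (0, delta_mx 0 i).
  have := sublinear_ge (0, delta_mx 0 i) (seminorm_sublinear (type_seminorm x)).
  by rewrite (seminormN _ (type_seminorm x)) => ?; lra.
have row_le (x : ntypes E n) c v : (forall i, val x (0, delta_mx 0 i) <= M) ->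
    `|val x (c, v) - `|c| | <= M * \sum_i `|v 0 i|.
  move=> hM; have leM : \sum_i `|v 0 i| * val x (0, delta_mx 0 i) <= M * \sum_i `|v 0 i|.
    by rewrite mulr_sumr ler_sum// => i _; rewrite mulrC ler_wpM2r.
  have := type_row_le x c v 0; have := type_row_le x c 0 v; rewrite type_base.
  have -> : \sum_i `|v 0 i - (0 : 'rV[R]_n) 0 i| * val x (0, delta_mx 0 i) =
            \sum_i `|v 0 i| * val x (0, delta_mx 0 i).
    by apply: eq_bigr => i _; rewrite mxE subr0.
  have -> : \sum_i `|(0 : 'rV[R]_n) 0 i - v 0 i| * val x (0, delta_mx 0 i) =
            \sum_i `|v 0 i| * val x (0, delta_mx 0 i).
    by apply: eq_bigr => i _; rewrite mxE sub0r normrN.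
  by rewrite ler_norml => ? ?; apply/andP; split; lra.
have M0 : 0 <= M by rewrite sumr_ge0// => i _; rewrite addr_ge0.
have sM i : val xi (0, delta_mx 0 i) <= M /\ val zeta (0, delta_mx 0 i) <= M.
  rewrite /M (bigD1 i)//=.
  have : 0 <= \sum_(j < n | j != i) (val xi (0, delta_mx 0 j) + val zeta (0, delta_mx 0 j)).
    by rewrite sumr_ge0// => j _; rewrite addr_ge0.
  move=> s0; split; first by rewrite -addrA lerDl addr_ge0// ge0.
  by rewrite addrAC lerDr addr_ge0// ge0.
have [||r0 _ h0 dD] := @types_amalgam xi zeta (2 * M).
- by rewrite mulr_ge0.
- move=> c v; have := row_le xi c v (fun i => (sM i).1); have := row_le zeta c v (fun i => (sM i).2).
  by rewrite !ler_norml => /andP[? ?] /andP[? ?]; apply/andP; split; lra.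
have [r hr rD] : exists2 r, realised_at xi zeta r & r < D.
  apply: contrapT => h; suff : D <= type_dist xi zeta by rewrite leNgt dD.
  apply: lb_le_inf; first by exists r0.
  by move=> r hr; rewrite leNgt; apply/negP => rD; apply: h; exists r.
by apply: le_trans (realised_close e w hr) _; rewrite ler_wpM2r ?sumr_ge0// ltW.
Qed.

End TypeDistance.

(** * Norm preserving extensions *)

Lemma list_bound (R : realType) (T : eqType) (h : T -> R) (s : seq T) :
  exists2 M, 0 < M & forall x, x \in s -> h x <= M.
Proof.
elim: s => [|x s [M M0 hM]]; first by exists 1.
exists (Num.max M (h x)); first by rewrite lt_max M0.
move=> y; rewrite in_cons le_max => /predU1P[->|/hM ->//].
by rewrite lexx orbT.
Qed.

Section DualNorm.
Context {R : realType} {E : normedModType R}.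
Implicit Types l : E -> R^o.

Lemma dual_unit_space l : dual_unit l -> dual_space E l.
Proof. by move=> /dual_ballP[]. Qed.

Lemma dual_space_unit l (c : R) : dual_space E l -> dual_norm l <= c -> 0 < c ->
  dual_unit (fun x => c^-1 * l x).
Proof.
move=> dl lc c0; have fl : functional l by apply/linear_functionalP; have [] := dl.
split=> [a x y|x]; first by rewrite fl; ring.
rewrite normrM gtr0_norm ?invr_gt0// ler_pdivrMl//.
by apply: le_trans (dual_norm_bound x dl) _; rewrite ler_wpM2r.
Qed.

Lemma dual_norm_attained d (dimE : has_dim E d) l : dual_space E l ->
  0 < dual_norm l -> exists2 u, `|u| = 1 & l u = dual_norm l.
Proof.
move=> dl c0; have hm := dual_space_unit dl (lexx _) c0.
have [[u u1 lu]|[k [k0 k1 hk]]] := norming_or_small dimE hm.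
  by exists u => //; rewrite -[RHS]mulr1 -lu mulVKf// gt_eqF.
have fl : functional l by apply/linear_functionalP; have [] := dl.
have [||_] := @dual_norm_le _ _ l (k * dual_norm l) fl; last first.
- by rewrite leNgt gtr_pMl// k1.
- move=> x; have := hk x; rewrite normrM gtr0_norm ?invr_gt0// ler_pdivrMl//.
  by rewrite mulrA [k * _]mulrC.
- by rewrite mulr_ge0// ltW.
Qed.

End DualNorm.

Section Extensions.
Context {R : realType} {E G : normedModType R}.
Context (i : {linear E -> G}) (hi : isometric i).
Implicit Types (l : E -> R) (L : G -> R).

(** The largest sublinear function on [G] below the norm of [G] and below [l] on [E]. *)
Definition inf_gauge l (z : G) : R := inf [set `|z - i x| + l x | x in [set: E]].

Lemma inf_gauge_sublinear l : dual_unit l -> sublinear (inf_gauge l) /\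
  forall x z, inf_gauge l z <= `|z - i x| + l x.
Proof.
move=> hl; have fl := hl.1.
have [||||||sp ple] := @inf_sublinear R G E [set: E] (fun x z => `|z - i x| + l x) (fun z => - `|z|).
- by exists 0.
- move=> x z _; have := dual_unit_ge x hl; have := ler_normB z (z - i x).
  by rewrite opprB addrCA subrr addr0 hi; lra.
- by move=> x _; rewrite sub0r normrN hi; have := dual_unit_ge x hl; lra.
- by exists 0 => //; rewrite linear0 subr0 normr0 (functional0 fl) addr0.
- move=> x y z w _ _; exists (x + y) => //.
  rewrite linearD opprD addrACA (functionalD _ _ fl).
  by have := ler_normD (z - i x) (w - i y); lra.
- move=> x t z _ t0; exists (t *: x) => //.
  by rewrite linearZ -scalerBr normrZ gtr0_norm// (functionalZ _ _ fl) mulrDr.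
by split=> // x z; exact: ple.
Qed.

(** By Hahn-Banach the extensions of [l] of norm at most one are the linear functions below
    [inf_gauge l], and its value at [a] is the largest value that they take there. *)
Lemma norm_extension l a : dual_unit l ->
  exists L, [/\ dual_unit L, forall x, L (i x) = l x & L a = inf_gauge l a].
Proof.
move=> hl; have fl := hl.1; have [sp ple] := inf_gauge_sublinear hl.
have [L [fL Lp La]] := hahn_banach a sp.
have Li x : L (i x) <= l x.
  by apply: le_trans (Lp _) _; have := ple x (i x); rewrite subrr normr0 add0r.
exists L; split=> //.
  apply: dual_unitP => // z; apply: le_trans (Lp z) _.
  by have := ple 0 z; rewrite linear0 subr0 (functional0 fl) addr0.
move=> x; apply/eqP; rewrite eq_le Li/=.
by have := Li (- x); rewrite linearN (functionalN _ fL) (functionalN _ fl) lerN2.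
Qed.

(** Reduction to functionals of norm one, each of which is normed by some [u]; for these,
    extending with the same norm means extending within the dual ball of [G]. *)
Lemma unique_extensionsP d (dimE : has_dim E d) : unique_extensions i <->
  forall l u, dual_unit l -> `|u| = 1 -> l u = 1 -> forall L L',
    dual_unit L -> dual_unit L' -> (forall x, L (i x) = l x) ->
    (forall x, L' (i x) = l x) -> L = L'.
Proof.
split=> [uE l u hl u1 lu L L' hL hL' Li L'i|uE l dl].
  have [dl l1 _] := norming_unit hl u1 lu.
  have iu1 : `|i u| = 1 by rewrite hi.
  have [dL L1 _] := norming_unit hL iu1 (etrans (Li u) lu).
  have [dL' L'1 _] := norming_unit hL' iu1 (etrans (L'i u) lu).
  have [M [_ uM]] := uE l dl.
  have <- := uM L; last by split=> //; rewrite L1 l1.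
  by have <- := uM L'; last by split=> //; rewrite L'1 l1.
have fl : functional l by apply/linear_functionalP; have [] := dl.
have := dual_norm_ge0 dl; rewrite le_eqVlt => /predU1P[c0|c0].
  have l0 x : l x = 0.
    by have := dual_norm_bound x dl; rewrite -c0 mul0r normr_le0 => /eqP.
  have [|||d0 n0] := @dual_norm_le _ G (fun=> 0) 0.
  - by move=> a x y; rewrite mulr0 addr0.
  - by [].
  - by move=> x; rewrite normr0 mul0r.
  exists (fun=> 0); split.
    by split=> //; apply/eqP; rewrite -c0 eq_le n0 dual_norm_ge0.
  move=> L [dL _ nL]; apply/funext => z; apply/eqP.
  by rewrite eq_sym -normr_le0; have := dual_norm_bound z dL; rewrite nL -c0 mul0r.
set c := dual_norm l in c0.
have [u u1 lu] := dual_norm_attained dimE dl c0.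
have hm := dual_space_unit dl (lexx _) c0; rewrite -/c in hm.
have [L [hL Li _]] := norm_extension 0 hm.
have cV x : c * (c^-1 * x) = x by rewrite mulVKf// gt_eqF.
pose cL z : R^o := c * L z.
have [|||dcL ncL] := @dual_norm_le _ G cL c; [|exact: ltW| |].
- by move=> a x y; rewrite /cL hL.1; ring.
- by move=> x; rewrite /cL normrM gtr0_norm// ler_wpM2l ?hL.2// ltW.
have cLi x : cL (i x) = l x by rewrite /cL Li cV.
exists cL; split.
  split=> //; apply/eqP; rewrite eq_le ncL.
  have := dual_norm_bound (i u) dcL; rewrite hi u1 mulr1 cLi lu => h.
  by apply: le_trans h; exact: ler_norm.
move=> L' [dL' L'i nL'].
have hL' := dual_space_unit dL' (le_trans _ (lexx c)) c0.
have {}hL' : dual_unit (fun x => c^-1 * L' x) by apply: hL'; rewrite nL'.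
have LE : L = (fun x => c^-1 * L' x).
  apply: (uE _ u hm u1) => // [|x]; last by rewrite L'i.
  by rewrite lu mulVf// gt_eqF.
by apply/funext => z; rewrite /cL LE cV.
Qed.

(** The largest and the smallest value of an extension at [a] are [inf_gauge l a] and
    [- inf_gauge l (- a)]; when they agree, points almost attaining the two infima are as
    required. *)
Lemma extension_gap l a : dual_unit l ->
  (forall L L', dual_unit L -> dual_unit L' -> (forall x, L (i x) = l x) ->
    (forall x, L' (i x) = l x) -> L = L') ->
  forall e, 0 < e -> exists x1 x2, `|a - i x1| + `|a - i x2| <= l (x2 - x1) + e.
Proof.
move=> hl uL e e0; have fl := hl.1.
have [L [hL Li La]] := norm_extension a hl.
have [L' [hL' L'i L'a]] := norm_extension (- a) hl.
have LL' := uL L L' hL hL' Li L'i; rewrite -LL' (functionalN _ hL.1) La in L'a.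
have near z : exists x, `|z - i x| + l x < inf_gauge l z + e / 2.
  apply: contrapT => h.
  suff : inf_gauge l z + e / 2 <= inf_gauge l z by lra.
  apply: lb_le_inf; first by exists (`|z - i 0| + l 0), 0.
  by move=> _ [x _ <-]; rewrite leNgt; apply/negP => hx; apply: h; exists x.
have [x hx] := near a; have [y hy] := near (- a).
exists x, (- y); rewrite (functionalB _ _ fl) (functionalN _ fl) linearN.
rewrite -L'a -opprD normrN in hy; rewrite opprK.
by lra.
Qed.

Lemma dist_kc a : kc (fun y => `|a - i y|).
Proof.
split=> [x z t t0 t1|x z|x z].
- have t1' : 0 <= 1 - t by rewrite subr_ge0.
  have -> : a - i (t *: x + (1 - t) *: z) = t *: (a - i x) + (1 - t) *: (a - i z).
    rewrite linearD !linearZ !scalerBr addrACA -opprD; congr (_ - _).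
    by rewrite -scalerDl addrCA subrr addr0 scale1r.
  by apply: le_trans (ler_normD _ _) _; rewrite !normrZ (ger0_norm t0) (ger0_norm t1').
- have -> : a - i x = (a - i z) - i (x - z) by rewrite linearB opprB addrA subrK.
  by apply: le_trans (ler_normB _ _) _; rewrite hi.
rewrite -hi linearB (_ : i x - i z = (a - i z) - (a - i x)).
  by apply: le_trans (ler_normB _ _) _; rewrite addrC.
by rewrite opprB [RHS]addrC addrA subrK.
Qed.

End Extensions.

(** * Unique extensions give isolated types *)

Section Rigidity.
Context {R : realType} {E : normedModType R} (d : nat) (dimE : has_dim E d).
Implicit Types (f g : E -> R) (l m : E -> R).

(** A subgradient [m] of [g] at a far point [y] has almost norm one, because [g] grows
    like the norm. Let [l] be [m] divided by its norm; then
    [g y <= g x2 + m (y - x2)], about [g x2 + l (y - x2)], while [f y >= l (y - x1) - f x1]. *)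
Lemma kc_far f g (M e y : _) : kc f -> kc g ->
  (forall l u, dual_unit l -> `|u| = 1 -> l u = 1 -> exists x1 x2,
     [/\ `|x2| <= M & f x1 + g x2 <= l (x2 - x1) + e]) ->
  2 * g 0 < `|y| -> g y <= f y + e + 2 * g 0 / `|y| * M.
Proof.
move=> kf kg h y_gt; have g0 := kc_ge0 0 kg; have y0 : 0 < `|y| by lra.
have [m hm my] := kc_subgradient y kg; have fm := hm.1.
have gy : `|y| <= g y + g 0 by have [_ _ /(_ y 0)] := kg; rewrite subr0.
have m0 : g y - m y <= g 0 by have := my 0; rewrite sub0r (functionalN _ fm).
have dm : dual_space E m := dual_unit_space hm.
have [c1 cy] : dual_norm m <= 1 /\ m y <= dual_norm m * `|y|.
  split; first by have /dual_ballP[] := hm.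
  by apply: le_trans (ler_norm _) (dual_norm_bound y dm).
set c := dual_norm m in c1 cy.
have cge : 1 - c <= 2 * g 0 / `|y|.
  by rewrite ler_pdivlMr//; lra.
have c0 : 0 < c.
  rewrite -(pmulr_lgt0 _ y0); apply: lt_le_trans cy; lra.
have [u u1 mu] := dual_norm_attained dimE dm c0.
have hl := dual_space_unit dm (lexx _) c0; rewrite -/c in hl mu.
have [|x1 [x2 [x2M hx]]] := h _ u hl u1; first by rewrite mu mulVf// gt_eqF.
have my0 : 0 <= m y by lra.
have ly : m y <= c^-1 * m y by rewrite ler_peMl// invf_ge1.
have lx : c^-1 * m x2 - m x2 <= (1 - c) * M.
  have -> : c^-1 * m x2 - m x2 = (1 - c) * (c^-1 * m x2) by field; rewrite gt_eqF.
  rewrite ler_wpM2l ?subr_ge0//; apply: le_trans x2M.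
  exact: dual_unit_le hl.
have M0 : 0 <= M by apply: le_trans x2M.
have := ler_wpM2r M0 cge.
have := my x2; rewrite (functionalB _ _ fm).
have : c^-1 * m y - c^-1 * m x1 - f x1 <= f y.
  have := dual_unit_le (y - x1) hl; rewrite (functionalB _ _ fm) mulrBr.
  by have [_ _ /(_ y x1)] := kf; lra.
move: hx; rewrite (functionalB _ _ fm) mulrBr.
by lra.
Qed.

(** The inequality [l (x2 - x1) <= f x1 + f x2] is as sharp as possible for each
    functional of norm one. For [f y = `|a - y|] it says that extensions of norm one
    have a unique value at [a]. *)
Definition gap f := forall l u, dual_unit l -> `|u| = 1 -> l u = 1 ->
  forall e, 0 < e -> exists x1 x2, f x1 + f x2 <= l (x2 - x1) + e.

Lemma finite_gap f e : gap f -> 0 < e -> exists K : seq E,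
  forall l u, dual_unit l -> `|u| = 1 -> l u = 1 -> exists x1 x2,
    [/\ x1 \in K, x2 \in K & f x1 + f x2 <= l (x2 - x1) + e].
Proof.
move=> hf e0.
pose Q (A : set (E -> R)) := exists K : seq E, forall l u, A l -> dual_unit l ->
  `|u| = 1 -> l u = 1 -> exists x1 x2,
    [/\ x1 \in K, x2 \in K & f x1 + f x2 <= l (x2 - x1) + e].
suff [K hK] : Q dual_unit.
  by exists K => l u hl; exact: hK.
apply: (dual_induct dimE).
- by exists [::].
- by move=> A B AB [K hK]; exists K => l u /AB; exact: hK.
- move=> A B [K hK] [K' hK']; exists (K ++ K') => l u [Al|Bl] hl u1 lu.
    have [x1 [x2 [k1 k2 hx]]] := hK l u Al hl u1 lu.
    by exists x1, x2; rewrite !mem_cat k1 k2.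
  have [x1 [x2 [k1 k2 hx]]] := hK' l u Bl hl u1 lu.
  by exists x1, x2; rewrite !mem_cat k1 k2 !orbT.
move=> l hl; have [[u u1 lu]|[k [k0 k1 hk]]] := norming_or_small dimE hl.
  have [x1 [x2 hx]] := hf l u hl u1 lu (e / 2) ltac:(lra).
  have p0 : 0 < `|x2 - x1| + 1 by rewrite ltr_wpDl.
  exists (e / 2 / (`|x2 - x1| + 1)); first by rewrite !divr_gt0.
  exists [:: x1; x2] => m _ [hm lm] _ _ _; exists x1, x2.
  split; rewrite ?inE ?eqxx ?orbT//.
  have := lm (x2 - x1); rewrite ler_norml => /andP[h _].
  have : e / 2 / (`|x2 - x1| + 1) * `|x2 - x1| <= e / 2.
    by rewrite mulrAC ler_pdivrMr// ler_wpM2l// ?lerDl//; lra.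
  by lra.
have [r r0 hr] := interior_misses hl k0 k1 hk; exists r => //.
exists [::] => m u [hm lm] _ u1 mu.
by have := hr m hm lm u u1; rewrite mu eqxx.
Qed.

(** Finitely many points realise the gap for all functionals of norm one. A function [g]
    close to [f] at these points is compared with [f] far away by [kc_far], applied in
    both directions, and on the remaining ball by a finite net. *)
Lemma kc_rigid f e : kc f -> gap f -> 0 < e -> exists (K : seq E) (r : R), 0 < r /\
  forall g, kc g -> (forall x, x \in K -> `|g x - f x| <= r) ->
    forall y, `|g y - f y| <= e.
Proof.
move=> kf gf e0; pose s := e / 4; have s0 : 0 < s by rewrite /s; lra.
have [K hK] := finite_gap gf s0.
have [M M0 hM] := list_bound (fun x : E => `|x|) K.
have f0 := kc_ge0 0 kf.
(* beyond [rho] the defect [2 g 0 / `|y|] of the norm of a subgradient, times [M], is below [s] *)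
pose rho := 2 * (f 0 + s) * (1 + M / s).
have [N hN] := finite_net dimE rho s0.
exists (0 :: K ++ N), s; split=> // g kg hg y.
have hgK x : x \in K -> `|g x - f x| <= s.
  by move=> xK; apply: hg; rewrite in_cons mem_cat xK orbT.
have hgN x : x \in N -> `|g x - f x| <= s.
  by move=> xK; apply: hg; rewrite in_cons mem_cat xK !orbT.
have g0 : g 0 <= f 0 + s.
  by have := hg 0 (mem_head _ _); rewrite ler_norml => /andP[_ ?]; lra.
have [yr|yr] := leP `|y| rho.
  have [z zN yz] := hN y yr; have := hgN z zN.
  have [_ /(_ y z) h1 _] := kf; have [_ /(_ z y) h2 _] := kf.
  have [_ /(_ y z) h3 _] := kg; have [_ /(_ z y) h4 _] := kg.
  rewrite (distrC z y) in h2 h4.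
  by rewrite /s in yz *; rewrite !ler_norml => /andP[? ?]; apply/andP; split; lra.
have f0s : 0 < f 0 + s by lra.
have y0 : 0 < `|y|.
  apply: lt_trans yr; rewrite !mulr_gt0// ltr_pwDl// divr_ge0// ltW//.
have h2y : 2 * (f 0 + s) < `|y|.
  apply: le_lt_trans yr; rewrite ler_peMr ?lerDl ?divr_ge0 ?mulr_ge0// ltW//.
have tail c : 0 <= c -> c <= f 0 + s -> 2 * c / `|y| * M <= s.
  move=> c0 cf; rewrite mulrAC ler_pdivrMr//.
  apply: le_trans (_ : 2 * (f 0 + s) * M <= _).
    by rewrite ler_wpM2r ?ler_wpM2l// ltW.
  rewrite -ler_pdivrMl//; apply: le_trans (ltW yr).
  rewrite mulrCA -mulrA /rho -mulrA !ler_wpM2l//; first exact: ltW.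
  by rewrite [_ * M]mulrC; lra.
have := tail (g 0) (kc_ge0 0 kg) g0.
have := tail (f 0) f0 ltac:(lra).
have : g y <= f y + 2 * s + 2 * g 0 / `|y| * M.
  apply: kc_far => // [l u hl u1 lu|]; last by lra.
  have [x1 [x2 [k1 k2 hx]]] := hK l u hl u1 lu; exists x1, x2; split; first exact: hM.
  by have := hgK x2 k2; rewrite ler_norml => /andP[_ ?]; lra.
have : f y <= g y + 2 * s + 2 * f 0 / `|y| * M.
  apply: kc_far => // [l u hl u1 lu|]; last by lra.
  have [x1 [x2 [k1 k2 hx]]] := hK l u hl u1 lu; exists x1, x2; split; first exact: hM.
  by have := hgK x1 k1; rewrite ler_norml => /andP[_ ?]; lra.
rewrite /s ler_norml => ? ? ? ?; apply/andP; split; lra.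
Qed.

End Rigidity.

Lemma has_dim_row (R : realType) n : has_dim 'rV[R]_n n.
Proof.
exists (fun i => delta_mx 0 i) => x; exists x; split; first exact: row_sum_delta.
by move=> c ->; exact/esym/row_sum_delta.
Qed.

Lemma dist_perturb (R : realType) (a a' b b' e : R) :
  b' <= b + e / 8 -> a' <= a + e / 8 -> b <= b' + e / 8 -> a <= a' + e / 8 ->
  `|b' - a'| <= e / 4 -> `|a - b| <= e / 2.
Proof. by rewrite !ler_norml => ? ? ? ? /andP[? ?]; apply/andP; split; lra. Qed.

Section Isolation.
Context {R : realType} {E : normedModType R} (d : nat) (dimE : has_dim E d) (n : nat).
Implicit Types (xi zeta : ntypes E n).

(** The distance function of the combination [\sum_i w_i x_i] of the variables. *)
Definition slice xi (w : 'rV[R]_n) (y : E) : R := val xi (- y, w).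

Lemma slice_kc xi w : kc (slice xi w).
Proof.
have [xD xZ] := type_seminorm xi; have sx := type_seminorm xi.
split=> [x z t t0 t1|x z|x z]; rewrite /slice.
- have t1' : 0 <= 1 - t by rewrite subr_ge0.
  have -> : (- (t *: x + (1 - t) *: z), w) = t *: (- x, w) + (1 - t) *: (- z, w).
    congr pair; first by rewrite /= !scalerN opprD.
    by rewrite /= -scalerDl addrCA subrr addr0 scale1r.
  by apply: le_trans (xD _ _) _; rewrite !xZ !ger0_norm.
- have -> : (- x, w) = (- z, w) + (z - x, 0) by congr pair; rewrite /= ?addr0// addrA addNr add0r.
  by apply: le_trans (xD _ _) _; rewrite type_base distrC.
rewrite -(type_base xi).
have -> : (x - z, 0) = (- z, w) + - (- x, w) by congr pair; rewrite /= ?subrr// opprK addrC.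
by apply: le_trans (xD _ _) _; rewrite (seminormN _ sx) addrC.
Qed.

Lemma slices_near xi (e : R) (N : seq 'rV[R]_n) : (forall w, gap (slice xi w)) ->
  0 < e -> exists (K : seq (E * 'rV[R]_n)) (r : R), 0 < r /\
  forall zeta, (forall x, x \in K -> `|val zeta x - val xi x| < r) ->
    forall w c, w \in N -> `|val zeta (c, w) - val xi (c, w)| <= e.
Proof.
move=> hgap e0; elim: N => [|w N [K [r [r0 h]]]]; first by exists [::], 1.
have [K' [r' [r'0 h']]] := kc_rigid dimE (slice_kc xi w) (hgap w) e0.
exists (K ++ [seq (- y, w) | y <- K']), (Num.min r r'); split; first by rewrite lt_min r0.
move=> zeta hz v c; rewrite in_cons => /predU1P[->|vN].
  rewrite -[c]opprK; apply: (h' (slice zeta w)); first exact: slice_kc.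
  move=> y yK; have := hz (- y, w); rewrite mem_cat map_f ?orbT// => /(_ isT).
  by rewrite lt_min => /andP[_ /ltW].
apply: h => // x xK; have := hz x; rewrite mem_cat xK => /(_ isT).
by rewrite lt_min => /andP[].
Qed.

(** Each slice is rigid. As types are Lipschitz in [w], with a constant bounded by the
    values at the unit vectors, a finite net of the unit ball of the row vectors
    controls all slices; homogeneity and [type_dist_le] conclude. *)
Lemma gap_isolated xi : (forall w, gap (slice xi w)) -> isolated_type xi.
Proof.
move=> hgap e e0; apply/ptws_nbhsP.
have e4 : 0 < e / 4 by lra.
have e2 : 0 < e / 2 by lra.
have e2e : e / 2 < e by lra.
pose C := \sum_i (val xi (0, delta_mx 0 i) + 1) + 1.
have ge0 zeta i : 0 <= val zeta (0, delta_mx 0 i).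
  have := sublinear_ge (0, delta_mx 0 i) (seminorm_sublinear (type_seminorm zeta)).
  by rewrite (seminormN _ (type_seminorm zeta)) => ?; lra.
have C0 : 0 < C.
  by rewrite /C ltr_wpDl// sumr_ge0// => i _; rewrite addr_ge0.
(* a displacement of [w] by [s] changes the types by at most [e / 8] *)
pose s := e / 8 / C; have s0 : 0 < s by rewrite !divr_gt0.
have [N hN] := finite_net (has_dim_row R n) 1 s0.
have [K [r [r0 hK]]] := slices_near N hgap e4.
exists ([seq (0, delta_mx 0 i) | i <- enum 'I_n] ++ K), (Num.min 1 r).
split; first by rewrite lt_min ltr01.
move=> zeta hz /=.
have hzK : forall w c, w \in N -> `|val zeta (c, w) - val xi (c, w)| <= e / 4.
  apply: hK => x xK; have := hz x; rewrite mem_cat xK orbT => /(_ isT).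
  by rewrite lt_min => /andP[].
have hzB i : val zeta (0, delta_mx 0 i) <= val xi (0, delta_mx 0 i) + 1.
  have := hz (0, delta_mx 0 i); rewrite mem_cat map_f ?mem_enum// => /(_ isT).
  by rewrite lt_min -lerBlDl => /andP[/ltW/(le_trans (ler_norm _))].
have lip (x : ntypes E n) c w v : (forall i, val x (0, delta_mx 0 i) <= val xi (0, delta_mx 0 i) + 1) ->
    `|w - v| <= s -> val x (c, w) <= val x (c, v) + e / 8.
  move=> hx wv; apply: le_trans (type_row_le x c w v) _; rewrite lerD2l.
  apply: le_trans (_ : s * C <= _); last by rewrite /s divfK// gt_eqF.
  apply: le_trans (_ : \sum_i s * (val xi (0, delta_mx 0 i) + 1) <= _).
    apply: ler_sum => i _; rewrite ler_pM// ?ge0//.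
    have := row_coord_le (w - v) i; rewrite !mxE => h.
    exact: le_trans h wv.
  by rewrite -mulr_sumr ler_wpM2l// ?(ltW s0)// /C lerDl.
have xiB i : val xi (0, delta_mx 0 i) <= val xi (0, delta_mx 0 i) + 1 by rewrite lerDl.
have unitw w c : `|w| <= 1 -> `|val xi (c, w) - val zeta (c, w)| <= e / 2.
  move=> w1; have [v vN wv] := hN w w1; have := hzK v c vN.
  have := lip xi c w v xiB wv; have := lip zeta c w v hzB wv.
  rewrite distrC in wv.
  have := lip xi c v w xiB wv; have := lip zeta c v w hzB wv.
  exact: dist_perturb.
apply: le_lt_trans e2e.
apply: type_dist_le => [|c w]; first exact: ltW.
have [->|w0] := eqVneq w 0.
  by rewrite !type_base subrr normr0 mulr_ge0 ?sumr_ge0// ltW.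
have w0' : 0 < `|w| by rewrite normr_gt0.
have -> : (c, w) = `|w| *: (`|w|^-1 *: c, `|w|^-1 *: w).
  by congr pair; rewrite /= scalerA divff ?gt_eqF// scale1r.
rewrite (type_seminorm xi).2 (type_seminorm zeta).2 normr_id -mulrBr normrM normr_id.
apply: le_trans (_ : `|w| * (e / 2) <= _).
  rewrite ler_wpM2l// unitw// normrZ normfV normr_id mulVf ?gt_eqF//.
rewrite mulrC ler_wpM2l//; first exact: ltW.
apply: row_norm_le => [|i]; first by rewrite sumr_ge0.
by rewrite (bigD1 i)//= lerDl sumr_ge0.
Qed.

End Isolation.

Lemma unique_atomic (R : realType) (E G : normedModType R) d (dimE : has_dim E d)
    (i : {linear E -> G}) (hi : isometric i) : unique_extensions i -> atomic hi.
Proof.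
move=> /(unique_extensionsP hi dimE) uE n a; apply: (gap_isolated dimE) => w l u hl u1 lu e e0.
have [x1 [x2 hx]] := extension_gap hi (\sum_j w 0 j *: a j) hl (uE l u hl u1 lu) e0.
exists x1, x2; rewrite /slice /= /tp_fun /= !linearN.
by rewrite [- i x1 + _]addrC [- i x2 + _]addrC.
Qed.

(** * Isolated types give unique extensions *)

Lemma sup_seminorm (R : realType) (V : lmodType R) (J : Type) (P : set J)
    (phi : J -> V -> R) (h : V -> R) : P !=set0 ->
  (forall j, P j -> functional (phi j)) ->
  (forall j v, P j -> `|phi j v| <= h v) ->
  let N v := sup [set `|phi j v| | j in P] in
  [/\ seminorm N, forall j v, P j -> `|phi j v| <= N v &
      forall v M, (forall j, P j -> `|phi j v| <= M) -> N v <= M].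
Proof.
move=> [j0 Pj0] fphi hphi N.
have Nge j v : P j -> `|phi j v| <= N v.
  move=> Pj; apply: ub_le_sup; last by exists j.
  by exists (h v) => _ [k Pk <-]; exact: hphi.
have Nle v M : (forall j, P j -> `|phi j v| <= M) -> N v <= M.
  move=> hM; apply: ge_sup; first by exists `|phi j0 v|, j0.
  by move=> _ [k Pk <-]; exact: hM.
have N0 v : 0 <= N v by apply: le_trans (Nge j0 v Pj0).
have NZ c v : N (c *: v) <= `|c| * N v.
  apply: Nle => j Pj; rewrite (functionalZ _ _ (fphi j Pj)) normrM.
  by rewrite ler_wpM2l// Nge.
split=> //; split=> [x y|c v].
  apply: Nle => j Pj; rewrite (functionalD _ _ (fphi j Pj)).
  by apply: le_trans (ler_normD _ _) _; rewrite lerD ?Nge.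
apply/eqP; rewrite eq_le NZ /=; have [->|c0] := eqVneq c 0; first by rewrite normr0 mul0r.
have := NZ c^-1 (c *: v); rewrite scalerA mulVf// scale1r normfV.
by rewrite ler_pdivlMl// normr_gt0.
Qed.

Section OneTypes.
Context {R : realType} {E : normedModType R}.
Implicit Types (f g : E -> R) (l m : E -> R).

(** The Katetov inequality separates [sup_y (l y - f y)] from [inf_y (l y + f y)]. *)
Lemma kc_intercept f l : kc f -> dual_unit l ->
  exists s, forall y, `|s - l y| <= f y.
Proof.
move=> [_ _ kf] hl; exists (inf [set l y + f y | y in setT]) => y.
have lo z : l z - f z <= inf [set l y + f y | y in setT].
  apply: lb_le_inf; first by exists (l 0 + f 0), 0.
  move=> _ [w _ <-]; have := kf z w; have := dual_unit_le (z - w) hl.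
  by rewrite (functionalB _ _ hl.1); lra.
have up : inf [set l y + f y | y in setT] <= l y + f y.
  apply: ge_inf; last by exists y.
  exists (l 0 - f 0) => _ [w _ <-]; have := kf 0 w; have := dual_unit_le (0 - w) hl.
  by rewrite (functionalB _ _ hl.1); lra.
by rewrite ler_norml; have := lo y => ?; apply/andP; split; lra.
Qed.

(** The semi-norm is the supremum of [`|l b + c s|] over the pairs [(l, s)] which are
    compatible with [f], that is over the extensions of functionals [l] of norm at most
    one taking the value [s] at the new variable. Subgradients show that its values
    are not too small. *)
Lemma type_of_kc f : kc f -> exists zeta : ntypes E 1,
  forall y, val zeta (- y, const_mx 1) = f y.
Proof.
move=> kf; pose P (j : (E -> R) * R) := dual_unit j.1 /\ forall y, `|j.2 - j.1 y| <= f y.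
pose phi (j : (E -> R) * R) (v : E * 'rV[R]_1) := j.1 v.1 + v.2 0 0 * j.2.
have P0 : exists j, P j.
  have [l hl _] := kc_subgradient 0 kf; have [s hs] := kc_intercept kf hl.
  by exists (l, s).
have [||sN Nge Nle] := @sup_seminorm R (E * 'rV[R]_1)%type _ P phi
  (fun v => `|v.1| + `|v.2 0 0| * f 0) P0.
- move=> [l s] [hl _] a x y; have fl : functional l := hl.1.
  by rewrite /phi /= fl !mxE; ring.
- move=> [l s] v [/= hl /(_ 0)]; rewrite (functional0 hl.1) subr0 => hs.
  apply: le_trans (ler_normD _ _) _; rewrite normrM lerD//; first exact: hl.2.
  by rewrite ler_wpM2l.
set N := (fun v => sup _) in sN Nge Nle.
have Nb b : N (b, 0) = `|b|.
  apply/eqP; rewrite eq_le; apply/andP; split.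
    by apply: Nle => -[l s] [/= hl _]; rewrite /phi /= mxE mul0r addr0; exact: hl.2.
  have [l hl lb] := norming_functional b; have [s hs] := kc_intercept kf hl.
  apply: le_trans (Nge (l, s) (b, 0) _); last by split.
  by rewrite /phi /= mxE mul0r addr0 lb normr_id.
have Nin : (N : {ptws (E * 'rV[R]_1)%type -> R}) \in ntypes E 1 by rewrite inE; split.
exists (exist (fun p : {ptws (E * 'rV[R]_1)%type -> R} => p \in ntypes E 1) N Nin) => y /=; apply/eqP; rewrite eq_le; apply/andP; split.
  apply: Nle => -[l s] [/= hl hs]; rewrite /phi /= mxE mul1r (functionalN _ hl.1) addrC.
  exact: hs.
have [m hm my] := kc_subgradient y kf; have [_ lip kt] := kf.
apply: le_trans (Nge (fopp m, f y - m y) _ _).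
  rewrite /phi /= mxE mul1r /fopp (functionalN _ hm.1) opprK addrC subrK.
  exact: ler_norm.
split; first exact: dual_unitN.
move=> z; rewrite /fopp /= opprK ler_norml; have := my z; rewrite (functionalB _ _ hm.1).
have := dual_unit_le (y - z) hm; rewrite (functionalB _ _ hm.1).
by have := kt y z; move=> ? ? ?; apply/andP; split; lra.
Qed.

Context (d : nat) (dimE : has_dim E d).

(** By [penalty], [m w + k (m u - 1) < c] on the whole dual ball for large [k]; take [m]
    norming [w + k u]. *)
Lemma far_norm (w u : E) (c : R) : `|u| = 1 ->
  (forall m, dual_unit m -> m u = 1 -> m w < c) ->
  exists2 k0, 0 <= k0 & forall k, k0 <= k -> `|w + k *: u| <= c + k.
Proof.
move=> u1 h; have clT : dual_closed [set: E -> R] by move=> m _ [].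
have PhiE m : functional m -> aff (- w, - c) m = c - m w.
  by move=> fm; rewrite /aff /= (functionalN _ fm); ring.
have PsiE m : functional m -> aff (- u, - 1) m = 1 - m u.
  by move=> fm; rewrite /aff /= (functionalN _ fm); ring.
have [||k k0 hk] := penalty dimE clT (@aff_continuous _ _ (- w, - c)) (@aff_continuous _ _ (- u, - 1)).
- move=> m hm _; rewrite PsiE; last exact: hm.1.
  by rewrite subr_ge0 -u1 dual_unit_le.
- move=> m hm _; rewrite PsiE ?PhiE; try exact: hm.1.
  by move=> mu; rewrite subr_gt0; apply: h => //; lra.
exists k => // k' kk'; have [m hm <-] := norming_functional (w + k' *: u).
have := hk k' kk' m hm I; rewrite PsiE ?PhiE; try exact: hm.1.
by rewrite (functionalD _ _ hm.1) (functionalZ _ _ hm.1); lra.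
Qed.

Lemma damped_bound (dl k a b c t : R) : 0 <= dl -> dl <= 1 -> 0 <= k -> 0 <= b ->
  - b <= a -> - 1 <= c -> t + b <= dl * k ->
  t <= (1 - dl) * a + (1 - dl) * (k * c) + k.
Proof.
move=> dl0 dl1 k0 b0 ba c1 tb; have dl1' : 0 <= 1 - dl by rewrite subr_ge0.
have := ler_wpM2l dl1' (ler_wpM2l k0 c1); have := ler_wpM2l dl1' ba.
by have := mulr_ge0 dl0 b0; lra.
Qed.

(** The constraints [f z + eta] at [z] in [X] and [k] at [x + k u], [x - k u] are
    admissible for large [k], by [far_norm] and the bound on the face [m u = 1]. Their
    envelope is at least [f] on [X], as a subgradient of [f] shrunk by the factor
    [1 - dl] satisfies the two far constraints as well. *)
Lemma pinched_kc f (X : seq E) (eta : R) (x u : E) : kc f -> `|u| = 1 -> 0 < eta ->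
  (forall m z, dual_unit m -> m u = 1 -> `|m (x - z)| <= f z) ->
  exists (k : R) g, [/\ kc g, forall z, z \in X -> `|g z - f z| <= eta,
    g (x + k *: u) <= k & g (x - k *: u) <= k].
Proof.
move=> kf u1 eta0 hx.
have chord v : x + v - (x - v) = v + v by rewrite opprB [LHS]addrC addrA subrK.
have /choice[k1 hk1] : forall z, exists k0, forall k, k0 <= k ->
    `|(z - x) + k *: u| <= f z + eta + k.
  move=> z; have [|k0 _ h] := @far_norm (z - x) u (f z + eta) u1; last by exists k0.
  move=> m hm mu; have := hx m z hm mu; rewrite !(functionalB _ _ hm.1) distrC.
  by move=> /(le_trans (ler_norm _)); lra.
have /choice[k2 hk2] : forall z, exists k0, forall k, k0 <= k ->
    `|(x - z) + k *: u| <= f z + eta + k.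
  move=> z; have [|k0 _ h] := @far_norm (x - z) u (f z + eta) u1; last by exists k0.
  by move=> m hm mu; have := hx m z hm mu; move=> /(le_trans (ler_norm _)); lra.
have [D D0 hD] := list_bound (fun z : E => `|z|) X.
(* shrinking a slope by [1 - dl] changes the values on [X] by at most [eta] *)
pose dl := eta / (eta + 2 * D); have den0 : 0 < eta + 2 * D by lra.
have dl0 : 0 < dl by rewrite divr_gt0.
have dl1 : dl <= 1 by rewrite ler_pdivrMr//; lra.
have dlD : dl * (2 * D) <= eta by rewrite /dl mulrAC ler_pdivrMr// ler_wpM2l//; lra.
have [K1 K10 hK1] := list_bound k1 X; have [K2 K20 hK2] := list_bound k2 X.
have [K3 K30 hK3] := list_bound (fun z => f z + `|z - x|) X.
(* [dl k >= f z + `|z - x|] makes room for the two far constraints *)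
pose k := K1 + K2 + K3 / dl.
have K3d : 0 < K3 / dl by rewrite divr_gt0.
have k0 : 0 < k by rewrite /k; lra.
have kK3 : K3 <= dl * k by rewrite mulrC -ler_pdivrMr// /k; lra.
pose p1 := (x + k *: u, k); pose p2 := (x - k *: u, k).
pose L := [:: p1, p2 & [seq (z, f z + eta) | z <- X]].
have LP p : p \in L -> [\/ p = p1, p = p2 | exists2 z, z \in X & p = (z, f z + eta)].
  rewrite !in_cons => /orP[/eqP ->|/orP[/eqP ->|/mapP[z zX ->]]].
  - exact: Or31.
  - exact: Or32.
  - by apply: Or33; exists z.
have A1 z : z \in X -> `|z - (x + k *: u)| <= f z + eta + k.
  move=> zX; rewrite distrC addrAC; apply: hk2; have := hK2 z zX; rewrite /k; lra.
have A2 z : z \in X -> `|z - (x - k *: u)| <= f z + eta + k.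
  move=> zX; rewrite opprB addrA addrAC; apply: hk1; have := hK1 z zX; rewrite /k; lra.
have A3 z z' : `|z - z'| <= f z + eta + (f z' + eta).
  by have [_ _ /(_ z z')] := kf; lra.
have A4 : `|x + k *: u - (x - k *: u)| <= k + k.
  rewrite chord; apply: le_trans (ler_normD _ _) _.
  by rewrite normrZ u1 mulr1 gtr0_norm.
have aL : admissible L.
  move=> p q /LP[->|->|[z zX ->]] /LP[->|->|[z' z'X ->]] /=.
  - by rewrite subrr normr0; lra.
  - exact: A4.
  - by rewrite distrC [leRHS]addrC A1.
  - by rewrite distrC A4.
  - by rewrite subrr normr0; lra.
  - by rewrite distrC [leRHS]addrC A2.
  - exact: A1.
  - exact: A2.
  - exact: A3.
exists k, (envelope L); split.
- exact: envelope_kc.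
- move=> z zX; rewrite ger0_norm ?lerBlDl ?subr_ge0.
    apply: (envelope_node aL (p := (z, f z + eta))).
    by rewrite !in_cons (map_f (fun z => (z, f z + eta)))// !orbT.
  have [m hm mz] := kc_subgradient z kf; have fm := hm.1.
  apply: envelope_ge => //; exists (fun y => (1 - dl) * m y).
    by apply: dual_unitZ => //; rewrite ger0_norm; lra.
  have mu : `|m u| <= 1 by rewrite -u1; exact: hm.2.
  have mzx : - `|z - x| <= m z - m x.
    by rewrite -(functionalB _ _ fm) dual_unit_ge.
  have z3 := hK3 z zX.
  have tail c : - 1 <= c -> f z <= (1 - dl) * (m z - m x) + (1 - dl) * (k * c) + k.
    by move=> c1; apply: (damped_bound (b := `|z - x|)) => //; [exact: ltW|exact: ltW|lra].
  move=> p /LP[->|->|[z' z'X ->]]; rewrite /aff /=.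
  + rewrite (functionalD _ _ fm) (functionalZ _ _ fm).
    move: mu; rewrite ler_norml => /andP[_ mu]; have := tail (- m u).
    by rewrite lerN2 => /(_ mu); lra.
  + rewrite (functionalB _ _ fm) (functionalZ _ _ fm).
    by move: mu; rewrite ler_norml => /andP[mu _]; have := tail _ mu; lra.
  have := mz z'; rewrite (functionalB _ _ fm).
  have : dl * (m z - m z') <= eta.
    apply: le_trans dlD; rewrite ler_wpM2l//; first exact: ltW.
    rewrite -(functionalB _ _ fm); apply: le_trans (dual_unit_le _ hm) _.
    by apply: le_trans (ler_normB _ _) _; have := hD z zX; have := hD z' z'X; lra.
  by lra.
- by apply: (envelope_node aL (p := p1)); rewrite mem_head.
- by apply: (envelope_node aL (p := p2)); rewrite !in_cons eqxx orbT.
Qed.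

End OneTypes.

Section Atomic.
Context {R : realType} {E G : normedModType R} (d : nat) (dimE : has_dim E d).
Context (i : {linear E -> G}) (hi : isometric i).

(** The face [m u = 1] is a simplex. Its vertices [w j] extend to [W j] of norm one on
    [G], and they are independent, so that some [x] has [w j x = W j a]; then
    [w j (x - z) = W j (a - i z)], and convexity passes to the whole face. *)
Lemma facet_interpolation (u : E) (a : G) : proper_faces_simplices E -> `|u| = 1 ->
  exists x, forall m z, dual_unit m -> m u = 1 -> `|m (x - z)| <= `|a - i z|.
Proof.
move=> pfs u1; pose F : set (E -> R^o) := [set m | dual_unit m /\ m u = 1].
have pF : proper_face (dual_ball E) F.
  split; first split.
  - apply/convex_setP => m n t [hm mu] [hn nu] t0 t1; split.
      exact: dual_unit_conv.
    by rewrite !fctE /= mu nu /GRing.scale/=; ring.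
  - by move=> m [hm _]; apply/dual_ballP.
  - move=> m n t /dual_ballP hm /dual_ballP hn t0 t1 [_].
    rewrite !fctE /GRing.scale/= => mnu.
    have mu1 := dual_unit_le u hm; have nu1 := dual_unit_le u hn; rewrite u1 in mu1 nu1.
    by have [mu nu] : m u = 1 /\ n u = 1 by split; nra.
  move=> FB; have : dual_ball E (fun=> 0) by apply/dual_ballP; exact: dual_unit0.
  by rewrite -FB => -[_ /eqP]; rewrite eq_sym oner_eq0.
have [n [w [aw FE]]] := pfs F pF.
have wF j : F (w j) by rewrite FE; apply: sub_hull; exists j.
have /choice[W hW] : forall j, exists L : G -> R, dual_unit L /\ forall x, L (i x) = w j x.
  by move=> j; have [L [hL Li _]] := norm_extension hi a (wF j).1; exists L.
have [x hx] : exists x, forall j, w j x = W j a.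
  apply: (interpolation dimE (w := w : 'I_n -> E -> R)).
    by move=> j; have [[]] := wF j.
  by apply: (affine_independent_independent (u := u)) aw => j; have [] := wF j.
exists x => m z hm mu.
pose H : set (E -> R^o) := [set m | `|m (x - z)| <= `|a - i z|].
suff : F `<=` H by apply.
rewrite FE; apply: hull_min.
  apply/convex_setP => p q t; rewrite /H /= => hp hq t0 t1.
  have t1' : 0 <= 1 - t by rewrite subr_ge0.
  apply: le_trans (ler_normD _ _) _; rewrite !normrM (ger0_norm t0) (ger0_norm t1').
  by have := ler_wpM2l t0 hp; have := ler_wpM2l t1' hq; lra.
move=> _ [j _ <-]; have [[fw _] _] := wF j; have [hWj Wi] := hW j.
rewrite /H /= (functionalB _ _ fw) hx -Wi -(functionalB _ _ hWj.1).
exact: hWj.2.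
Qed.

(** With [f y = `|a - i y|], isolation and [pinched_kc] give [f (x + k u) <= k + e] and
    [f (x - k u) <= k + e]. Applying [L] to the two vectors bounds [L a - L (i x)] by [e]
    from both sides. *)
Lemma isolated_determined (u : E) (a : G) : proper_faces_simplices E -> `|u| = 1 ->
  isolated_type (tp hi (fun=> a : G) : ntypes E 1) ->
  exists x, forall L, dual_unit L -> L (i u) = 1 -> L a = L (i x).
Proof.
move=> pfs u1 iso; have [x hx] := facet_interpolation a pfs u1.
exists x => L hL Lu; have fL := hL.1.
suff h e : 0 < e -> `|L a - L (i x)| <= e.
  apply/eqP; rewrite -subr_eq0 -normr_le0; apply/ler_addgt0Pr => e e0.
  by rewrite add0r h.
move=> e0; have /ptws_nbhsP[K [r [r0 hK]]] := iso e e0.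
have kf := dist_kc hi a; set f := (fun y => _) in kf.
have xiE y : val (tp hi (fun=> a : G) : ntypes E 1) (- y, const_mx 1) = f y.
  by rewrite /= /tp_fun /= big_ord1 mxE scale1r linearN addrC.
have [M M0 hM] := list_bound (fun p : E * 'rV[R]_1 => `|p.2 0 0|) K.
have eta0 : 0 < r / (2 * M) by rewrite divr_gt0// mulr_gt0.
have [k [g [kg gX g1 g2]]] :=
  pinched_kc dimE [seq - ((p.2 0 0)^-1 *: p.1) | p : E * 'rV[R]_1 <- K] kf u1 eta0 hx.
have [zeta hzeta] := type_of_kc kg.
have dz : type_dist (tp hi (fun=> a : G) : ntypes E 1) zeta < e.
  apply: hK => -[b w] pK; set c := w 0 0; have [c0|c0] := eqVneq c 0.
    have -> : w = 0 by apply/rowP => j; rewrite ord1 mxE.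
    by rewrite !type_base subrr normr0.
  have -> : (b, w) = c *: (- - (c^-1 *: b), const_mx 1).
    congr pair; first by rewrite /= opprK scalerA divff// scale1r.
    by apply/rowP => j; rewrite ord1 !mxE mulr1.
  rewrite (type_seminorm zeta).2 (type_seminorm (tp hi _)).2 hzeta xiE -mulrBr.
  rewrite normrM normr_id; apply: le_lt_trans (_ : M * (r / (2 * M)) < _).
    by rewrite ler_pM//; [exact: (hM _ pK)|exact: gX (map_f _ pK)].
  have -> : M * (r / (2 * M)) = r / 2 by field; rewrite gt_eqF.
  by lra.
have fg y : f y <= g y + e.
  have := type_dist_close (- y) (const_mx 1) dz; rewrite xiE hzeta big_ord1 mxE normr1 mulr1.
  by rewrite ler_norml => /andP[_ ?]; lra.
have f1 := fg (x + k *: u); have f2 := fg (x - k *: u).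
have := dual_unit_ge (a - i (x + k *: u)) hL; rewrite -/(f _).
have := dual_unit_le (a - i (x - k *: u)) hL; rewrite -/(f _).
rewrite !(functionalB _ _ fL) !linearD linearN linearZ !(functionalD _ _ fL).
rewrite (functionalN _ fL) (functionalZ _ _ fL) Lu mulr1.
move: f1 f2 g1 g2; clear => f1 f2 g1 g2 h1 h2.
by rewrite ler_norml; apply/andP; split; lra.
Qed.

Lemma atomic_unique : proper_faces_simplices E -> atomic hi -> unique_extensions i.
Proof.
move=> pfs at_i; apply/(unique_extensionsP hi dimE) => l u hl u1 lu L L' hL hL' Li L'i.
apply/funext => a.
have [x hx] := isolated_determined pfs u1 (at_i 1%N (fun=> a)).
by rewrite (hx L)// ?Li// (hx L')// L'i.
Qed.

Lemma norming_dual_unit (F : normedModType R) (v : F) (l : F -> R^o) :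
  norming v l -> dual_unit l.
Proof. by move=> [dl l1 _]; apply/dual_ballP; split=> //; rewrite l1. Qed.

Lemma norming_normalised (F : normedModType R) (v : F) (l : F -> R^o) : v != 0 ->
  dual_unit l -> l v = `|v| -> norming v l.
Proof.
move=> v0 hl lv; have v0' : `|v| != 0 by rewrite normr_eq0.
have [||dl l1 _] := @norming_unit _ _ l (`|v|^-1 *: v) hl.
- by rewrite normrZ normfV normr_id mulVf.
- by rewrite (functionalZ _ _ hl.1) lv mulVf.
by split.
Qed.

(** A functional norming [i v] is the same thing as an extension, of norm one, of a
    functional norming [v], and the latter is unique as [E] is smooth. *)
Lemma smooth_unique_extensions : smooth_space E ->
  unique_extensions i <-> forall v, v != 0 -> smooth_at (i v).
Proof.
move=> sE; split=> [/(unique_extensionsP hi dimE) uE v v0|sG].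
  have iv0 : i v != 0 by rewrite -normr_gt0 hi normr_gt0.
  have v0' : `|v| != 0 by rewrite normr_eq0.
  have [l hl lv] := norming_functional v.
  have [L [hL Li _]] := norm_extension hi 0 hl.
  exists L; split; first by apply: norming_normalised => //; rewrite Li lv hi.
  move=> L' nL'; have hL' := norming_dual_unit nL'; have [_ _ L'v] := nL'.
  have hl' : dual_unit (fun x => L' (i x)).
    by split=> [a x y|x]; [rewrite linearP hL'.1|rewrite -hi; exact: hL'.2].
  have [m [_ um]] := sE v v0.
  have ml : m = l by apply: um; exact: norming_normalised.
  have ml' : m = (fun x => L' (i x)).
    by apply: um; apply: norming_normalised => //; rewrite L'v hi.
  apply: (uE l (`|v|^-1 *: v)) => //.
  - by rewrite normrZ normfV normr_id mulVf.
  - by rewrite (functionalZ _ _ hl.1) lv mulVf.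
  - by move=> x; rewrite -ml ml'.
apply/(unique_extensionsP hi dimE) => l u hl u1 lu L L' hL hL' Li L'i.
have u0 : u != 0 by rewrite -normr_eq0 u1 oner_eq0.
have iu0 : i u != 0 by rewrite -normr_gt0 hi u1.
have [m [_ um]] := sG u u0.
have <- : m = L by apply: um; apply: norming_normalised => //; rewrite Li lu hi u1.
by apply: um; apply: norming_normalised => //; rewrite L'i lu hi u1.
Qed.

End Atomic.

Theorem theorem6p4 (R : realType) (E : normedModType R) (d : nat)
    (dimE : has_dim E d) :
  (small_faces_simplices E d \/ polyhedral E ->
     dense (isolated_KC E))
  /\
  ((d <= 3)%N -> small_faces_simplices E d)
  /\
  (proper_faces_simplices E -> small_faces_simplices E d)
  /\
  ((d <= 2)%N -> proper_faces_simplices E)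
  /\
  (proper_faces_simplices E ->
     forall G : completeNormedModType R, gurarij G -> separable_space G ->
     forall (i : {linear E -> G}) (hi : isometric i),
       atomic hi <-> unique_extensions i)
  /\
  (smooth_space E -> small_faces_simplices E d)
  /\
  (smooth_space E ->
     forall G : completeNormedModType R, gurarij G -> separable_space G ->
     forall (i : {linear E -> G}) (hi : isometric i),
       atomic hi <-> (forall v : E, v != 0 -> smooth_at (i v))).
Proof.
have atomicE (G : completeNormedModType R) (i : {linear E -> G}) (hi : isometric i) :
    proper_faces_simplices E -> atomic hi <-> unique_extensions i.
  by move=> pfs; split; [exact: (atomic_unique dimE pfs)|exact: (unique_atomic dimE)].
split; first exact: isolated_dense.
split; first exact: low_dim_small_faces.
split; first exact: proper_small_faces.
split; first exact: low_dim_proper_faces.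
split; first by move=> pfs G _ _ i hi; exact: atomicE.
split; first by move=> sE; exact: (proper_small_faces dimE (smooth_proper_faces dimE sE)).
move=> sE G _ _ i hi; rewrite atomicE; last exact: (smooth_proper_faces dimE sE).
exact: (smooth_unique_extensions dimE hi sE).
Qed.
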